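(* Let $X_1,\dots,X_n$ be random row vectors in $\mathbb R^d$ (with arbitrary joint distribution) satisfying the orthant symmetry condition. Let $c=2e^3/9$, and let $x_d(\delta)$ and $\tilde x_d(\delta)$, $0<\delta<1$, be the $\delta$-quantiles of $\chi_d$ and $n^{1/2}R$, respectively, as defined in the context. If $\delta\le 0.5$, then $x_d(\delta)>(d-1)^{1/2}$ and $$\begin{aligned}\tilde x_d(\delta)&<x_d(\delta/c)\\&<x_d(\delta)+\bigl[x_d(\delta)-(d-1)/x_d(\delta)\bigr]^{-1}\log c\\&<x_d(\delta)+\bigl[x_d(\delta)-(d-1)^{1/2}\bigr]^{-1}\log c\\&<x_d(\delta)+o(1)\\&<x_d(\delta)\bigl(1+d^{-1/2}\cdot o(1)\bigr)\\&<x_d(\delta)\bigl(1+o(1)\bigr),\end{aligned}$$ where $o(1)\to0$ uniformly in $d,n,X_1,\dots,X_n$ when $\delta\downarrow0$.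
   Context: Orthant symmetry condition: $(X_1,\dots,X_n)$ has the same joint distribution as $(\epsilon_1X_1,\dots,\epsilon_nX_n)$, where $\epsilon_1,\dots,\epsilon_n$ are i.i.d., independent of $(X_1,\dots,X_n)$, with $\mathbf P(\epsilon_i=1)=\mathbf P(\epsilon_i=-1)=\frac12$. Statistic: $\overline X=\frac1n\sum_{i=1}^nX_i$, $S=\frac1n\sum_{i=1}^nX_i^TX_i$ (a $d\times d$ matrix), $R^2=\lim_{\varepsilon\downarrow0}\overline X(S+\varepsilon I)^{-1}\overline X^T$ (the limit always exists), $R=(R^2)^{1/2}$. Equivalently, $nR^2=\nu^TP\nu$, where $\nu=(1,\dots,1)^T\in\mathbb R^n$ and $P$ is the matrix of the orthogonal projector of $\mathbb R^n$ onto the column space of the $n\times d$ matrix whose $i$th row is $X_i$. $\chi_d$ denotes the nonnegative square root of a random variable having the chi-square distribution with $d$ degrees of freedom. For $0<\delta<1$, $x_d(\delta)$ is defined by $\mathbf P(\chi_d\ge x_d(\delta))=\delta$, and $\tilde x_d(\delta)=\inf\{x\in\mathbb R:\mathbf P(n^{1/2}R\ge x)\le\delta\}$. The different occurrences of $o(1)$ need not denote the same quantity.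
   Formalization: For d = 1 the third strict inequality of the chain is false, since (d-1)/x_d(δ) = (d-1)^{1/2} = 0 makes both sides equal; it is stated with ≤ when d = 1 and remains strict for all d ≥ 2. *)

(* Defs.v *)
From HB Require Import structures.
From mathcomp Require Import all_boot all_order all_algebra.
From mathcomp Require Import all_classical all_reals all_analysis.
From mathcomp Require Import measurable_realfun.

Set Implicit Arguments.
Unset Strict Implicit.
Unset Printing Implicit Defensive.

Import Order.TTheory GRing.Theory Num.Theory.
Import numFieldNormedType.Exports.

Local Open Scope classical_set_scope.
Local Open Scope ring_scope.

(* Matrices carry the product sigma-algebra, generated by the entries. *)
Section measurable_matrix.
Context {R : realType} (m n : nat).

Definition entry_cylinders : set (set 'M[R]_(m, n)) :=
  [set A | exists i j, exists2 B : set R,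
     measurable B & A = [set M : 'M[R]_(m, n) | B (M i j)]].

Let mx_set0 : <<s entry_cylinders >> set0.
Proof. exact: sigma_algebra0. Qed.

Let mx_setC A : <<s entry_cylinders >> A -> <<s entry_cylinders >> (~` A).
Proof. exact: sigma_algebraC. Qed.

Let mx_bigcup (F : (set 'M[R]_(m, n))^nat) :
  (forall k, <<s entry_cylinders >> (F k)) ->
  <<s entry_cylinders >> (\bigcup_k F k).
Proof. exact: sigma_algebra_bigcup. Qed.

HB.instance Definition _ := @isMeasurable.Build default_measure_display
  'M[R]_(m, n) <<s entry_cylinders >> mx_set0 mx_setC mx_bigcup.

End measurable_matrix.

Section orthant_symmetry.
Context {R : realType} {n d : nat}.

Definition same_joint_law d1 (T1 : measurableType d1) (P1 : probability T1 R)
    (X1 : 'I_n -> T1 -> 'rV[R]_d)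
    d2 (T2 : measurableType d2) (P2 : probability T2 R)
    (X2 : 'I_n -> T2 -> 'rV[R]_d) : Prop :=
  forall B : set (n.-tuple 'rV[R]_d), measurable B ->
    P1 [set w | B [tuple X1 i w | i < n]] = P2 [set w | B [tuple X2 i w | i < n]].

Definition rademacher dT (T : measurableType dT) (P : probability T R)
    (e : {RV P >-> R}) : Prop :=
  P [set w | e w = 1] = (2^-1)%:E /\ P [set w | e w = -1] = (2^-1)%:E.

(* Mutual independence of the n + 1 random elements (X_1, ..., X_n),
   e_1, ..., e_n; taking some of the events to be setT yields the product rule
   for subfamilies. *)
Definition signs_independent dT (T : measurableType dT) (P : probability T R)
    (X : 'I_n -> {RV P >-> 'rV[R]_d}) (e : 'I_n -> {RV P >-> R}) : Prop :=
  forall (B : set (n.-tuple 'rV[R]_d)) (A : 'I_n -> set R),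
    measurable B -> (forall i, measurable (A i)) ->
    P [set w | B [tuple X i w | i < n] /\ forall i, A i (e i w)] =
    (P [set w | B [tuple X i w | i < n]] *
     \prod_(i < n) P [set w | A i (e i w)])%E.

(* The space carrying X need not be rich enough to support independent signs,
   so they may live, together with a copy Y of X, on another one. *)
Definition orthant_symmetric dT (T : measurableType dT) (P : probability T R)
    (X : 'I_n -> {RV P >-> 'rV[R]_d}) : Prop :=
  exists (dU : measure_display) (U : measurableType dU) (Q : probability U R)
         (Y : 'I_n -> {RV Q >-> 'rV[R]_d}) (e : 'I_n -> {RV Q >-> R}),
    [/\ same_joint_law P X Q Y,
        forall i, rademacher (e i),
        signs_independent Y e &
        same_joint_law P X Q (fun i w => e i w *: Y i w)].

End orthant_symmetry.

Record orthant_sample (R : realType) := OrthantSample {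
  dimension : nat;
  sample_size : nat;
  display : measure_display;
  space : measurableType display;
  law : probability space R;
  observation : 'I_sample_size -> {RV law >-> 'rV[R]_dimension};
  dimension_gt0 : (0 < dimension)%N;
  sample_size_gt0 : (0 < sample_size)%N;
  observation_symmetric : orthant_symmetric observation }.

Section statistic.
Context {R : realType} {n d : nat} (x : 'I_n -> 'rV[R]_d).

Definition sample_mean : 'rV[R]_d := n%:R^-1 *: \sum_(i < n) x i.

Definition sample_second_moment : 'M[R]_d :=
  n%:R^-1 *: \sum_(i < n) ((x i)^T *m x i).

Definition R_squared : R :=
  lim ((sample_mean *m invmx (sample_second_moment + t%:M)
          *m sample_mean^T) 0 0 @[t --> 0^'+]).

Definition R_statistic : R := Num.sqrt R_squared.

End statistic.

Section chi.
Context {R : realType}.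

(* normal_prob is a measure on measurableTypeR R, whose sigma-algebra is the
   Borel sigma-algebra of R under a different display. *)
Definition add_square (p : R * measurableTypeR R) : R :=
  p.1 + (p.2 : R) ^+ 2.

Lemma measurable_add_square :
  measurable_fun [set: R * measurableTypeR R] add_square.
Proof.
apply: measurable_funD; first exact: measurable_fst.
apply: (measurable_funX (f := snd : R * measurableTypeR R -> R)).
exact: measurable_snd.
Qed.

HB.instance Definition _ :=
  isMeasurableFun.Build _ _ _ _ add_square measurable_add_square.

(* The law of Z_1^2 + ... + Z_d^2, for Z_i i.i.d. standard normal. *)
Fixpoint chi_square (d : nat) : probability R R :=
  if d is d'.+1 then
    distribution (chi_square d' \x normal_prob (0 : R) 1)%E add_square
  else \d_(0 : R).

(* P(chi_d >= x) *)
Definition chi_tail (d : nat) (x : R) : \bar R :=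
  chi_square d [set u | x <= Num.sqrt u].

(* The x such that P(chi_d >= x) = delta (unique if 0 < d and 0 < delta < 1). *)
Definition chi_quantile (d : nat) (delta : R) : R :=
  xget 0 [set x | chi_tail d x = delta%:E].

End chi.

Section sample_quantile.
Context {R : realType}.

Definition stat_quantile (s : orthant_sample R) (delta : R) : R :=
  inf [set x : R |
    (law s [set w | (x <= Num.sqrt (sample_size s)%:R
                          * R_statistic (fun i => observation (o:=s) i w))%R]
     <= delta%:E)%E].

Definition uniform_o1 (o : orthant_sample R -> R -> R) : Prop :=
  forall eps : R, 0 < eps ->
    \forall delta \near 0^'+, forall s, `|o s delta| < eps.

End sample_quantile.

(* Main.v *)
Require Import Defs.
From HB Require Import structures.
From mathcomp Require Import all_boot all_order all_algebra.
From mathcomp Require Import all_classical all_reals all_analysis.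
From mathcomp Require Import measurable_realfun ring lra.
Import Order.TTheory GRing.Theory Num.Theory.
Import numFieldNormedType.Exports.
Local Open Scope classical_set_scope.
Local Open Scope ring_scope.
Set Implicit Arguments.
Unset Strict Implicit.
Unset Printing Implicit Defensive.

(** Fix [y > 0] and let [q] be the tail of the chi distribution with [d] degrees of
    freedom. The main point is the bound [c * q y] for the probability that [n^(1/2) R]
    is at least [y]; at [y = chi_quantile d (delta / c)] it equals [delta], which gives
    the first inequality of the chain.

    By orthant symmetry it suffices to bound, for fixed rows [x_1, ..., x_n], the
    proportion of sign patterns [e] for which the statistic of [(e_i x_i)] is large
    ([orthant_tail]). Signs do not change the second moment, and in an orthonormal frame
    of the column space the statistic [n^(1/2) R] is the length of [sum_i e_i a_i], where
    the vectors [a_i] live in dimension [m <= d] and the matrices [a_i^T a_i] add up to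
    the identity ([orthonormal_frame]).

    Such lengths are compared with Gaussian ones through test functions. If
    [f (s + z a) + f (s - z a)] lies above a parabola in [z] that touches it at [z = 1],
    then replacing a random sign by a standard Gaussian coefficient, which has the same
    mean square, can only increase the average of [f]; the property is inherited by
    partial averages, so all signs can be replaced ([sign_averages_lt]). By rotation
    invariance the Gaussian average of a function of the length is a chi-square integral
    ([gaussian_averages_chi_square]), monotone in the number of degrees of freedom.
    The test functions are the positive cubes [(|v|^2 - tau)_+^3], and [(|v| - t)_+^3] with
    [t >= 0] in dimension one; for these the parabola exists because the symmetrised
    function is convex in [z^2] ([cube_pair_strict_support]).

    Markov's inequality then requires the integral of a positive cube against the chi
    distribution. The tail [q] is logarithmically concave in [r^2] for [d >= 2] and in [r]
    for [d = 1], hence dominated by the exponential function that touches it at [y]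
    ([hazard_domination]), and the cubic moment of an exponential tail is explicit.
    Optimising the threshold produces the factor [6 e^3 / 27 = c]
    ([exponential_majorant]). In dimension one the optimal [t] is nonnegative as soon as
    [q y <= 9 / (4 e^3) = 1 / (2 c)] ([chi1_hazard_ge3]), that is, in the range
    [delta <= 1 / 2]. The comparison is strict, the number of sign patterns is an integer,
    and probabilities are continuous along decreasing events, so the quantile itself is
    strictly smaller ([stat_quantile_lt]).

    The other inequalities concern the chi distribution alone. Its mode [(d - 1)^(1/2)]
    lies below its median because reflection at the mode increases the density
    ([chi_q_mode_gt]). Beyond [x] a shift by [h] multiplies the density, hence the tail, by
    less than [exp (- (x - (d - 1) / x) h)] ([chi_q_shift_lt]). Finally the tail at
    distance [M] beyond the mode has a lower bound independent of [d] ([chi_q_mode_lb]), so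
    [x - (d - 1)^(1/2)] tends to infinity uniformly as [delta] tends to zero. *)

(** * Rotation invariance of the standard Gaussian law *)

Section affine_substitution.
Context {R : realType}.
Local Notation mu := (@lebesgue_measure R).
Local Open Scope ereal_scope.

(** Both sides are integrals of [f] against multiples of measures that agree on
    half-open intervals, and such measures are equal to the Lebesgue measure. *)
Lemma ge0_integral_affine (f : R -> \bar R) (a b : R) :
  measurable_fun [set: R] f -> (forall r, 0 <= f r) -> (0 < a)%R ->
  a%:E * \int[mu]_r f (a * r + b)%R = \int[mu]_r f r.
Proof.
move=> mf f0 a0.
pose phi : measurableTypeR R -> measurableTypeR R := fun x => (a * x + b)%R.
have mphi : measurable_fun [set: measurableTypeR R] phi.
  by apply: measurable_funD => //; exact: measurable_funM.
pose c : {nonneg R} := NngNum (ltW a0).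
have cE : c%:num = a by [].
have /= H := @ge0_integral_pushforward _ _ _ _ R phi mphi mu setT f measurableT mf (fun x _ => f0 x).
rewrite preimage_setT in H; rewrite -[X in _ * X]H.
have -> : a%:E = c%:num%:E by [].
rewrite -ge0_integral_mscale//.
apply: eq_measure_integral => A mA _; symmetry.
apply: lebesgue_measure_unique => // _ [[x y]] _ <-.
transitivity (c%:num%:E * mu (phi @^-1` `]x, y]%classic)); last by [].
have -> : phi @^-1` `]x, y]%classic = `]((x - b) / a)%R, ((y - b) / a)%R]%classic.
  apply/seteqP; split => r /=; rewrite !in_itv/= /phi.
    by move=> /andP[h1 h2]; rewrite ltr_pdivrMr// ler_pdivlMr//; apply/andP; split; lra.
  by rewrite ltr_pdivrMr// ler_pdivlMr// => /andP[h1 h2]; apply/andP; split; lra.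
rewrite !lebesgue_measure_itv/= !lte_fin ltr_pM2r ?invr_gt0// ltrD2r.
case: ifPn => xy; last by rewrite mule0.
by rewrite -!EFinD -EFinM; congr EFin; field; rewrite gt_eqF.
Qed.

End affine_substitution.

Section density.
Local Open Scope ereal_scope.
Context d (T : measurableType d) (R : realType).
Variables (mu nu : {measure set T -> \bar R}) (g : T -> R).
Hypotheses (mg : measurable_fun setT g) (g0 : forall x, (0 <= g x)%R).
Hypothesis nuE : forall A, measurable A -> nu A = \int[mu]_(x in A) (g x)%:E.

Import HBNNSimple.

(** Both sides are compatible with monotone limits, so the hypothesis on sets, which
    settles indicators, extends to simple functions and then to [f]. *)
Lemma ge0_integral_density (f : T -> \bar R) :
  measurable_fun setT f -> (forall x, 0 <= f x) ->
  \int[nu]_x f x = \int[mu]_x (f x * (g x)%:E).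
Proof.
move=> mf f0.
pose f_ := nnsfun_approx measurableT mf.
have fE x : f x = limn (fun n => (f_ n x)%:E).
  by apply/esym/cvg_lim => //; exact: cvg_nnsfun_approx.
have ndf x m n : (m <= n)%N -> (f_ m x <= f_ n x)%R.
  by move=> mn; exact/lefP/nd_nnsfun_approx.
transitivity (limn (fun n => \int[nu]_x (f_ n x)%:E)).
  rewrite -monotone_convergence//.
  - by apply: eq_integral => x _.
  - by move=> n; exact/measurable_EFinP/measurable_funTS.
  - by move=> n x _; rewrite lee_fin.
  - by move=> x _ m n mn; rewrite lee_fin; exact: ndf.
transitivity (limn (fun n => \int[mu]_x ((f_ n x)%:E * (g x)%:E))); last first.
  rewrite -monotone_convergence//.
  - apply: eq_integral => x _; apply: cvg_lim => //.
    apply: cvgeZr => //; exact: cvg_nnsfun_approx.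
  - by move=> n; apply/measurable_EFinP/measurable_funM.
  - by move=> n x _; rewrite lee_fin mulr_ge0.
  - by move=> x _ m n mn; rewrite lee_fin ler_wpM2r//; exact: ndf.
congr (limn _); apply/funext => n.
under eq_integral do rewrite fimfunE -fsumEFin//.
rewrite ge0_integral_fsum//; last 2 first.
- by move=> r; exact/measurable_EFinP/measurableT_comp.
- by move=> r x _; rewrite EFinM nnfun_muleindic_ge0.
under [in RHS]eq_integral => x _.
  rewrite fimfunE -fsumEFin// ge0_mule_fsuml; last first.
    by move=> r; rewrite EFinM nnfun_muleindic_ge0.
  over.
rewrite ge0_integral_fsum//; last 2 first.
- move=> r; apply/measurable_EFinP/measurable_funM => //.
  by apply/measurable_funM => //; exact: measurableT_comp.
- move=> r x _; apply: mule_ge0; last by rewrite lee_fin.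
  by rewrite EFinM nnfun_muleindic_ge0.
apply: eq_fsbigr => r _.
have [r0|r0] := ltP r 0%R.
  rewrite preimage_nnfun0//.
  by rewrite !integral0_eq// => x _; rewrite indic0 mulr0// mul0e.
under eq_integral do rewrite EFinM.
under [in RHS]eq_integral do rewrite EFinM -muleA.
rewrite ge0_integralZl//; last exact/measurable_EFinP.
rewrite ge0_integralZl//; last 2 first.
- by apply/measurable_EFinP/measurable_funM.
- by move=> x _; rewrite mule_ge0 ?lee_fin.
rewrite integral_indic// setIT nuE//; congr (_ * _).
rewrite [LHS]integral_mkcond; apply: eq_integral => x _.
by rewrite patchE indicE; case: (x \in _); rewrite ?mul1e ?mul0e.
Qed.

End density.

Section gaussian_measure.
Local Open Scope ereal_scope.
Context {R : realType}.
Local Notation mu := (@lebesgue_measure R).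

Definition gaussian : probability (measurableTypeR R) R := normal_prob (0 : R) 1.

Definition gaussian_pdf (x : R) : R := normal_pdf 0 1 x.

Lemma gaussian_pdfE x : gaussian_pdf x = (normal_peak 1 * expR (- (x ^+ 2 / 2)))%R.
Proof.
rewrite /gaussian_pdf normal_pdfE ?oner_eq0// /normal_fun subr0 expr1n.
by congr (_ * expR _)%R; rewrite mulNr.
Qed.

Lemma gaussian_pdf_ge0 x : (0 <= gaussian_pdf x)%R.
Proof. exact: normal_pdf_ge0. Qed.

Lemma measurable_gaussian_pdf : measurable_fun [set: R] gaussian_pdf.
Proof. exact: measurable_normal_pdf. Qed.

Lemma measurable_gaussian_pdfE :
  measurable_fun [set: measurableTypeR R] (fun x : R => (gaussian_pdf x)%:E).
Proof. by apply/measurable_EFinP; exact: measurable_gaussian_pdf. Qed.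

Lemma integral_gaussian (f : R -> \bar R) :
  measurable_fun [set: R] f -> (forall x, 0 <= f x) ->
  \int[gaussian]_x f x = \int[mu]_x (f x * (gaussian_pdf x)%:E).
Proof.
move=> mf f0.
rewrite (@ge0_integral_density _ (measurableTypeR R) R mu gaussian gaussian_pdf)//.
  exact: measurable_normal_pdf.
exact: gaussian_pdf_ge0.
Qed.

(** For fixed [y] the shear is a translation in [x], which preserves the Lebesgue
    measure; Tonelli's theorem makes [x] the inner variable. *)
Lemma integral_shear (a : R) (h : R * R -> \bar R) :
  measurable_fun [set: measurableTypeR R * measurableTypeR R] h -> (forall p, 0 <= h p) ->
  \int[mu]_x \int[mu]_y h (x + a * y, y)%R = \int[mu]_x \int[mu]_y h (x, y).
Proof.
move=> mh h0.
pose k (p : measurableTypeR R * measurableTypeR R) := h (p.1 + a * p.2, p.2)%R.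
have mk : measurable_fun setT k.
  apply: measurableT_comp => //; apply: measurable_fun_pair => //.
  apply: measurable_funD; first exact: measurable_fst.
  by apply: measurable_funM => //; exact: measurable_snd.
transitivity (\int[mu]_x \int[mu]_y k (x, y)); first by [].
rewrite (@fubini_tonelli _ _ _ _ R mu mu k)//.
rewrite (@fubini_tonelli _ _ _ _ R mu mu h)//.
apply: eq_integral => y _; rewrite /k/=.
have := @ge0_integral_affine R (fun x => h (x, y)) 1 (a * y).
under eq_integral do rewrite mul1r.
rewrite mul1e; apply => //.
exact: (@measurable_fun_pair1 _ _ _ (measurableTypeR R) (measurableTypeR R) _ h y).
by move=> v; exact: h0.
Qed.

Lemma integral_shear2 (a : R) (h : R * R -> \bar R) :
  measurable_fun [set: measurableTypeR R * measurableTypeR R] h -> (forall p, 0 <= h p) ->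
  \int[mu]_x \int[mu]_y h (x, y + a * x)%R = \int[mu]_x \int[mu]_y h (x, y).
Proof.
move=> mh h0; apply: eq_integral => x _.
have := @ge0_integral_affine R (fun y => h (x, y)) 1 (a * x).
under eq_integral do rewrite mul1r.
rewrite mul1e; apply => //.
exact: (@measurable_fun_pair2 _ _ _ (measurableTypeR R) (measurableTypeR R) _ h x).
Qed.

(** A rotation is the product of three shears, with the tangent of the half angle as
    the outer coefficient. The hypothesis [0 <= c] keeps the half angle away from a
    right angle, where this factorisation breaks down; it costs nothing in the
    elimination of coordinates below, where [(c, s)] may be replaced by its opposite. *)
Lemma integral_rotation (c s : R) (h : R * R -> \bar R) :
  measurable_fun [set: measurableTypeR R * measurableTypeR R] h -> (forall p, 0 <= h p) ->
  (c ^+ 2 + s ^+ 2 = 1)%R -> (0 <= c)%R ->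
  \int[mu]_x \int[mu]_y h (c * x + s * y, - s * x + c * y)%R = \int[mu]_x \int[mu]_y h (x, y).
Proof.
move=> mh h0 cs c0.
have c1 : (1 + c != 0)%R by rewrite gt_eqF// ltr_wpDr.
(* the tangent of half the angle, so that [p * (1 + c) = s] and [p * s = 1 - c] *)
pose p := (s / (1 + c))%R.
have pE : (p * (1 + c) = s)%R by rewrite /p divfK.
have psE : (p * s = 1 - c)%R.
  by apply: (mulIf c1); rewrite mulrAC pE mulrDr mulr1; move: cs; rewrite !expr2; lra.
pose h1 (v : measurableTypeR R * measurableTypeR R) := h (v.1 + p * v.2, v.2)%R.
pose h2 (v : measurableTypeR R * measurableTypeR R) := h1 (v.1, v.2 + (- s) * v.1)%R.
have mh1 : measurable_fun setT h1.
  apply: measurableT_comp => //; apply: measurable_fun_pair => //.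
  apply: measurable_funD; first exact: measurable_fst.
  by apply: measurable_funM => //; exact: measurable_snd.
have mh2 : measurable_fun setT h2.
  apply: measurableT_comp => //; apply: measurable_fun_pair => //.
  apply: measurable_funD; first exact: measurable_snd.
  by apply: measurable_funM => //; exact: measurable_fst.
transitivity (\int[mu]_x \int[mu]_y h2 (x + p * y, y)%R); last first.
  rewrite (integral_shear p mh2 (fun v => h0 _)).
  transitivity (\int[mu]_x \int[mu]_y h1 (x, y)%R); last exact: (integral_shear p mh h0).
  exact: (integral_shear2 (- s) mh1 (fun v => h0 _)).
apply: eq_integral => x _; apply: eq_integral => y _.
rewrite /h2 /h1/=; congr (h (_, _)).
  transitivity ((1 - p * s) * x + (p + p * (1 - p * s)) * y)%R; last by ring.
  rewrite psE (_ : 1 - (1 - c) = c)%R; last by ring.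
  by rewrite -[X in (_ = _ + (X + _) * _)%R]mulr1 -mulrDr pE.
transitivity ((- s) * x + (1 - p * s) * y)%R; last by ring.
by rewrite psE; congr (_ + _ * _)%R; ring.
Qed.

Lemma gaussian_pdfM x y x' y' : (x ^+ 2 + y ^+ 2 = x' ^+ 2 + y' ^+ 2)%R ->
  (gaussian_pdf x * gaussian_pdf y = gaussian_pdf x' * gaussian_pdf y')%R.
Proof.
move=> e; rewrite !gaussian_pdfE.
have E u v : (normal_peak 1 * expR (- (u / 2)) * (normal_peak 1 * expR (- (v / 2))) =
    normal_peak 1 * normal_peak 1 * expR (- ((u + v) / 2)) :> R)%R.
  by rewrite mulrACA -expRD; congr (_ * expR _)%R; lra.
by rewrite !E e.
Qed.

Lemma integral_gaussian2 (h : R * R -> \bar R) :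
  measurable_fun [set: measurableTypeR R * measurableTypeR R] h -> (forall p, 0 <= h p) ->
  \int[gaussian]_x \int[gaussian]_y h (x, y) =
  \int[mu]_x \int[mu]_y (h (x, y) * (gaussian_pdf x * gaussian_pdf y)%:E).
Proof.
move=> mh h0.
rewrite integral_gaussian; last 2 first.
- exact: (@measurable_fun_fubini_tonelli_F _ _ (measurableTypeR R) (measurableTypeR R) _ gaussian h).
- by move=> x; exact: integral_ge0.
have mhx x : measurable_fun [set: R] (fun y => h (x, y)).
  exact: (@measurable_fun_pair2 _ _ _ (measurableTypeR R) (measurableTypeR R) _ h x).
apply: eq_integral => x _.
rewrite integral_gaussian// -ge0_integralZr//.
- by apply: eq_integral => y _; rewrite -muleA -EFinM mulrC.
- by apply: emeasurable_funM; [exact: mhx|exact: measurable_gaussian_pdfE].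
- by move=> y _; rewrite mule_ge0// lee_fin gaussian_pdf_ge0.
- by rewrite lee_fin gaussian_pdf_ge0.
Qed.

(** The joint density depends on [x ^+ 2 + y ^+ 2] alone, and rotations preserve both
    this quantity and the Lebesgue measure. *)
Lemma gaussian_rotation (c s : R) (h : R * R -> \bar R) :
  measurable_fun [set: measurableTypeR R * measurableTypeR R] h -> (forall p, 0 <= h p) ->
  (c ^+ 2 + s ^+ 2 = 1)%R -> (0 <= c)%R ->
  \int[gaussian]_x \int[gaussian]_y h (c * x + s * y, - s * x + c * y)%R =
  \int[gaussian]_x \int[gaussian]_y h (x, y).
Proof.
move=> mh h0 cs c0.
pose rot (v : measurableTypeR R * measurableTypeR R) : measurableTypeR R * measurableTypeR R :=
  (c * v.1 + s * v.2, - s * v.1 + c * v.2)%R.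
have mrot : measurable_fun setT rot.
  have m1 : measurable_fun setT (fst : measurableTypeR R * measurableTypeR R -> R) by exact: measurable_fst.
  have m2 : measurable_fun setT (snd : measurableTypeR R * measurableTypeR R -> R) by exact: measurable_snd.
  by apply: measurable_fun_pair; apply: measurable_funD; apply: measurable_funM.
have mhr : measurable_fun setT (h \o rot) by exact: (measurableT_comp mh mrot).
pose H (v : measurableTypeR R * measurableTypeR R) := h v * (gaussian_pdf v.1 * gaussian_pdf v.2)%:E.
have H0 v : 0 <= H v by rewrite mule_ge0// lee_fin mulr_ge0// gaussian_pdf_ge0.
have mH : measurable_fun setT H.
  apply: emeasurable_funM; first exact: mh.
  apply/measurable_EFinP; apply: measurable_funM.
    exact: (measurableT_comp measurable_gaussian_pdf measurable_fst).
  exact: (measurableT_comp measurable_gaussian_pdf measurable_snd).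
transitivity (\int[mu]_x \int[mu]_y H (c * x + s * y, - s * x + c * y)%R); last first.
  by rewrite (integral_rotation mH H0 cs c0) (integral_gaussian2 mh h0).
transitivity (\int[mu]_x \int[mu]_y ((h \o rot) (x, y) * (gaussian_pdf x * gaussian_pdf y)%:E)).
  exact: (integral_gaussian2 mhr (fun v => h0 _)).
apply: eq_integral => x _; apply: eq_integral => y _; rewrite /H/=; congr (_ * _%:E).
apply: gaussian_pdfM.
transitivity ((c ^+ 2 + s ^+ 2) * (x ^+ 2 + y ^+ 2))%R; first by rewrite cs mul1r.
by ring.
Qed.

Lemma gaussian_cst (x : \bar R) : \int[gaussian]_y x = x.
Proof.
transitivity (x * gaussian setT); first exact: integral_cst.
by rewrite probability_setT mule1.
Qed.

(** A marginal of the rotation invariance: the second coordinate of the quarter turn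
    is [- x]. *)
Lemma gaussian_symmetry (f : R -> \bar R) :
  measurable_fun [set: R] f -> (forall x, 0 <= f x) ->
  \int[gaussian]_x f (- x)%R = \int[gaussian]_x f x.
Proof.
move=> mf f0.
pose h1 (v : measurableTypeR R * measurableTypeR R) := f v.1.
pose h2 (v : measurableTypeR R * measurableTypeR R) := f v.2.
have mh1 : measurable_fun setT h1 by apply: measurableT_comp => //; exact: measurable_fst.
have mh2 : measurable_fun setT h2 by apply: measurableT_comp => //; exact: measurable_snd.
have e01 : (0 ^+ 2 + 1 ^+ 2 = 1 :> R)%R by rewrite expr0n expr1n add0r.
have e1 := @gaussian_rotation 0 1 h1 mh1 (fun v => f0 _) e01 (lexx _).
have e2 := @gaussian_rotation 0 1 h2 mh2 (fun v => f0 _) e01 (lexx _).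
have cstI (g : R -> \bar R) : \int[gaussian]_x \int[gaussian]_y g y = \int[gaussian]_y g y.
  by rewrite gaussian_cst.
have cstJ (g : R -> \bar R) : (\int[gaussian]_x \int[gaussian]_y g x = \int[gaussian]_y g y).
  by apply: eq_integral => x _; rewrite gaussian_cst.
move: e1 e2; rewrite /h1 /h2/=.
rewrite !cstI !cstJ.
under eq_integral do under eq_integral do rewrite mul0r add0r mul1r.
rewrite cstI => _.
under eq_integral do under eq_integral do rewrite mul0r addr0 mulN1r.
by rewrite cstJ.
Qed.

End gaussian_measure.

(** * Integration of derivatives and the Gaussian variance *)

Section ftc_tools.
Context {R : realType}.
Local Notation mu := (@lebesgue_measure R).

Lemma is_derive_continuous (F : R -> R) (x df : R) : is_derive x 1 F df -> {for x, continuous F}.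
Proof.
by move=> dF; apply: differentiable_continuous; apply/derivable1_diffP; exact: ex_derive.
Qed.

Lemma FTC_tail (F f : R -> R) (a l : R) :
  (forall x, a <= x -> is_derive x 1 F (f x)) -> (forall x, a <= x -> {for x, continuous f}) ->
  (forall x, a <= x -> 0 <= f x) -> F x @[x --> +oo] --> l ->
  (\int[mu]_(x in `[a, +oo[) (f x)%:E = (l - F a)%:E)%E.
Proof.
move=> dF cf f0 Fl; rewrite (@ge0_continuous_FTC2y _ f F a l)//.
- apply: continuous_in_subspaceT => x; rewrite inE/= in_itv/= andbT => ax; exact: cf.
- by move=> x /ltW /dF dFx; exact: ex_derive.
- apply: cvg_at_right_filter; exact: is_derive_continuous (dF _ (lexx _)).
- by move=> x; rewrite in_itv/= andbT => /ltW /dF dFx; rewrite derive1E; exact: derive_val.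
Qed.

Lemma FTC_segment (F f : R -> R) (a b : R) : a <= b ->
  (forall x, a <= x <= b -> is_derive x 1 F (f x)) -> (forall x, a <= x <= b -> {for x, continuous f}) ->
  (\int[mu]_(x in `[a, b]) (f x)%:E = (F b - F a)%:E)%E.
Proof.
rewrite le_eqVlt => /predU1P[<- _ _|ab dF cf].
  by rewrite set_itv1 integral_set1 subrr.
have abW := ltW ab.
rewrite (@continuous_FTC2 _ f F a b)//.
- by apply: continuous_in_subspaceT => x; rewrite inE/= in_itv/= => ax; exact: cf.
- split.
  + by move=> x; rewrite in_itv/= => /andP[/ltW ax /ltW xb]; have := dF x; rewrite ax xb => /(_ isT) dFx; exact: ex_derive.
  + apply: cvg_at_right_filter; apply: is_derive_continuous (dF _ _); by rewrite lexx.
  + apply: cvg_at_left_filter; apply: is_derive_continuous (dF _ _); by rewrite lexx andbT.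
- move=> x; rewrite in_itv/= => /andP[/ltW ax /ltW xb]; have := dF x; rewrite ax xb => /(_ isT) dFx.
  by rewrite derive1E; exact: derive_val.
Qed.

Lemma derive_ge0_homo (f df : R -> R) (a b : R) : a <= b ->
  (forall x, a <= x <= b -> is_derive x 1 f (df x)) -> (forall x, a <= x <= b -> 0 <= df x) ->
  f a <= f b.
Proof.
move=> ab dF df0.
have [] := @MVT_segment _ f df a b ab.
- by move=> x; rewrite in_itv/= => /andP[/ltW ax /ltW xb]; apply: dF; rewrite ax.
- apply: continuous_in_subspaceT => x; rewrite inE/= in_itv/= => ax.
  exact: is_derive_continuous (dF _ ax).
move=> c; rewrite in_itv/= => cab E; rewrite -subr_ge0 E mulr_ge0 ?df0// subr_ge0//.
Qed.

End ftc_tools.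

Section gaussian_variance.
Local Open Scope ereal_scope.
Context {R : realType}.
Local Notation mu := (@lebesgue_measure R).
Local Notation gaussian_pdf := (@gaussian_pdf R).

Lemma is_derive_gaussian_pdf (x : R) : is_derive x 1%R gaussian_pdf (- x * gaussian_pdf x)%R.
Proof.
have -> : gaussian_pdf = (fun y : R => normal_peak 1 * expR (- (y ^+ 2 / 2)))%R.
  by apply/funext => y; rewrite gaussian_pdfE.
apply: is_derive_eq.
by rewrite !scaler0 add0r /GRing.scale/=; field.
Qed.

Lemma cvg_gaussian_pdf : gaussian_pdf x @[x --> +oo%R] --> (0 : R)%R.
Proof.
have -> : gaussian_pdf = (fun y : R => normal_peak 1 * expR (- (y ^+ 2 / 2)))%R.
  by apply/funext => y; rewrite gaussian_pdfE.
rewrite -[X in _ --> X](mulr0 (normal_peak 1)).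
apply: cvgM; first exact: cvg_cst.
apply: (cvg_comp (fun y : R => y ^+ 2 / 2)%R (fun y => expR (- y))); last exact: cvgr_expR.
apply: gt0_cvgMly; last exact: cvgr_expr2.
by rewrite invr_gt0.
Qed.

Lemma gaussian_pdf_tail (z : R) : (0 <= z)%R ->
  \int[mu]_(u in `[z, +oo[) (u * gaussian_pdf u)%:E = (gaussian_pdf z)%:E.
Proof.
move=> z0; transitivity (0 - (- gaussian_pdf z))%R%:E; last by rewrite sub0r opprK.
apply: (@FTC_tail R (fun x => - gaussian_pdf x)%R (fun x => x * gaussian_pdf x)%R z 0).
- move=> x _; have := is_derive_gaussian_pdf x => dx.
  by apply: is_derive_eq; rewrite mulNr opprK.
- move=> x _; apply: cvgM; first exact: cvg_id.
  exact: is_derive_continuous (is_derive_gaussian_pdf x).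
- by move=> x zx; rewrite mulr_ge0 ?gaussian_pdf_ge0// (le_trans z0).
- by rewrite -oppr0; apply: cvgN; exact: cvg_gaussian_pdf.
Qed.

Lemma continuous_gaussian_pdf : continuous gaussian_pdf.
Proof. by move=> x; exact: is_derive_continuous (is_derive_gaussian_pdf x). Qed.

(** Write the density at [z] as the integral over [u >= z] of [u] times the density at
    [u], and exchange the two integrals: the integral over [0 <= z <= u] contributes
    another factor [u]. *)
Lemma gaussian_half_variance :
  \int[mu]_(z in `[0%R, +oo[) (z ^+ 2 * gaussian_pdf z)%:E = \int[mu]_(z in `[0%R, +oo[) (gaussian_pdf z)%:E.
Proof.
(* [p.1] is the level [z] and [p.2] the variable [u] of the tail integral *)
pose K (p : measurableTypeR R * measurableTypeR R) : \bar R :=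
  if (0 <= p.1)%R && (p.1 <= p.2)%R then (p.2 * gaussian_pdf p.2)%:E else 0.
have K0 p : 0 <= K p.
  rewrite /K; case: ifPn => // /andP[p1 p2]; rewrite lee_fin mulr_ge0 ?gaussian_pdf_ge0//.
  exact: le_trans p2.
have mK : measurable_fun setT K.
  apply: measurable_fun_ifT => //.
    by apply: measurable_and; apply: measurable_fun_ler.
  apply/measurable_EFinP; apply: measurable_funM; first exact: measurable_snd.
  exact: (measurableT_comp measurable_gaussian_pdf measurable_snd).
transitivity (\int[mu]_z \int[mu]_u K (z, u)); last first.
  rewrite [RHS]integral_mkcond; apply: eq_integral => z _.
  rewrite patchE mem_setE in_itv/= andbT; case: ifPn => z0; last first.
    by apply: integral0_eq => u _; rewrite /K/= (negbTE z0).
  rewrite -gaussian_pdf_tail// [RHS]integral_mkcond; apply: eq_integral => u _.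
  by rewrite patchE mem_setE in_itv/= andbT /K/= z0.
rewrite (@fubini_tonelli _ _ _ _ R mu mu K mK K0).
rewrite [LHS]integral_mkcond; apply: eq_integral => u _.
rewrite patchE mem_setE in_itv/= andbT; case: ifPn => u0; last first.
  symmetry; apply: integral0_eq => z _; rewrite /K/=; case: ifPn => // /andP[z0 zu].
  by rewrite (le_trans z0 zu) in u0.
transitivity (\int[mu]_(z in `[0%R, u]) (u * gaussian_pdf u)%:E).
  rewrite integral_cst//= lebesgue_measure_itv/= lte_fin.
  rewrite le_eqVlt in u0; case/predU1P : u0 => [<-|u0].
    by rewrite ltxx mule0 expr0n/= mul0r.
  by rewrite u0 -EFinB subr0 -EFinM expr2 -mulrA mulrC.
rewrite [LHS]integral_mkcond; apply: eq_integral => z _.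
by rewrite patchE mem_setE in_itv/=.
Qed.

Lemma gaussian_variance : \int[@gaussian R]_z (z ^+ 2)%:E = 1.
Proof.
rewrite integral_gaussian; last 2 first.
- by apply/measurable_EFinP; exact: measurable_funX.
- by move=> x; rewrite lee_fin sqr_ge0.
under eq_integral do rewrite -EFinM.
have even x : gaussian_pdf (- x) = gaussian_pdf x by rewrite !gaussian_pdfE sqrrN.
have -> : 1 = \int[mu]_x (gaussian_pdf x)%:E by rewrite integral_normal_pdf.
rewrite (@ge0_symfun_integralT _ (fun z => z ^+ 2 * gaussian_pdf z)%R); last 3 first.
- by move=> x; rewrite mulr_ge0 ?sqr_ge0 ?gaussian_pdf_ge0.
- by move=> x; apply: cvgM; [exact: exprn_continuous|exact: continuous_gaussian_pdf].
- by move=> x /=; rewrite sqrrN even.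
rewrite (@ge0_symfun_integralT _ gaussian_pdf); last 3 first.
- by move=> x; rewrite gaussian_pdf_ge0.
- exact: continuous_gaussian_pdf.
- by move=> x /=; rewrite even.
have -> : [set x : R | (0 <= x)%R] = `[0%R, +oo[%classic.
  by apply/seteqP; split => x /=; rewrite in_itv/= andbT.
by rewrite gaussian_half_variance.
Qed.

End gaussian_variance.

(** * Supporting parabolas of sums of two positive cubes *)

Section positive_cube.
Context {R : realType}.
Implicit Types x z B C D : R.

Definition pos_part x := Num.max x 0.

Lemma pos_part_ge0 x : 0 <= pos_part x.
Proof. by rewrite /pos_part le_max lexx orbT. Qed.

(** A direct criterion for the square of the positive part, whose derivative at the
    kink is out of reach of the rules of calculus. *)
Lemma is_derive_quadratic_remainder (f : R -> R) (x d M : R) :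
  (forall h, `|f (x + h) - f x - d * h| <= M * h ^+ 2) -> is_derive x 1 f d.
Proof.
move=> fM.
have M0 : 0 <= M by have := le_trans (normr_ge0 _) (fM 1); rewrite expr1n mulr1.
have lim : h^-1 *: ((f \o shift x) (h *: (1 : R)) - f x) @[h --> 0^'] --> d.
  apply/cvgrPdist_le => e e0.
  near=> h.
  have h0 : h != 0 by near: h; exact: nbhs_dnbhs_neq.
  have hM : `|h| <= e / (M + 1).
    near: h; apply: dnbhs0_le; rewrite divr_gt0// ltr_wpDl//.
  rewrite /GRing.scale/= mulr1 (addrC h).
  have -> : d - h^-1 * (f (x + h) - f x) = - (h^-1 * (f (x + h) - f x - d * h)).
    by field.
  rewrite normrN normrM normfV.
  rewrite ler_pdivrMl ?normr_gt0//.
  apply: (le_trans (fM h)); rewrite -[h ^+ 2]real_normK ?num_real// expr2 mulrCA ler_pM2l ?normr_gt0//.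
  apply: (@le_trans _ _ ((M + 1) * `|h|)); first by rewrite ler_wpM2r// lerDl.
  by move: hM; rewrite ler_pdivlMr ?ltr_wpDl// mulrC.
by apply: DeriveDef; [apply: cvgP lim|exact: cvg_lim].
Unshelve. all: by end_near. Qed.

Lemma is_derive_pos_part2 x : is_derive x 1 (fun y => pos_part y ^+ 2) (2 * pos_part x).
Proof.
apply: (@is_derive_quadratic_remainder _ _ _ 1) => h.
rewrite /pos_part ler_norml; case: (leP (x + h) 0) => xh; case: (leP x 0) => x0; apply/andP; split; nra.
Qed.

Lemma pos_part3E x : pos_part x ^+ 3 = x * pos_part x ^+ 2.
Proof. by rewrite /pos_part; case: (leP x 0) => x0; [rewrite !expr0n/= mulr0|rewrite exprS]. Qed.

Lemma is_derive_pos_part3 x : is_derive x 1 (fun y => pos_part y ^+ 3) (3 * pos_part x ^+ 2).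
Proof.
have -> : (fun y => pos_part y ^+ 3) = (fun y => y * pos_part y ^+ 2) by apply/funext => y; exact: pos_part3E.
have d2 := is_derive_pos_part2 x.
apply: is_derive_eq; rewrite /GRing.scale/= mulr1.
have := pos_part3E x; rewrite /pos_part; case: (leP x 0) => x0 _; ring.
Qed.

(** As a function of [z], the value at [s + z *: a] plus the value at [s - z *: a] of
    the cube of the positive part of a quadratic (or affine) function of the point;
    [D], [B], [C] are its coefficients along the line. *)
Definition cube_pair D B C z : R :=
  pos_part (D + B * z ^+ 2 + C * z) ^+ 3 + pos_part (D + B * z ^+ 2 - C * z) ^+ 3.

(** The derivative of [cube_pair] divided by [z], that is, twice its derivative with
    respect to [z ^+ 2]. *)
Definition cube_pair_slope D B C z : R :=
  3 * (pos_part (D + B * z ^+ 2 + C * z) ^+ 2 * (2 * B + C / z) +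
       pos_part (D + B * z ^+ 2 - C * z) ^+ 2 * (2 * B - C / z)).

Lemma is_derive_quadratic D B C z :
  is_derive z 1 (fun y => D + B * y ^+ 2 + C * y) (2 * B * z + C).
Proof. by apply: is_derive_eq; rewrite /GRing.scale/=; ring. Qed.

Lemma is_derive_cube_pair D B C z :
  is_derive z 1 (cube_pair D B C)
   (3 * (pos_part (D + B * z ^+ 2 + C * z) ^+ 2 * (2 * B * z + C) +
       pos_part (D + B * z ^+ 2 - C * z) ^+ 2 * (2 * B * z - C))).
Proof.
have dp := is_derive_quadratic D B C z.
have dq := is_derive_quadratic D B (- C) z.
have d3p := is_derive_pos_part3 (D + B * z ^+ 2 + C * z).
have d3q := is_derive_pos_part3 (D + B * z ^+ 2 + (- C) * z).
have e1 := @is_derive1_comp R (fun y => pos_part y ^+ 3) (fun y => D + B * y ^+ 2 + C * y) z _ _ d3p dp.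
have e2 := @is_derive1_comp R (fun y => pos_part y ^+ 3) (fun y => D + B * y ^+ 2 + (- C) * y) z _ _ d3q dq.
have -> : cube_pair D B C = (fun y => ((fun y => pos_part y ^+ 3) \o (fun y => D + B * y ^+ 2 + C * y)) y + ((fun y => pos_part y ^+ 3) \o (fun y => D + B * y ^+ 2 + (- C) * y)) y).
  by apply/funext => y; rewrite /cube_pair /= mulNr.
by apply: is_derive_eq; rewrite !mulNr; ring.
Qed.

(** Up to the factor [3 / z ^+ 2] this is the derivative of [cube_pair_slope]. When
    both brackets are positive the terms combine to products of [B * z], [D + B * z ^+
    2] and squares, all nonnegative. When only one is, [D + B * z ^+ 2] is at most
    [|C| * z], which makes the factor that is left nonnegative. *)
Lemma cube_pair_slope_derivative_ge0 D B C z : 0 <= B -> 0 < z ->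
  let P := pos_part (D + B * z ^+ 2 + C * z) in
  let Q := pos_part (D + B * z ^+ 2 - C * z) in
  0 <= 2 * z * (P * (2 * B * z + C) ^+ 2 + Q * (2 * B * z - C) ^+ 2) - C * (P ^+ 2 - Q ^+ 2).
Proof.
move=> B0 z0 /=; set m := D + B * z ^+ 2.
have single c : 0 < m + c * z -> m - c * z <= 0 ->
    0 <= 2 * z * ((m + c * z) * (2 * B * z + c) ^+ 2) - c * (m + c * z) ^+ 2.
  move=> p0 q0.
  have cz : 0 < c * z by lra.
  have c0 : 0 < c by rewrite pmulr_lgt0 in cz.
  have -> : 2 * z * ((m + c * z) * (2 * B * z + c) ^+ 2) - c * (m + c * z) ^+ 2 =
    (m + c * z) * (c * (c * z - m) + 8 * (B * z) * z * (B * z + c)) by ring.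
  apply: mulr_ge0; first exact: ltW.
  apply: addr_ge0; first by apply: mulr_ge0; lra.
  have Bz : 0 <= B * z by rewrite mulr_ge0// ltW.
  by rewrite !mulr_ge0//; lra.
rewrite /pos_part; case: (leP (m + C * z) 0) => p; case: (leP (m - C * z) 0) => q.
- by rewrite !expr0n/=; lra.
- have := @single (- C); rewrite mulNr opprK => /(_ q p).
  by rewrite expr0n/= => H; apply: (le_trans H); rewrite le_eqVlt; apply/orP; left; apply/eqP; ring.
- have := single C p q.
  by rewrite expr0n/= => H; apply: (le_trans H); rewrite le_eqVlt; apply/orP; left; apply/eqP; ring.
- have m0 : 0 < m by lra.
  have -> : 2 * z * ((m + C * z) * (2 * B * z + C) ^+ 2 + (m - C * z) * (2 * B * z - C) ^+ 2) -
     C * ((m + C * z) ^+ 2 - (m - C * z) ^+ 2) = 16 * (B * z * (B * z) * z * m + B * z * (C * z * (C * z))) by ring.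
  have Bz : 0 <= B * z by rewrite mulr_ge0// ltW.
  have Cz : 0 <= C * z * (C * z) by rewrite -expr2 sqr_ge0.
  apply: mulr_ge0 => //; apply: addr_ge0; last exact: mulr_ge0.
  by rewrite !mulr_ge0 ?(ltW z0) ?(ltW m0).
Qed.

Lemma cube_pair_slope_ndecr D B C z y : 0 <= B -> 0 < z -> z <= y ->
  cube_pair_slope D B C z <= cube_pair_slope D B C y.
Proof.
move=> B0 z0 zy.
apply: (@derive_ge0_homo R (cube_pair_slope D B C) (fun z => 3 * z ^- 2 *
  (2 * z * (pos_part (D + B * z ^+ 2 + C * z) * (2 * B * z + C) ^+ 2 +
     pos_part (D + B * z ^+ 2 - C * z) * (2 * B * z - C) ^+ 2) -
   C * (pos_part (D + B * z ^+ 2 + C * z) ^+ 2 - pos_part (D + B * z ^+ 2 - C * z) ^+ 2)))) => //; last first.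
  move=> x /andP[zx _]; have x0 := lt_le_trans z0 zx.
  apply: mulr_ge0; first by rewrite mulr_ge0// invr_ge0 sqr_ge0.
  exact: cube_pair_slope_derivative_ge0.
move=> x /andP[zx _]; have x0 := lt_le_trans z0 zx.
have dp := is_derive_quadratic D B C x.
have dq := is_derive_quadratic D B (- C) x.
have d2p := is_derive_pos_part2 (D + B * x ^+ 2 + C * x).
have d2q := is_derive_pos_part2 (D + B * x ^+ 2 + (- C) * x).
have e1 := @is_derive1_comp R (fun y => pos_part y ^+ 2) (fun y => D + B * y ^+ 2 + C * y) x _ _ d2p dp.
have e2 := @is_derive1_comp R (fun y => pos_part y ^+ 2) (fun y => D + B * y ^+ 2 + (- C) * y) x _ _ d2q dq.
have xn0 : x != 0 by rewrite gt_eqF.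
have di : is_derive x 1 (fun y : R => y^-1) (- x ^- 2).
  have := is_deriveV xn0 (is_derive_id x 1).
  by rewrite /GRing.scale/= mulr1.
have -> : cube_pair_slope D B C = (fun y => 3 * (
   ((fun y => pos_part y ^+ 2) \o (fun y => D + B * y ^+ 2 + C * y)) y * (2 * B + C * y^-1) +
   ((fun y => pos_part y ^+ 2) \o (fun y => D + B * y ^+ 2 + (- C) * y)) y * (2 * B + (- C) * y^-1))).
  by apply/funext => t; rewrite /cube_pair_slope /= !mulNr.
apply: is_derive_eq; rewrite /GRing.scale/= !mulNr; field.
exact: xn0.
Qed.

Lemma cube_pairN D B C z : cube_pair D B C (- z) = cube_pair D B C z.
Proof. by rewrite /cube_pair sqrrN mulrN opprK addrC. Qed.

(** As a function of [z ^+ 2] the pair is convex, because its slope is nondecreasing,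
    hence it lies above its tangent at [z ^+ 2 = 1]. *)
Lemma cube_pair_support D B C : 0 <= B -> forall z,
  cube_pair D B C 1 + cube_pair_slope D B C 1 / 2 * (z ^+ 2 - 1) <= cube_pair D B C z.
Proof.
move=> B0.
set k := cube_pair_slope D B C 1 / 2.
(* on [z >= 0] the derivative of [F] has the sign of [z - 1] *)
pose F z := cube_pair D B C z - k * z ^+ 2.
pose dF z := 3 * (pos_part (D + B * z ^+ 2 + C * z) ^+ 2 * (2 * B * z + C) +
       pos_part (D + B * z ^+ 2 - C * z) ^+ 2 * (2 * B * z - C)) - 2 * k * z.
have dFE z : is_derive z 1 F (dF z).
  have dc := is_derive_cube_pair D B C z.
  by rewrite /F /dF; apply: is_derive_eq; rewrite /GRing.scale/=; ring.
have dFz z : 0 < z -> dF z = z * (cube_pair_slope D B C z - cube_pair_slope D B C 1).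
  move=> z0; rewrite /dF /k /cube_pair_slope; field.
  by rewrite gt_eqF.
suff pos z : 0 <= z -> F 1 <= F z.
  move=> z; have [z0|z0] := leP 0 z; first by have := pos z z0; rewrite /F; lra.
  have := pos (- z); rewrite oppr_ge0 => /(_ (ltW z0)); rewrite /F cube_pairN sqrrN; lra.
move=> z0; have [z1|z1] := leP z 1; last first.
  apply: (@derive_ge0_homo R F dF); first exact: ltW.
  move=> x /andP[x1 _]; rewrite dFz; last by lra.
  by apply: mulr_ge0; [lra|rewrite subr_ge0 cube_pair_slope_ndecr//; lra].
rewrite -lerN2.
apply: (@derive_ge0_homo R (fun x => - F x) (fun x => - dF x)) => //.
move=> x /andP[zx x1]; have [->|xn0] := eqVneq x 0.
  by rewrite /dF expr0n/= !mulr0 !addr0 !subr0 !add0r; lra.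
have x0 : 0 < x by rewrite lt_def xn0 (le_trans z0).
by rewrite dFz// -mulrN opprB; apply: mulr_ge0; [lra|rewrite subr_ge0 cube_pair_slope_ndecr].
Qed.

(** One of the two brackets grows at least linearly, so its cube beats every multiple
    of [z ^+ 2]. *)
Lemma cube_pair_superquadratic D B C k : 0 <= B -> (0 < B) || (C != 0) ->
  exists z0, forall z, z0 <= z -> k * (1 + z ^+ 2) <= cube_pair D B C z.
Proof.
move=> B0 BC.
(* for [z >= 1] the larger bracket is at least [e * z - |D|], and for [z] beyond the
   threshold at least [e * z / 2]; the last summand of the threshold makes the cube of
   the latter at least [2 * |k| * z ^+ 2] *)
pose e := B + `|C|.
have e0 : 0 < e.
  by case/orP: BC => h; [rewrite ltr_wpDr|rewrite ltr_wpDl// normr_gt0].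
pose W := `|k|.
exists (1 + 2 * `|D| / e + 16 * W / e ^+ 3) => z zz.
have e30 : 0 < e ^+ 3 by rewrite exprn_gt0.
have De : 0 <= 2 * `|D| / e by rewrite divr_ge0 ?mulr_ge0// ltW.
have We : 0 <= 16 * W / e ^+ 3 by rewrite divr_ge0 ?mulr_ge0 ?normr_ge0// ltW.
have z1 : 1 <= z by lra.
have zD : 2 * `|D| <= e * z.
  have : 2 * `|D| / e <= z by lra.
  by rewrite ler_pdivrMr// (mulrC z).
have zW : 16 * W <= z * e ^+ 3.
  by rewrite -ler_pdivrMr//; lra.
have lb : e * z / 2 <= D + B * z ^+ 2 + `|C| * z.
  have h1 : - `|D| <= D by exact: lerNnormlW.
  have h2 : B * z <= B * z ^+ 2 by rewrite expr2 mulrA ler_peMr// mulr_ge0//; lra.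
  by rewrite /e mulrDl in zD *; lra.
have ez : 0 <= e * z / 2 by rewrite !mulr_ge0//; lra.
have cube x : e * z / 2 <= x -> (e * z / 2) ^+ 3 <= pos_part x ^+ 3.
  move=> h; rewrite lerXn2r ?nnegrE ?pos_part_ge0//.
  by rewrite /pos_part le_max h.
have pge0 x : 0 <= pos_part x ^+ 3 by rewrite exprn_ge0// pos_part_ge0.
have Gz : (e * z / 2) ^+ 3 <= cube_pair D B C z.
  rewrite /cube_pair; case: (leP 0 C) => C0.
    rewrite ger0_norm// in lb; have := cube _ lb; have := pge0 (D + B * z ^+ 2 - C * z); lra.
  rewrite ltr0_norm// mulNr in lb; have := cube _ lb; have := pge0 (D + B * z ^+ 2 + C * z); lra.
apply: le_trans Gz.
have kW : k <= W by exact: ler_norm.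
have W0 : 0 <= W by exact: normr_ge0.
have z21 : 1 <= z ^+ 2 by rewrite expr_ge1//; lra.
apply: (@le_trans _ _ (2 * W * z ^+ 2)).
  have : k * (1 + z ^+ 2) <= W * (1 + z ^+ 2) by rewrite ler_wpM2r//; lra.
  have : W * 1 <= W * z ^+ 2 by rewrite ler_wpM2l.
  lra.
have : 16 * W * z ^+ 2 <= z * e ^+ 3 * z ^+ 2 by rewrite ler_wpM2r// sqr_ge0.
have -> : (e * z / 2) ^+ 3 = z * e ^+ 3 * z ^+ 2 / 8 by field.
lra.
Qed.

(** Far from the origin the pair exceeds the supporting parabola by at least one,
    unless it is constant; this surplus, which has positive Gaussian probability, is
    the source of every strict inequality in the comparison of signs with Gaussian
    variables. *)
Lemma cube_pair_strict_support D B C : 0 <= B -> exists k z0, forall z,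
  cube_pair D B C 1 + k * (z ^+ 2 - 1) + (((0 < B) || (C != 0)) && (z0 <= z))%:R
    <= cube_pair D B C z.
Proof.
move=> B0; have sup := cube_pair_support D C B0.
set k := _ / 2 in sup.
have [BC|_] := boolP ((0 < B) || (C != 0)); last first.
  by exists k, 0 => z; rewrite /= addr0; exact: sup.
have [z0 z0P] := cube_pair_superquadratic D (`|cube_pair D B C 1| + `|k| + 1) B0 BC.
exists k, z0 => z; have [zz|_] := leP z0 z; last by rewrite /= addr0.
apply: le_trans (z0P z zz); rewrite /=.
have := ler_norm (cube_pair D B C 1); have := normr_ge0 (cube_pair D B C 1).
have := sqr_ge0 z => zz0 n0 n1.
have : k * (z ^+ 2 - 1) <= `|k| * (1 + z ^+ 2).
  apply: (le_trans (ler_norm _)); rewrite normrM ler_wpM2l//.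
  by rewrite (le_trans (ler_normB _ _))// normr1 ger0_norm// addrC.
have : 0 <= `|cube_pair D B C 1| * z ^+ 2 by rewrite mulr_ge0.
lra.
Qed.

End positive_cube.

(** * Averages along a random sign and along a Gaussian variable *)

Section matrix_measurability.
Context {R : realType}.

Lemma measurable_entry m n (i : 'I_m) (j : 'I_n) :
  measurable_fun [set: 'M[R]_(m, n)] (fun M : 'M[R]_(m, n) => M i j).
Proof.
move=> _ B mB; rewrite setTI; apply: sub_sigma_algebra.
by exists i, j, B.
Qed.

Lemma measurable_mx d (T : measurableType d) m n (f : T -> 'M[R]_(m, n)) :
  (forall i j, measurable_fun setT (fun t => f t i j)) -> measurable_fun setT f.
Proof.
move=> mf; apply: (@measurability _ _ _ _ _ _ (@entry_cylinders R m n)) => //.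
move=> _ [_ [i [j [B mB ->]]] <-].
exact: (mf i j measurableT B mB).
Qed.

End matrix_measurability.

Section operators.
Context {R : realType} {m : nat}.
Local Notation V := 'rV[R]_m.
Implicit Types (a s : V) (f : V -> R).

Definition sign_average a f s : R := (f (s + a) + f (s - a)) / 2.

Definition gaussian_average a (g : V -> \bar R) s : \bar R :=
  (\int[gaussian]_z g (s + (z : R) *: a)%R)%E.

(** The property of a test function that makes a Gaussian coefficient dominate a
    random sign. The symmetrised function lies above a parabola [l + k * z ^+ 2] that
    touches it at [z = 1]; signs and standard Gaussian variables have the same mean
    square, so both give this parabola the same average. The indicator records the
    strict gain for large [z] in a direction that is not zero. *)
Definition quadratic_support f := forall s a, exists k z0, forall z : R,
  f (s + a) + f (s - a) + k * (z ^+ 2 - 1) + ((a != 0) && (z0 <= z))%:R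
    <= f (s + z *: a) + f (s - z *: a).

(** The supporting parabolas at [s + a] and [s - a] average to one at [s]. This
    stability allows the signs to be replaced by Gaussian variables one at a time. *)
Lemma quadratic_support_average a f : quadratic_support f -> quadratic_support (sign_average a f).
Proof.
move=> Kf s b; have [k1 [z1 H1]] := Kf (s + a) b; have [k2 [z2 H2]] := Kf (s - a) b.
exists ((k1 + k2) / 2), (Num.max z1 z2) => z.
have {H1} := H1 z; have {H2} := H2 z; rewrite /sign_average ge_max.
rewrite !(addrAC s _ a) !(addrAC s _ (- a)).
case: (b != 0) => /=; last by lra.
by case: (z1 <= z) => /=; case: (z2 <= z) => /=; lra.
Qed.

Lemma measurable_line a d (T : measurableType d) (g : T -> V) (h : T -> R) :
  measurable_fun setT g -> measurable_fun setT h -> measurable_fun setT (fun t => g t + h t *: a).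
Proof.
move=> mg mh; apply: measurable_mx => i j.
under eq_fun do rewrite !mxE.
apply: measurable_funD; last exact: measurable_funM.
exact: (measurableT_comp (measurable_entry i j) mg).
Qed.

Lemma measurable_gaussian_average a (g : V -> \bar R) :
  measurable_fun setT g -> (forall s, 0 <= g s)%E -> measurable_fun setT (gaussian_average a g).
Proof.
move=> mg g0.
pose k (p : V * measurableTypeR R) := g (p.1 + (p.2 : R) *: a).
have mk : measurable_fun setT k.
  apply: (measurableT_comp mg); apply: measurable_line; [exact: measurable_fst|exact: measurable_snd].
exact: (@measurable_fun_fubini_tonelli_F _ _ V (measurableTypeR R) R gaussian k mk (fun p => g0 _)).
Qed.

Lemma measurable_along a s (g : V -> \bar R) : measurable_fun setT g ->
  measurable_fun [set: R] (fun z : R => g (s + z *: a)).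
Proof.
move=> mg; apply: (measurableT_comp mg); apply: measurable_line; first exact: measurable_cst.
exact: measurable_id.
Qed.

Lemma gaussian_average_ge0 a (g : V -> \bar R) : (forall s, 0 <= g s)%E ->
  forall s, (0 <= gaussian_average a g s)%E.
Proof. by move=> g0 s; exact: integral_ge0. Qed.

Lemma gaussian_average0 (g : V -> \bar R) : gaussian_average 0 g = g.
Proof.
apply/funext => s; rewrite /gaussian_average.
under eq_integral do rewrite scaler0 addr0.
exact: gaussian_cst.
Qed.

Lemma gaussian_averageN a (g : V -> \bar R) s :
  measurable_fun setT g -> (forall s, 0 <= g s)%E ->
  gaussian_average a g s = (\int[gaussian]_z g (s - (z : R) *: a)%R)%E.
Proof.
move=> mg g0; rewrite /gaussian_average -(gaussian_symmetry (measurable_along a s mg))//.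
by apply: eq_integral => z _; rewrite scaleNr.
Qed.

Lemma le_gaussian_average a (g1 g2 : V -> \bar R) s :
  measurable_fun setT g1 -> (forall s, 0 <= g1 s)%E -> measurable_fun setT g2 ->
  (forall s, g1 s <= g2 s)%E -> (gaussian_average a g1 s <= gaussian_average a g2 s)%E.
Proof.
move=> mg1 g10 mg2 g12; apply: ge0_le_integral => //; exact: measurable_along.
Qed.

Lemma gaussian_itv_gt0 (z0 : R) : (0 < gaussian `[z0, +oo[%classic)%E.
Proof.
pose M := `|z0| + 1.
apply: (@lt_le_trans _ _ (\int[lebesgue_measure]_(x in `[z0, (z0 + 1)%R]) (gaussian_pdf M)%:E)%E).
  rewrite integral_cst//= lebesgue_measure_itv/= lte_fin ltrDl ltr01 -EFinB addrAC subrr add0r mule1 lte_fin.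
  by rewrite gaussian_pdfE mulr_gt0 ?expR_gt0 ?normal_peak_gt0 ?oner_eq0.
apply: (@le_trans _ _ (\int[lebesgue_measure]_(x in `[z0, (z0 + 1)%R]) (gaussian_pdf x)%:E)%E).
  apply: ge0_le_integral => //.
  - by move=> x _; rewrite lee_fin gaussian_pdf_ge0.
  - by apply/measurable_EFinP; exact: measurable_funTS measurable_gaussian_pdf.
  - move=> x /=; rewrite in_itv/= => /andP[zx xz].
    rewrite lee_fin !gaussian_pdfE ler_wpM2l ?normal_peak_ge0// ler_expR lerN2 ler_wpM2r//.
    rewrite -[x ^+ 2]real_normK ?num_real// lerXn2r ?nnegrE//.
      by rewrite /M addr_ge0.
    rewrite /M ler_norml; have := ler_norm z0; have := lerNnormlW (lexx `|z0|); lra.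
apply: ge0_subset_integral => //=.
- by apply/measurable_EFinP; exact: measurable_funTS measurable_gaussian_pdf.
- by move=> x _; rewrite lee_fin gaussian_pdf_ge0.
- by move=> x /=; rewrite !in_itv/= andbT => /andP[].
Qed.

(** Integrate the defining inequality of [quadratic_support] against the Gaussian law:
    the parabola contributes its value at [z = 1] since the variance is one, and the
    surplus contributes the positive mass of a half-line. *)
Lemma sign_average_lt a f s : measurable_fun setT f -> (forall s, 0 <= f s) -> quadratic_support f ->
  ((sign_average a f s)%:E <= gaussian_average a (EFin \o f) s)%E /\
  (a != 0 -> ((sign_average a f s)%:E < gaussian_average a (EFin \o f) s)%E).
Proof.
move=> mf f0 Kf.
have mEf : measurable_fun setT (EFin \o f) by exact/measurable_EFinP.
have Ef0 t : (0 <= (EFin \o f) t)%E by rewrite lee_fin.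
set G := gaussian_average _ _ _.
have G0 : (0 <= G)%E by exact: gaussian_average_ge0.
have [k [z0 H]] := Kf s a.
have mfp : measurable_fun [set: measurableTypeR R] (fun z : R => (f (s + z *: a))%:E).
  exact: (measurable_along a s mEf).
have mfm : measurable_fun [set: measurableTypeR R] (fun z : R => (f (s - z *: a))%:E).
  by under eq_fun do rewrite -scalerN; exact: (measurable_along (- a) s mEf).
have fE0 (t : V) : (0 <= (f t)%:E)%E by rewrite lee_fin.
have sum2 : (\int[gaussian]_z ((f (s + (z : R) *: a)%R)%:E + (f (s - (z : R) *: a)%R)%:E) = G + G)%E.
  rewrite ge0_integralD//.
  by congr (_ + _)%E; rewrite [in RHS]/G (gaussian_averageN _ _ mEf Ef0).
(* [k] may be negative: its negative part goes to the other side, so that all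
   integrands are nonnegative *)
pose kp := Num.max k 0; pose kn := Num.max (- k) 0.
have kp0 : 0 <= kp by rewrite le_max lexx orbT.
have kn0 : 0 <= kn by rewrite le_max lexx orbT.
have kE : k = kp - kn by rewrite /kp /kn; case: (leP k 0) => ?; case: (leP (- k) 0) => ?; lra.
have mz2 c : measurable_fun [set: measurableTypeR R] (fun z : R => (c * z ^+ 2)%:E).
  by apply/measurable_EFinP; apply: measurable_funM => //; exact: measurable_funX.
pose A : set R := if a != 0 then `[z0, +oo[%classic else set0.
have mA : measurable (A : set (measurableTypeR R)) by rewrite /A; case: ifP.
have AE z : \1_A z = ((a != 0) && (z0 <= z))%:R :> R.
  rewrite /A; case: (a != 0) => /=; last by rewrite indic0.
  by rewrite indicE mem_setE in_itv/= andbT.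
have mone : measurable_fun [set: measurableTypeR R] (fun z => (\1_A z)%:E : \bar R).
  by apply/measurable_EFinP; exact: measurable_indic.
have Iz2 c : 0 <= c -> (\int[@gaussian R]_z (c * (z : R) ^+ 2)%R%:E = c%:E)%E.
  move=> c0; under eq_integral do rewrite EFinM.
  rewrite ge0_integralZl//.
  - by rewrite gaussian_variance mule1.
  - by apply/measurable_EFinP; exact: measurable_funX.
  - by move=> z _; rewrite lee_fin sqr_ge0.
have z20 c (z : R) : 0 <= c -> (0 <= (c * z ^+ 2)%R%:E)%E by move=> c0; rewrite lee_fin mulr_ge0// sqr_ge0.
have kn20 (z : R) : [set: R] z -> (0 <= (kn * z ^+ 2)%R%:E)%E by move=> _; exact: z20.
have kp20 (z : R) : [set: R] z -> (0 <= (kp * z ^+ 2)%R%:E)%E by move=> _; exact: z20.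
have cst0 (z : R) : [set: R] z -> (0 <= (f (s + a) + f (s - a) + kn)%R%:E)%E.
  by move=> _; rewrite lee_fin !addr_ge0.
have kpE0 (z : R) : [set: R] z -> (0 <= kp%:E)%E by rewrite lee_fin.
have ind0 (z : R) : [set: R] z -> (0 <= (\1_A z : R)%:E)%E by rewrite lee_fin.
have key : ((f (s + a) + f (s - a) + kn + kp)%R%:E + gaussian A <= G + G + (kn + kp)%R%:E)%E.
  have -> : (G + G + (kn + kp)%R%:E = \int[gaussian]_z
     ((f (s + (z : R) *: a)%R)%:E + (f (s - (z : R) *: a)%R)%:E + ((kn * z ^+ 2)%R%:E + kp%:E)))%E.
    rewrite ge0_integralD; [|by []|by move=> z _; exact: adde_ge0|exact: emeasurable_funD|by move=> z _; rewrite adde_ge0 ?kn20 ?kpE0|by apply: emeasurable_funD].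
    rewrite sum2 ge0_integralD//.
    by rewrite Iz2// gaussian_cst EFinD.
  have -> : ((f (s + a) + f (s - a) + kn + kp)%R%:E + gaussian A = \int[gaussian]_z
     ((f (s + a) + f (s - a) + kn)%R%:E + ((kp * (z : R) ^+ 2)%R%:E + (\1_A z)%:E)))%E.
    rewrite ge0_integralD; [|by []|by []|by []|by move=> z _; rewrite adde_ge0 ?kp20 ?ind0|by apply: emeasurable_funD].
    rewrite gaussian_cst ge0_integralD//.
    by rewrite Iz2// integral_indic// setIT addeA -EFinD.
  apply: ge0_le_integral => //.
  - by move=> z _; apply: adde_ge0; [exact: (cst0 z)|apply: adde_ge0; [exact: (kp20 z)|exact: (ind0 z)]].
  - by do 2 apply: emeasurable_funD => //.
  - by apply: emeasurable_funD; apply: emeasurable_funD.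
  - move=> z _; rewrite -!EFinD lee_fin AE; have := H z; rewrite kE; lra.
case GE : G => [g| |]; last 2 first.
- by rewrite leey ltey.
- by rewrite GE in G0.
have gA : exists2 r, gaussian A = r%:E & 0 <= r /\ (a != 0 -> 0 < r).
  have fA : gaussian A \is a fin_num by exact: fin_num_measure.
  exists (fine (gaussian A)); first by rewrite fineK.
  split; first by rewrite fine_ge0.
  by move=> a0; rewrite -lte_fin fineK// /A a0; exact: gaussian_itv_gt0.
have [r rE [r0 rp]] := gA.
move: key; rewrite rE GE -!EFinD lee_fin /sign_average !lee_fin => key.
split; first by lra.
by move=> /rp rp0; rewrite lte_fin; lra.
Qed.

End operators.

(** * Gaussian averages of radial functions *)

Section iterated_averages.
Context {R : realType} {m : nat}.
Local Notation V := 'rV[R]_m.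
Implicit Types (a b s x : V) (f : V -> R) (L : seq V).

Definition sign_averages L f := foldr sign_average f L.

Definition gaussian_averages L (g : V -> \bar R) := foldr gaussian_average g L.

Lemma measurable_sign_average a f : measurable_fun setT f -> measurable_fun setT (sign_average a f).
Proof.
move=> mf.
have mshift b : measurable_fun setT (fun s : V => f (s + b)).
  apply: (measurableT_comp mf); apply: measurable_mx => i j.
  under eq_fun do rewrite mxE.
  by apply: measurable_funD => //; exact: measurable_entry.
by apply: measurable_funM => //; apply: measurable_funD.
Qed.

Lemma measurable_gaussian_averages L (g : V -> \bar R) :
  measurable_fun setT g -> (forall s, 0 <= g s)%E ->
  measurable_fun setT (gaussian_averages L g) /\ (forall s, 0 <= gaussian_averages L g s)%E.
Proof.
move=> mg g0; elim: L => // a L [mL L0]; split; first exact: measurable_gaussian_average.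
by move=> s; exact: gaussian_average_ge0.
Qed.

Lemma quadratic_support_averages L f :
  [/\ measurable_fun setT f, forall s, 0 <= f s & quadratic_support f] ->
  [/\ measurable_fun setT (sign_averages L f), forall s, 0 <= sign_averages L f s &
      quadratic_support (sign_averages L f)].
Proof.
move=> Kf; elim: L => // a L [mL L0 KL]; split; first exact: measurable_sign_average.
- by move=> s /=; rewrite /sign_average divr_ge0// addr_ge0.
- exact: quadratic_support_average.
Qed.

(** Replace the signs by Gaussian variables from the outermost average inwards: the
    functions still averaged over signs retain [quadratic_support]. *)
Lemma sign_averages_lt L f s : measurable_fun setT f -> (forall s, 0 <= f s) -> quadratic_support f ->
  ((sign_averages L f s)%:E <= gaussian_averages L (EFin \o f) s)%E /\
  (has (fun a => a != 0) L -> ((sign_averages L f s)%:E < gaussian_averages L (EFin \o f) s)%E).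
Proof.
move=> mf f0 Kf; elim: L s => [|a L IH] s; first by split.
have mEf : measurable_fun setT (EFin \o f) by exact/measurable_EFinP.
have Ef0 t : (0 <= (EFin \o f) t)%E by rewrite lee_fin.
have [mL L0 KL] : [/\ measurable_fun setT (sign_averages L f), forall s, 0 <= sign_averages L f s &
      quadratic_support (sign_averages L f)] by exact: quadratic_support_averages.
have [mG G0] := measurable_gaussian_averages L mEf Ef0.
have [le1 lt1] := sign_average_lt a s mL L0 KL.
have le2 : (gaussian_average a (EFin \o sign_averages L f) s <=
            gaussian_average a (gaussian_averages L (EFin \o f)) s)%E.
  apply: le_gaussian_average => //.
  - exact/measurable_EFinP.
  - by move=> t; have [] := IH t.
split; first exact: le_trans le2.
rewrite /=; have [a0|a0] := eqVneq a 0; last by move=> _; exact: lt_le_trans (lt1 a0) le2.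
rewrite a0 gaussian_average0 /sign_average subr0 addr0 => /= hL.
rewrite (_ : (_ + _) / 2 = sign_averages L f s); last by field.
by have [_ ->] := IH s.
Qed.

Lemma gaussian_average_rotation (c t : R) a b (g : V -> \bar R) :
  measurable_fun setT g -> (forall s, 0 <= g s)%E -> c ^+ 2 + t ^+ 2 = 1 -> 0 <= c ->
  gaussian_average a (gaussian_average b g) =
  gaussian_average (c *: a - t *: b) (gaussian_average (t *: a + c *: b) g).
Proof.
move=> mg g0 ct c0; apply/funext => s; rewrite /gaussian_average.
pose h (v : measurableTypeR R * measurableTypeR R) := g (s + (v.1 : R) *: a + (v.2 : R) *: b).
have mh : measurable_fun setT h.
  apply: (measurableT_comp mg); apply: measurable_line; last exact: measurable_snd.
  by apply: measurable_line; [exact: measurable_cst|exact: measurable_fst].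
have := gaussian_rotation mh (fun v => g0 _) ct c0.
rewrite /h /= => <-; apply: eq_integral => z _; apply: eq_integral => w _; congr g.
by apply/rowP => i; rewrite !mxE; ring.
Qed.

(** The entries of the sum of the matrices [x^T *m x] over [x] in [L], that is, of the
    covariance matrix of the combination of the vectors of [L] with independent
    standard coefficients. *)
Definition covariance_form L (i j : 'I_m) : R := \sum_(x <- L) x 0 i * x 0 j.

(** The rotation with angle determined by [(al, be)], taken with the sign for which
    the cosine is nonnegative. *)
Lemma rotation_to_zero (al be : R) : exists c t : R, [/\ 0 <= c, c ^+ 2 + t ^+ 2 = 1 & t * al + c * be = 0].
Proof.
have [->|al0] := eqVneq al 0.
  by exists 0, 1; split => //; [rewrite expr0n expr1n add0r|rewrite mulr0 mul0r addr0].
pose r := Num.sqrt (al ^+ 2 + be ^+ 2).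
have s0 : 0 < al ^+ 2 + be ^+ 2 by rewrite ltr_pwDl ?sqr_ge0// exprn_even_gt0.
have r0 : 0 < r by rewrite sqrtr_gt0.
have rE : r ^+ 2 = al ^+ 2 + be ^+ 2 by rewrite sqr_sqrtr// ltW.
have rn0 : r != 0 by rewrite gt_eqF.
case: (leP 0 al) => al1.
  exists (al / r), (- be / r); split; first by rewrite divr_ge0// ltW.
    by rewrite !expr_div_n sqrrN -mulrDl -rE divff// expf_neq0.
  by field.
exists (- al / r), (be / r); split; first by rewrite divr_ge0 ?oppr_ge0// ltW.
  by rewrite !expr_div_n sqrrN -mulrDl -rE divff// expf_neq0.
by field.
Qed.

(** Rotating two neighbouring averages changes neither the iterated average nor the
    covariance. Starting from the end of the list, each rotation moves the coordinate
    [i0] of the later vector into the earlier one. *)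
Lemma givens_elimination (i0 : 'I_m) a L : exists b L',
  [/\ forall g, measurable_fun setT g -> (forall s, 0 <= g s)%E ->
        gaussian_averages (a :: L) g = gaussian_averages (b :: L') g,
      forall i j, covariance_form (a :: L) i j = covariance_form (b :: L') i j &
      forall x, x \in L' -> x 0 i0 = 0].
Proof.
elim: L a => [|a' L IH] a; first by exists a, [::]; split.
have [b [L' [E C Z]]] := IH a'.
have [c [t [c0 ct tc]]] := rotation_to_zero (a 0 i0) (b 0 i0).
exists (c *: a - t *: b), ((t *: a + c *: b) :: L'); split.
- move=> g mg g0; have [mL L0] := measurable_gaussian_averages L' mg g0.
  change (gaussian_average a (gaussian_averages (a' :: L) g) =
    gaussian_average (c *: a - t *: b)
      (gaussian_average (t *: a + c *: b) (gaussian_averages L' g))).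
  rewrite (E g mg g0).
  exact: (gaussian_average_rotation a b mL L0 ct c0).
- move=> i j; have := C i j; rewrite /covariance_form !big_cons => ->.
  rewrite !mxE !addrA; congr (_ + _).
  transitivity ((c ^+ 2 + t ^+ 2) * (a 0 i * a 0 j + b 0 i * b 0 j)); first by rewrite ct mul1r.
  by ring.
- by move=> x; rewrite inE => /predU1P[->|/Z//]; rewrite !mxE.
Qed.

Definition sqnorm x : R := \sum_i x 0 i ^+ 2.

Lemma measurable_sqnorm : measurable_fun setT sqnorm.
Proof.
apply: measurable_sum => i; apply: measurable_funX; exact: measurable_entry.
Qed.

End iterated_averages.

Section chi_square_integral.
Context {R : realType}.
Implicit Types (F : R -> \bar R).

Lemma measurable_add_sqr F : measurable_fun setT F ->
  measurable_fun [set: R * measurableTypeR R] (fun p : R * measurableTypeR R => F (p.1 + (p.2 : R) ^+ 2)).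
Proof. by move=> mF; exact: (measurableT_comp mF measurable_add_square). Qed.

Lemma integral_chi_square0 F : measurable_fun setT F ->
  (\int[@chi_square R 0]_u F u = F 0%R)%E.
Proof. by move=> mF; rewrite integral_dirac// diracT mul1e. Qed.

Lemma integral_chi_squareS k F : measurable_fun setT F -> (forall u, 0 <= F u)%E ->
  (\int[@chi_square R k.+1]_u F u = \int[chi_square k]_u \int[gaussian]_z F (u + (z : R) ^+ 2)%R)%E.
Proof.
move=> mF F0.
rewrite /= ge0_integral_distribution//.
have := @fubini_tonelli1 _ _ R (measurableTypeR R) R (chi_square k) gaussian
  (fun p => F (p.1 + (p.2 : R) ^+ 2)%R) (measurable_add_sqr mF) (fun p => F0 _).
by move=> /= <-.
Qed.

Lemma integral_chi_square_swap k F : measurable_fun setT F -> (forall u, 0 <= F u)%E ->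
  (\int[@chi_square R k.+1]_u F u = \int[gaussian]_z \int[chi_square k]_u F (u + (z : R) ^+ 2)%R)%E.
Proof.
move=> mF F0; rewrite integral_chi_squareS//.
exact: (@fubini_tonelli _ _ R (measurableTypeR R) R (chi_square k) gaussian
  (fun p => F (p.1 + (p.2 : R) ^+ 2)%R) (measurable_add_sqr mF) (fun p => F0 _)).
Qed.

(** One more degree of freedom adds a square to the random variable. *)
Lemma le_integral_chi_square k l F : measurable_fun setT F -> (forall u, 0 <= F u)%E ->
  {homo F : u v / (u <= v)%R >-> (u <= v)%E} -> (k <= l)%N ->
  (\int[@chi_square R k]_u F u <= \int[@chi_square R l]_u F u)%E.
Proof.
move=> mF F0 hF; elim: l => [|l IH]; first by rewrite leqn0 => /eqP ->.
rewrite leq_eqVlt => /predU1P[->//|]; rewrite ltnS => /IH /le_trans; apply.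
rewrite integral_chi_squareS//; apply: ge0_le_integral => //.
  exact: (@measurable_fun_fubini_tonelli_F _ _ R (measurableTypeR R) R gaussian _ (measurable_add_sqr mF) (fun p => F0 _)).
move=> u _; rewrite -[leLHS]gaussian_cst; apply: ge0_le_integral => //.
  apply: (measurableT_comp mF); apply: measurable_funD => //; exact: measurable_funX.
by move=> z _; apply: hF; rewrite lerDl sqr_ge0.
Qed.

(** The squared length of an isotropic Gaussian vector has the chi-square law.
    Eliminate the last of the first [k] coordinates: the covariance forces the
    remaining vector to be a unit vector along this axis, and the other vectors to be
    isotropic in the first [k - 1] coordinates. *)
Lemma gaussian_averages_chi_square m (F : R -> \bar R) (L : seq 'rV[R]_m) k :
  measurable_fun setT F -> (forall u, 0 <= F u)%E -> (k <= m)%N ->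
  (forall i j, covariance_form L i j = ((i == j) && (i < k)%N)%:R) ->
  forall s : 'rV[R]_m, (forall i : 'I_m, (i < k)%N -> s 0 i = 0) ->
  (gaussian_averages L (F \o sqnorm) s = \int[chi_square k]_u F (sqnorm s + u)%R)%E.
Proof.
move=> mF F0.
have mG : measurable_fun setT (F \o @sqnorm R m).
  by apply: (measurableT_comp mF); exact: measurable_sqnorm.
have G0 s : (0 <= (F \o @sqnorm R m) s)%E by exact: F0.
elim: k L => [|k IH] L km cov s sk.
  rewrite integral_chi_square0; last by apply: (measurableT_comp mF); exact: measurable_funD.
  rewrite addr0.
  have L0 : forall x, x \in L -> x = 0.
    move=> x xL; apply/rowP => i; rewrite mxE; apply/eqP; rewrite -sqrf_eq0 expr2.
    have := cov i i; rewrite ltn0 andbF => /eqP.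
    rewrite psumr_eq0; last by move=> y _; rewrite -expr2 sqr_ge0.
    by move=> /allP/(_ x xL).
  suff -> : gaussian_averages L (F \o sqnorm) = F \o sqnorm by [].
  elim: L L0 {cov} => // a L IHL L0 /=.
  rewrite (L0 a) ?inE ?eqxx// gaussian_average0.
  by apply: IHL => x xL; apply: L0; rewrite inE xL orbT.
(* the coordinate [k], the last of the first [k + 1] *)
pose i0 := Ordinal km.
case: L cov => [|a L] cov.
  have := cov i0 i0; rewrite eqxx ltnSn /covariance_form big_nil => /eqP.
  by rewrite eq_sym oner_eq0.
have [b [L' [E C Z]]] := givens_elimination i0 a L.
rewrite E//.
have Z0 j : \sum_(x <- L') x 0 i0 * x 0 j = 0.
  by rewrite big_seq big1// => x xL; rewrite Z// mul0r.
have bb j : b 0 i0 * b 0 j = (i0 == j)%:R.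
  have := cov i0 j; rewrite C /covariance_form big_cons Z0 addr0 => ->.
  by rewrite ltnSn andbT.
have b2 : b 0 i0 ^+ 2 = 1 by rewrite expr2 bb eqxx.
have bn0 : b 0 i0 != 0 by apply/eqP => h; move: b2; rewrite h expr0n => /eqP; rewrite eq_sym oner_eq0.
have bj j : j != i0 -> b 0 j = 0.
  move=> ji; apply: (mulfI bn0); rewrite bb mulr0.
  by rewrite eq_sym (negbTE ji).
have km' : (k <= m)%N by exact: ltnW.
have cov' i j : covariance_form L' i j = ((i == j) && (i < k)%N)%:R.
  have := cov i j; rewrite C /covariance_form big_cons.
  have [ii|ii] := eqVneq i i0.
    rewrite ii Z0 => _; by rewrite ltnn andbF.
  rewrite (bj i)// mul0r add0r => ->; congr (_%:R); congr (_ && _).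
  rewrite ltnS leq_eqVlt; case: eqP => // ik.
  by case/negP: ii; apply/eqP/val_inj.
rewrite /= /gaussian_average.
have s0 : s 0 i0 = 0 by apply: sk.
have sz (z : R) : sqnorm (s + z *: b) = sqnorm s + z ^+ 2.
  rewrite /sqnorm (bigD1 i0)//= [in RHS](bigD1 i0)//= s0 expr0n/= add0r.
  rewrite !mxE s0 add0r exprMn b2 mulr1 addrC; congr (_ + _).
  by apply: eq_bigr => j ji; rewrite !mxE bj// mulr0 addr0.
rewrite (@integral_chi_square_swap k (fun u => F (sqnorm s + u)%R))//; last first.
  by apply: (measurableT_comp mF); exact: measurable_funD.
apply: eq_integral => z _.
rewrite IH//.
  by apply: eq_integral => u _; rewrite sz -addrA (addrC u).
move=> i ik; rewrite !mxE sk ?(leq_trans ik)// bj ?mulr0 ?addr0//.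
by apply/eqP => h; move: ik; rewrite h ltnn.
Qed.

End chi_square_integral.

(** * The density of the chi distribution *)

Section measurable_real_functions.
Context {R : realType}.

Lemma measurable_sqrt : measurable_fun [set: R] (@Num.sqrt R).
Proof. by apply: continuous_measurable_fun; exact: sqrt_continuous. Qed.

Lemma measurable_inv : measurable_fun [set: R] (fun x : R => x^-1).
Proof.
have oN0 : open [set x : R | x != 0] by exact: open_neq.
have <- : [set x : R | x != 0] `|` [set 0] = [set: R].
  by apply/seteqP; split => // x _; have [->|x0] := eqVneq x 0; [right|left].
apply/measurable_funU => //; first exact: open_measurable.
split; last exact: measurable_fun_set1.
apply: open_continuous_measurable_fun => // x; rewrite inE/= => x0.
by apply: cvgV => //; exact: cvg_id.
Qed.

Lemma measurable_superlevel dT (T : measurableType dT) (f : T -> R) (y : R) :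
  measurable_fun [set: T] f -> measurable [set w | y <= f w].
Proof.
move=> mf; have := mf measurableT [set` `[y, +oo[] (measurable_itv _); rewrite setTI.
suff -> : f @^-1` [set` `[y, +oo[] = [set w | y <= f w] by [].
by apply/seteqP; split => w /=; rewrite in_itv/= andbT.
Qed.

End measurable_real_functions.

Section chi_density.
Context {R : realType}.
Local Notation mu := (@lebesgue_measure R).
Implicit Types (F : R -> \bar R) (r x : R).

Definition chi_shape (d : nat) r : R := r ^+ d.-1 * expR (- (r ^+ 2 / 2)).

(** Extending the density by zero to the whole line lets the integrals below range
    over the line, where the affine substitution applies. *)
Definition pos_chi_shape d r : R := if 0 < r then chi_shape d r else 0.

Lemma chi_shape_ge0 d r : 0 <= r -> 0 <= chi_shape d r.
Proof. by move=> r0; rewrite mulr_ge0 ?expR_ge0// exprn_ge0. Qed.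

Lemma pos_chi_shape_ge0 d r : 0 <= pos_chi_shape d r.
Proof. by rewrite /pos_chi_shape; case: ifPn => // /ltW; exact: chi_shape_ge0. Qed.

Lemma measurable_chi_shape d : measurable_fun [set: R] (chi_shape d).
Proof.
apply: measurable_funM; first exact: measurable_funX.
apply: measurableT_comp => //; apply: measurable_funN => //.
apply: measurable_funM => //; exact: measurable_funX.
Qed.

Lemma measurable_pos_chi_shape d : measurable_fun [set: R] (pos_chi_shape d).
Proof.
apply: measurable_fun_ifT => //; last exact: measurable_chi_shape.
exact: measurable_fun_ltr.
Qed.

Lemma integral_even F : measurable_fun setT F -> (forall x, 0 <= F x)%E -> (forall x, F (- x) = F x) ->
  (\int[mu]_x F x = 2%:E * \int[mu]_(x in `]0%R, +oo[) F x)%E.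
Proof.
move=> mF F0 eF.
have split : [set: R] = (`]-oo, 0%R] `|` `]0%R, +oo[)%classic.
  by apply/seteqP; split => // x _ /=; rewrite !in_itv/= andbT; case: (leP x 0); [left|right].
rewrite split ge0_integral_setU//=; last 2 first.
- exact: measurable_funTS.
- apply/disj_setPS => x [] /=; rewrite !in_itv/= andbT => x0 x1.
  by have := lt_le_trans x1 x0; rewrite ltxx.
have -> : (\int[mu]_(x in `]-oo, 0%R]) F x = \int[mu]_(x in `]0%R, +oo[) F x)%E.
  under eq_integral do rewrite -eF.
  rewrite -ge0_integration_by_substitution0//.
  by rewrite [RHS]integral_itv_obnd_cbnd//; exact: measurable_funTS.
by rewrite mule_natl mule2n.
Qed.

Lemma chi_density1 : exists2 C : R, 0 < C & forall F, measurable_fun setT F -> (forall u, 0 <= F u)%E ->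
  (\int[@chi_square R 1]_u F u = C%:E * \int[mu]_r (F (r ^+ 2)%R * (pos_chi_shape 1 r)%:E))%E.
Proof.
exists (2 * normal_peak 1); first by rewrite mulr_gt0// normal_peak_gt0 ?oner_eq0.
move=> F mF F0.
have mF2 : measurable_fun [set: R] (fun z => F (z ^+ 2)).
  by apply: (measurableT_comp mF); exact: measurable_funX.
rewrite integral_chi_square_swap//.
under eq_integral => z _.
  rewrite integral_chi_square0; last by apply: (measurableT_comp mF); exact: measurable_funD.
  rewrite add0r; over.
rewrite integral_gaussian//.
have k0 : 0 <= normal_peak (1 : R) by exact: normal_peak_ge0.
rewrite integral_even; last 3 first.
- by apply: emeasurable_funM => //; exact: measurable_gaussian_pdfE.
- by move=> z; rewrite mule_ge0// lee_fin gaussian_pdf_ge0.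
- by move=> z; rewrite sqrrN !gaussian_pdfE sqrrN.
rewrite EFinM -muleA; congr (_ * _)%E.
rewrite -ge0_integralZl//; last 2 first.
- apply: emeasurable_funM => //; apply/measurable_EFinP; exact: measurable_pos_chi_shape.
- by move=> z _; rewrite mule_ge0// lee_fin pos_chi_shape_ge0.
rewrite [LHS]integral_mkcond; apply: eq_integral => z _.
rewrite patchE mem_setE in_itv/= andbT /pos_chi_shape; case: ifPn => z0; last by rewrite !mule0.
by rewrite /chi_shape expr0 mul1r gaussian_pdfE EFinM muleCA.
Qed.

(** Polar coordinates without angles. In the integral over [(r, z)] substitute [z = r
    * s], which makes [r ^+ 2 + z ^+ 2] equal to [(q s * r) ^+ 2] with [q s = sqrt (1
    + s ^+ 2)], and then rescale [r] by [q s]. The variables separate, and the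
    integral in [s] is absorbed in the constant, which is finite and positive since
    the total mass is one. *)
Lemma chi_densityS d : (0 < d)%N -> (exists2 C : R, 0 < C & forall F, measurable_fun setT F -> (forall u, 0 <= F u)%E ->
  (\int[@chi_square R d]_u F u = C%:E * \int[mu]_r (F (r ^+ 2)%R * (pos_chi_shape d r)%:E))%E) ->
  exists2 C : R, 0 < C & forall F, measurable_fun setT F -> (forall u, 0 <= F u)%E ->
  (\int[@chi_square R d.+1]_u F u = C%:E * \int[mu]_r (F (r ^+ 2)%R * (pos_chi_shape d.+1 r)%:E))%E.
Proof.
move=> d0 [C C0 HC].
set k := normal_peak (1 : R).
have k0 : 0 < k by rewrite normal_peak_gt0 ?oner_eq0.
pose q (s : R) := Num.sqrt (1 + s ^+ 2).
have q2 s : q s ^+ 2 = 1 + s ^+ 2 by rewrite sqr_sqrtr// addr_ge0// sqr_ge0.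
have q0 s : 0 < q s by rewrite sqrtr_gt0 ltr_pwDl// sqr_ge0.
have mqq : measurable_fun [set: R] q.
  apply: (measurableT_comp measurable_sqrt); apply: measurable_funD => //; exact: measurable_funX.
have mq : measurable_fun [set: R] (fun s => ((q s)^-1 ^+ d.+1)%:E).
  by apply/measurable_EFinP; apply: measurable_funX; exact: (measurableT_comp measurable_inv).
pose K : \bar R := (\int[mu]_s ((q s)^-1 ^+ d.+1)%:E)%E.
have key F : measurable_fun setT F -> (forall u, 0 <= F u)%E ->
  (\int[@chi_square R d.+1]_u F u = (C * k)%:E * (K * \int[mu]_r (F (r ^+ 2)%R * (pos_chi_shape d.+1 r)%:E)))%E.
  move=> mF F0.
  pose T2 := (measurableTypeR R * measurableTypeR R)%type.
  have m1 : measurable_fun setT (fst : T2 -> R) by exact: measurable_fst.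
  have m2 : measurable_fun setT (snd : T2 -> R) by exact: measurable_snd.
  have mX (g : T2 -> R) n : measurable_fun setT g -> measurable_fun setT (fun v => g v ^+ n).
    by move=> mg; exact: measurable_funX.
  have msh (g : T2 -> R) e : measurable_fun setT g -> measurable_fun setT (fun v => (pos_chi_shape e (g v))%:E).
    by move=> mg; apply/measurable_EFinP; exact: (measurableT_comp (measurable_pos_chi_shape e) mg).
  (* the integrands before and after the substitution [z = r * s] *)
  pose h1 (v : T2) := (F (v.1 ^+ 2 + v.2 ^+ 2)%R * ((pos_chi_shape d v.1)%:E * (gaussian_pdf v.2)%:E))%E.
  have mh1 : measurable_fun setT h1.
    apply: emeasurable_funM; first by apply: (measurableT_comp mF); apply: measurable_funD; apply: mX.
    apply: emeasurable_funM; first exact: msh.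
    exact: (measurableT_comp measurable_gaussian_pdfE m2).
  have h10 v : (0 <= h1 v)%E.
    by rewrite !mule_ge0// lee_fin ?pos_chi_shape_ge0 ?gaussian_pdf_ge0.
  pose h2 (v : T2) := (F ((q v.2 * v.1) ^+ 2)%R * ((pos_chi_shape d.+1 (q v.2 * v.1))%:E * ((q v.2)^-1 ^+ d)%:E))%E.
  have mh2 : measurable_fun setT h2.
    have mg : measurable_fun setT (fun v : T2 => q v.2 * v.1).
      by apply: measurable_funM => //; exact: (measurableT_comp mqq m2).
    apply: emeasurable_funM; first by apply: (measurableT_comp mF); exact: mX.
    apply: emeasurable_funM; first exact: msh.
    apply/measurable_EFinP; apply: (measurable_funX (f := fun v : T2 => (q v.2)^-1)).
    by apply: (measurableT_comp measurable_inv); exact: (measurableT_comp mqq m2).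
  have h20 v : (0 <= h2 v)%E.
    by rewrite !mule_ge0// lee_fin ?pos_chi_shape_ge0// exprn_ge0// invr_ge0 ltW.
  have step1 : (\int[@chi_square R d.+1]_u F u = C%:E * \int[mu]_z \int[mu]_r h1 (r, z))%E.
    rewrite integral_chi_square_swap//.
    have mFz (z : R) : measurable_fun [set: R] (fun u => F (u + z ^+ 2)).
      by apply: (measurableT_comp mF); exact: measurable_funD.
    have mG : measurable_fun [set: measurableTypeR R] (fun z : R => (\int[mu]_r (F (r ^+ 2 + z ^+ 2)%R * (pos_chi_shape d r)%:E))%E).
      apply: (@measurable_fun_fubini_tonelli_G _ _ (measurableTypeR R) (measurableTypeR R) R mu
        (fun v : T2 => (F (v.1 ^+ 2 + v.2 ^+ 2)%R * (pos_chi_shape d v.1)%:E)%E)).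
        apply: emeasurable_funM; first by apply: (measurableT_comp mF); apply: measurable_funD; apply: mX.
        exact: msh.
      by move=> v; rewrite mule_ge0// lee_fin pos_chi_shape_ge0.
    have G0 z : (0 <= (\int[mu]_r (F (r ^+ 2 + z ^+ 2)%R * (pos_chi_shape d r)%:E)))%E.
      by apply: integral_ge0 => r _; rewrite mule_ge0// lee_fin pos_chi_shape_ge0.
    under eq_integral do rewrite HC//.
    rewrite ge0_integralZl//; last by rewrite lee_fin ltW.
    congr (_ * _)%E; rewrite integral_gaussian//; apply: eq_integral => z _.
    rewrite -ge0_integralZr//; last 3 first.
    - apply: emeasurable_funM; first by apply: (measurableT_comp mF); apply: measurable_funD => //; exact: measurable_funX.
      by apply/measurable_EFinP; exact: measurable_pos_chi_shape.
    - by move=> r _; rewrite mule_ge0// lee_fin pos_chi_shape_ge0.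
    - by rewrite lee_fin gaussian_pdf_ge0.
    by apply: eq_integral => r _; rewrite /h1/= muleA.
  have step2 : (\int[mu]_z \int[mu]_r h1 (r, z) = k%:E * \int[mu]_r \int[mu]_s h2 (r, s))%E.
    rewrite -(@fubini_tonelli _ _ _ _ R mu mu h1 mh1 h10).
    rewrite -ge0_integralZl//; last 3 first.
    - exact: (@measurable_fun_fubini_tonelli_F _ _ (measurableTypeR R) (measurableTypeR R) R mu h2 mh2 h20).
    - by move=> r _; exact: integral_ge0.
    - by rewrite lee_fin ltW.
    apply: eq_integral => r _.
    case: (ltP 0 r) => r0; last first.
      rewrite !integral0_eq ?mule0// => s _; rewrite /h1 /h2 /= /pos_chi_shape ?pmulr_rgt0// ltNge r0/=.
        by rewrite mul0e mule0.
      by rewrite mul0e mule0.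
    rewrite -(@ge0_integral_affine R (fun z => h1 (r, z)) r 0)//; last first.
      exact: (@measurable_fun_pair2 _ _ _ (measurableTypeR R) (measurableTypeR R) _ h1 r).
    have mh2r : measurable_fun [set: R] (fun s => h2 (r, s)).
      exact: (@measurable_fun_pair2 _ _ _ (measurableTypeR R) (measurableTypeR R) _ h2 r).
    have mh1r : measurable_fun [set: R] (fun s => h1 (r, r * s + 0)%R).
      apply: (@measurableT_comp _ _ _ _ _ _ (fun z => h1 (r, z))).
        exact: (@measurable_fun_pair2 _ _ _ (measurableTypeR R) (measurableTypeR R) _ h1 r).
      by apply: measurable_funD => //; exact: measurable_funM.
    rewrite -!ge0_integralZl//; try by rewrite lee_fin ltW.
    apply: eq_integral => s _; rewrite /h1 /h2/= addr0.
    rewrite (_ : r ^+ 2 + (r * s) ^+ 2 = (q s * r) ^+ 2)%R; last by rewrite [in RHS]exprMn q2; ring.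
    rewrite muleCA [RHS]muleCA; congr (_ * _)%E.
    rewrite -!EFinM; congr EFin.
    rewrite /pos_chi_shape r0 pmulr_rgt0// r0 gaussian_pdfE -/k /chi_shape/=.
    have -> : expR (- ((q s * r) ^+ 2 / 2)) = expR (- (r ^+ 2 / 2)) * expR (- ((r * s) ^+ 2 / 2)).
      by rewrite -expRD [(q s * r) ^+ 2]exprMn q2 [(r * s) ^+ 2]exprMn; congr expR; ring.
    have qd : q s ^+ d * (q s)^-1 ^+ d = 1 by rewrite -exprMn divff ?expr1n// gt_eqF.
    have rd : r ^+ d = r * r ^+ d.-1 by rewrite -exprS prednK.
    rewrite [(q s * r) ^+ d]exprMn.
    transitivity (k * (r ^+ d * (expR (- (r ^+ 2 / 2)) * expR (- ((r * s) ^+ 2 / 2)))) * (q s ^+ d * (q s)^-1 ^+ d)).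
      rewrite qd mulr1 rd.
      have alg (x y e1 e2 k' : R) : x * (y * e1 * (k' * e2)) = k' * (x * y * (e1 * e2)) by ring.
      exact: alg.
    have alg (x y e k' z : R) : k' * (x * e) * (y * z) = k' * (y * x * e * z) by ring.
    exact: alg.
  have step3 : (\int[mu]_r \int[mu]_s h2 (r, s) = K * \int[mu]_r (F (r ^+ 2)%R * (pos_chi_shape d.+1 r)%:E))%E.
    rewrite (@fubini_tonelli _ _ _ _ R mu mu h2 mh2 h20).
    have I0 : (0 <= \int[mu]_r (F (r ^+ 2)%R * (pos_chi_shape d.+1 r)%:E))%E.
      by apply: integral_ge0 => r _; rewrite mule_ge0// lee_fin pos_chi_shape_ge0.
    rewrite -ge0_integralZr//; last by move=> s _; rewrite lee_fin exprn_ge0// invr_ge0 ltW.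
    apply: eq_integral => s _.
    have mf : measurable_fun [set: R] (fun r => (F (r ^+ 2)%R * (pos_chi_shape d.+1 r)%:E)%E).
      apply: emeasurable_funM; first by apply: (measurableT_comp mF); exact: measurable_funX.
      by apply/measurable_EFinP; exact: measurable_pos_chi_shape.
    have f0 r : (0 <= (F (r ^+ 2)%R * (pos_chi_shape d.+1 r)%:E))%E.
      by rewrite mule_ge0// lee_fin pos_chi_shape_ge0.
    rewrite -(ge0_integral_affine 0 mf f0 (q0 s)).
    have mfa : measurable_fun [set: R] (fun r => (F ((q s * r + 0) ^+ 2)%R * (pos_chi_shape d.+1 (q s * r + 0))%:E)%E).
      by apply: (measurableT_comp mf); apply: measurable_funD => //; exact: measurable_funM.
    rewrite muleA -EFinM -ge0_integralZl//; last by rewrite lee_fin mulr_ge0 ?(ltW (q0 s))// exprn_ge0// invr_ge0 ltW.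
    apply: eq_integral => r _; rewrite /h2/= addr0 muleA muleC; congr (_%:E * _)%E.
    by rewrite exprSr -mulrA mulVf ?mulr1// gt_eqF.
  by rewrite step1 step2 step3 EFinM muleA.
(* [F = 1] shows that the constants are finite and positive *)
have I1 := @key (cst 1%E) (measurable_cst _) (fun _ => lee01).
rewrite integral_cst// in I1.
rewrite mul1e in I1.
have {}I1 := etrans (esym (probability_setT (@chi_square R d.+1))) I1.
set I := (\int[mu]_r _)%E in I1.
have K0 : (0 <= K)%E by apply: integral_ge0 => s _; rewrite lee_fin exprn_ge0// invr_ge0 ltW.
have I0 : (0 <= I)%E by apply: integral_ge0 => r _; rewrite /= mul1e lee_fin pos_chi_shape_ge0.
have Ck0 : 0 < C * k by rewrite mulr_gt0.
have In0 : I != 0%E.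
  by apply/eqP => h; move: I1; rewrite h !mule0 => -[] /eqP; rewrite oner_eq0.
have Kn0 : K != 0%E.
  by apply/eqP => h; move: I1; rewrite h mul0e mule0 => -[] /eqP; rewrite oner_eq0.
have Kfin : (K < +oo)%E.
  rewrite ltey; apply/eqP => h; move: I1; rewrite h gt0_mulye ?lt_def ?In0// gt0_muley ?lte_fin//.
have KE : K = (fine K)%:E by rewrite fineK// ge0_fin_numE.
have fK0 : 0 < fine K by rewrite fine_gt0// Kfin lt_def Kn0 K0.
exists (C * k * fine K); first by rewrite mulr_gt0.
by move=> F mF F0; rewrite key// KE EFinM muleA.
Qed.

Lemma chi_density d : (0 < d)%N -> exists2 C : R, 0 < C & forall F, measurable_fun setT F -> (forall u, 0 <= F u)%E ->
  (\int[@chi_square R d]_u F u = C%:E * \int[mu]_r (F (r ^+ 2)%R * (pos_chi_shape d r)%:E))%E.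
Proof.
elim: d => // -[_ _|d IH _]; first exact: chi_density1.
by apply: chi_densityS => //; exact: IH.
Qed.

End chi_density.

(** * The tail of the chi distribution *)

Section chi_tail.
Context {R : realType}.
Local Notation mu := (@lebesgue_measure R).
Implicit Types (r x y : R) (d : nat).

Lemma is_derive_expn n r : is_derive r 1 (fun y : R => y ^+ n) (n%:R * r ^+ n.-1).
Proof.
have := is_deriveX n (is_derive_id r 1); rewrite scaler1 => h.
by rewrite (_ : (fun y => _) = (id : R -> R) ^+ n) // exprfctE.
Qed.

Lemma is_derive_chi_shape d r : is_derive r 1 (chi_shape d)
  (d.-1%:R * r ^+ d.-2 * expR (- (r ^+ 2 / 2)) - r * chi_shape d r).
Proof.
have dX := is_derive_expn d.-1 r.
have dE : is_derive r 1 (fun y : R => expR (- (y ^+ 2 / 2))) (- r * expR (- (r ^+ 2 / 2))).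
  by apply: is_derive_eq; rewrite !scaler0 add0r /GRing.scale/=; field.
have -> : chi_shape d = (fun y => (fun y : R => y ^+ d.-1) y * (fun y : R => expR (- (y ^+ 2 / 2))) y) by [].
by apply: is_derive_eq; rewrite /GRing.scale/= /chi_shape; ring.
Qed.

Lemma continuous_chi_shape d : continuous (chi_shape d : R -> R).
Proof. by move=> r; exact: is_derive_continuous (is_derive_chi_shape d r). Qed.

Lemma measurable_sqrt_ge x : measurable [set u : R | x <= Num.sqrt u].
Proof. by apply: measurable_superlevel; exact: measurable_sqrt. Qed.

Lemma chi_tail0 d x : x <= 0 -> chi_tail d x = 1%E.
Proof.
move=> x0; rewrite /chi_tail (_ : [set u | _] = setT) ?probability_setT//.
by apply/seteqP; split => // u _ /=; rewrite (le_trans x0)// sqrtr_ge0.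
Qed.

Lemma chi_tailE d : (0 < d)%N -> exists2 C : R, 0 < C & forall x, 0 <= x ->
  chi_tail d x = (\int[mu]_(r in `[x, +oo[) (C * chi_shape d r)%:E)%E.
Proof.
move=> d0; have [C C0 HC] := @chi_density R d d0; exists C => // x x0.
have mA := measurable_sqrt_ge x.
have mshape : measurable_fun [set: R] (fun r => (C * chi_shape d r)%:E).
  by apply/measurable_EFinP; apply: measurable_funM => //; exact: measurable_chi_shape.
have mind : measurable_fun [set: R] (fun u : R => (\1_([set u : R | x <= Num.sqrt u]) u)%:E : \bar R).
  by apply/measurable_EFinP; exact: measurable_indic.
transitivity (\int[chi_square d]_u (\1_([set u : R | x <= Num.sqrt u]) u)%:E)%E.
  by rewrite integral_indic// setIT.
rewrite (HC (fun u => (\1_([set u : R | x <= Num.sqrt u]) u)%:E)); last 2 first.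
- by apply/measurable_EFinP; exact: measurable_indic.
- by move=> u; rewrite lee_fin.
rewrite -integral_itv_obnd_cbnd; last exact: measurable_funTS.
rewrite -ge0_integralZl//; last 3 first.
- apply: emeasurable_funM; last by apply/measurable_EFinP; exact: measurable_pos_chi_shape.
  by apply: (measurableT_comp mind); exact: measurable_funX.
- by move=> r _; rewrite mule_ge0 ?lee_fin ?pos_chi_shape_ge0.
- by rewrite lee_fin ltW.
rewrite [RHS]integral_itv_obnd_cbnd; last exact: measurable_funTS.
rewrite -[RHS]integral_itv_obnd_cbnd; last exact: measurable_funTS.
have E : (\int[mu]_(r in `]x, +oo[) (C * chi_shape d r)%:E =
  \int[mu]_(r in `[x, +oo[) (if (0 < r)%R then (C * chi_shape d r)%:E else 0))%E.
  rewrite -integral_itv_obnd_cbnd; last first.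
    by apply: measurable_funTS; apply: measurable_fun_ifT => //; exact: measurable_fun_ltr.
  by apply: eq_integral => r; rewrite inE/= in_itv/= andbT => xr; rewrite (le_lt_trans x0 xr).
rewrite E [RHS]integral_mkcond; apply: eq_integral => r _.
rewrite patchE mem_setE in_itv/= andbT indicE /pos_chi_shape; case: ifPn => r0; last by rewrite !mule0; case: ifP.
rewrite (_ : (r ^+ 2 \in _) = (x <= r)); last first.
  by apply/idP/idP; rewrite ?inE/= sqrtr_sqr gtr0_norm.
by case: ifP => xr; rewrite ?mul1e ?EFinM// mul0e mule0.
Qed.

Definition chi_q d x : R := fine (chi_tail d x).

Lemma chi_q_fin d x : chi_tail d x = (chi_q d x)%:E.
Proof. by rewrite /chi_q fineK// fin_num_measure//; exact: measurable_sqrt_ge. Qed.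

Lemma chi_q0 d x : x <= 0 -> chi_q d x = 1.
Proof. by move=> x0; rewrite /chi_q chi_tail0. Qed.

Lemma chi_q_le1 d x : chi_q d x <= 1.
Proof. by rewrite -lee_fin -chi_q_fin; apply: probability_le1; exact: measurable_sqrt_ge. Qed.

(** Each degree of freedom adds the variance of a standard Gaussian variable to the
    mean. The maximum with zero gives a nonnegative integrand on the whole line. *)
Lemma integral_chi_square_id d : (\int[@chi_square R d]_u (Num.max u 0)%:E <= d%:R%:E)%E.
Proof.
have mmax : measurable_fun [set: R] (fun u : R => (Num.max u 0)%:E).
  by apply/measurable_EFinP; exact: measurable_maxr.
have max0 (u : R) : (0 <= (Num.max u 0)%:E)%E by rewrite lee_fin le_max lexx orbT.
elim: d => [|d IH]; first by rewrite integral_chi_square0// maxxx.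
rewrite integral_chi_squareS//.
apply: (@le_trans _ _ (\int[chi_square d]_u ((Num.max u 0)%:E + 1))%E); last first.
  rewrite ge0_integralD// integral_cst// -natr1 EFinD.
  by rewrite mul1e -[X in (_ + X <= _)%E](esym (probability_setT (@chi_square R d))) leeD.
apply: ge0_le_integral => //.
- by move=> u _; exact: integral_ge0.
- exact: (@measurable_fun_fubini_tonelli_F _ _ R (measurableTypeR R) R gaussian _ (measurable_add_sqr mmax) (fun p => max0 _)).
- exact: emeasurable_funD.
- move=> u _.
  have -> : ((Num.max u 0)%:E + 1 = \int[@gaussian R]_z ((Num.max u 0)%:E + ((z : R) ^+ 2)%:E))%E.
    rewrite ge0_integralD//.
    + by rewrite gaussian_cst gaussian_variance.
    + by move=> z _; rewrite lee_fin sqr_ge0.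
    + by apply/measurable_EFinP; exact: measurable_funX.
  apply: ge0_le_integral => //.
  + by apply: (measurableT_comp mmax); apply: measurable_funD => //; exact: measurable_funX.
  + by apply: emeasurable_funD => //; apply/measurable_EFinP; exact: measurable_funX.
  + move=> z _; rewrite -EFinD lee_fin; have := sqr_ge0 (z : R).
    by case: (leP u 0) => ?; case: (leP (u + (z : R) ^+ 2) 0) => ? ?; lra.
Qed.

Lemma chi_q_markov d x : 0 < x -> x ^+ 2 * chi_q d x <= d%:R.
Proof.
move=> x0; rewrite -lee_fin EFinM -chi_q_fin.
apply: le_trans (integral_chi_square_id d).
have mA := measurable_sqrt_ge x.
rewrite (_ : chi_tail d x = \int[chi_square d]_u (\1_([set u : R | x <= Num.sqrt u]) u)%:E)%E; last first.
  by rewrite integral_indic// setIT.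
rewrite -ge0_integralZl//; last 2 first.
- by apply/measurable_EFinP; exact: measurable_indic.
- by rewrite lee_fin sqr_ge0.
apply: ge0_le_integral => //.
- by move=> u _; rewrite -EFinM lee_fin mulr_ge0 ?sqr_ge0.
- by apply: emeasurable_funM => //; apply/measurable_EFinP; exact: measurable_indic.
- by apply/measurable_EFinP; exact: measurable_maxr.
move=> u _; rewrite -EFinM lee_fin indicE.
have [uA|_] := boolP (u \in _); last by rewrite mulr0 le_max lexx orbT.
move: uA; rewrite inE/= mulr1 => xu.
have u0 : 0 <= u.
  by rewrite leNgt; apply/negP => /ltW /ler0_sqrtr h; move: xu; rewrite h leNgt x0.
by rewrite le_max -[X in _ <= X](sqr_sqrtr u0) lerXn2r ?nnegrE ?sqrtr_ge0 ?xu// ltW.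
Qed.

(** On [0 <= x] the tail is one minus the integral of a continuous density. The
    constant [C] is the same in the three statements, so that later arguments can use
    the density, its derivative and the value at the origin together. *)
Lemma chi_q_derive d : (0 < d)%N -> exists2 C : R, 0 < C &
  [/\ forall x, 0 <= x -> chi_tail d x = (\int[mu]_(r in `[x, +oo[) (C * chi_shape d r)%:E)%E,
      forall x, 0 < x -> is_derive x 1 (chi_q d) (- (C * chi_shape d x)) &
      forall b, {within `[0, b], continuous (chi_q d)}].
Proof.
move=> d0; have [C C0 HC] := chi_tailE d0; exists C => //.
pose p r := C * chi_shape d r.
have cp : continuous p by move=> r; apply: cvgM; [exact: cvg_cst|exact: continuous_chi_shape].
have mp : measurable_fun [set: R] (EFin \o p) by apply/measurable_EFinP; exact: continuous_measurable_fun.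
have p0 r : 0 <= r -> 0 <= p r by move=> r0; rewrite mulr_ge0 ?chi_shape_ge0// ltW.
have ip b : mu.-integrable `[0, b] (EFin \o p).
  apply: continuous_compact_integrable; first exact: segment_compact.
  exact: continuous_subspaceT.
pose H x := (\int[mu]_(t in `[0, x]) p t)%R.
have qH x : 0 <= x -> chi_q d x = 1 - H x.
  move=> x0.
  have fH : (\int[mu]_(t in `[0%R, x]) (p t)%:E = (H x)%:E)%E.
    by rewrite /H /Rintegral fineK//; exact: (integrable_fin_num _ (ip x)).
  have one : (\int[mu]_(r in `[0%R, +oo[) (p r)%:E = 1)%E by rewrite -HC// chi_tail0.
  move: one; rewrite (_ : `[0, +oo[%classic = `[0, x] `|` `]x, +oo[)%classic; last first.
    apply/seteqP; split => r /=; rewrite !in_itv/= !andbT.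
      by move=> r0; rewrite r0/=; case: (leP r x); [left|right].
    by case=> [/andP[]//|/ltW/(le_trans x0)].
  rewrite ge0_integral_setU//=; last 3 first.
  - exact: measurable_funTS.
  - by move=> r /=; rewrite !in_itv/= andbT => -[/andP[r0 _]|/ltW/(le_trans x0) r0]; rewrite lee_fin p0.
  - apply/disj_setPS => r [] /=; rewrite !in_itv/= andbT => /andP[_ r0] r1.
    by have := lt_le_trans r1 r0; rewrite ltxx.
  rewrite fH integral_itv_obnd_cbnd; last exact: measurable_funTS.
  rewrite -HC// chi_q_fin -EFinD => -[] h; lra.
split=> //.
  move=> x x0.
  have xx1 : x < x + 1 by rewrite ltrDl.
  have [dH HE] := @continuous_FTC1_closed R p 0 x (x + 1) xx1 (ip _) x0 (cp x).
  have dHx : is_derive x 1 H (p x) := DeriveDef dH (etrans (esym (derive1E H x)) HE).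
  have near_eq : \forall y \near x, (1 - H y) = chi_q d y.
    near=> y; rewrite qH//; apply: ltW; near: y.
    by apply: open_nbhs_nbhs; split => //; exact: open_gt.
  have dQ : is_derive x 1 (fun y => 1 - H y) (- p x).
    by rewrite -[- p x]add0r; exact: is_deriveB.
  exact: (near_eq_is_derive near_eq dQ).
move=> b.
have [b0|b0] := ltP b 0.
  by rewrite set_itv_ge ?bnd_simp -?ltNge//; apply: continuous_subspace0.
have cH : {within `[0, b], continuous (fun x => 1 - H x)}.
  move=> x; apply: cvgB; first exact: cvg_cst.
  exact: (parameterized_integral_continuous b0 (ip b)).
apply: (subspace_eq_continuous _ cH) => x; rewrite inE/= in_itv/= => /andP[x0 _].
exact/esym/qH.
Unshelve. all: by end_near. Qed.

End chi_tail.

(** * Quantiles and mode of the chi distribution *)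

Section chi_tail_estimates.
Context {R : realType}.
Implicit Types (r x y u h t : R) (d k : nat).

Lemma chi_shape_gt0 d r : 0 < r -> 0 < chi_shape d r.
Proof. by move=> r0; rewrite mulr_gt0 ?expR_gt0// exprn_gt0. Qed.

Lemma chi_q_lt d x y : (0 < d)%N -> 0 <= x -> x < y -> chi_q d y < chi_q d x.
Proof.
move=> d0 x0 xy; have [C C0 [_ dq cq]] := @chi_q_derive R d d0.
have pos z : z \in `]x, y[ -> 0 < z by rewrite in_itv/= => /andP[xz _]; exact: le_lt_trans xz.
have [|c /pos c0 E] := MVT xy (fun z zi => dq z (pos z zi)).
  apply: continuous_subspaceW (cq y) => z /=; rewrite !in_itv/= => /andP[xz ->].
  by rewrite (le_trans x0 xz).
rewrite -subr_lt0 E mulNr oppr_lt0 mulr_gt0 ?subr_gt0// mulr_gt0//.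
exact: chi_shape_gt0.
Qed.

Lemma chi_q_le d x y : (0 < d)%N -> x <= y -> chi_q d y <= chi_q d x.
Proof.
move=> d0; rewrite le_eqVlt => /predU1P[->//|xy].
have [x0|x0] := leP 0 x; first exact/ltW/chi_q_lt.
by rewrite (chi_q0 d (ltW x0)) chi_q_le1.
Qed.

Lemma chi_q_small d e : 0 < e -> exists2 Y : R, 0 < Y & forall y, Y <= y -> chi_q d y <= e.
Proof.
move=> e0; exists (1 + d%:R / e) => [|y Yy]; first by rewrite ltr_pwDl// divr_ge0// ltW.
have de0 : 0 <= d%:R / e by rewrite divr_ge0// ltW.
have y1 : 1 <= y by lra.
have y0 : 0 < y by lra.
have := chi_q_markov d y0.
have yde : d%:R / e <= y by lra.
have : d%:R <= e * y ^+ 2.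
  have : d%:R <= y * e by rewrite -ler_pdivrMr.
  have : 0 <= e * (y * (y - 1)) by rewrite !mulr_ge0 ?(ltW e0) ?(ltW y0)// subr_ge0.
  by rewrite expr2; lra.
move=> h1 h2; have {h1 h2} := le_trans h2 h1.
by rewrite (mulrC e) ler_pM2l// exprn_gt0.
Qed.

Lemma chi_q_gt0 d x : (0 < d)%N -> 0 < chi_q d x.
Proof.
move=> d0; have [x0|x0] := ltP x 0; first by rewrite chi_q0// ltW.
have x1 : x < x + 1 by rewrite ltrDl.
apply: le_lt_trans (chi_q_lt d0 x0 x1).
by rewrite -lee_fin -chi_q_fin measure_ge0.
Qed.

(** The tail decreases continuously from one to zero, so the intermediate value
    theorem provides a point for the choice made in the definition of the quantile. *)
Lemma chi_quantileP d (delta : R) : (0 < d)%N -> 0 < delta < 1 ->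
  0 < chi_quantile d delta /\ chi_q d (chi_quantile d delta) = delta.
Proof.
move=> d0 /andP[de0 de1].
have [Y Y0 HY] := chi_q_small d de0.
have [C C0 [_ dq cq]] := @chi_q_derive R d d0.
have [|x xY Ex] := IVT (ltW Y0) (cq Y) (v := delta).
  rewrite chi_q0//; apply/andP; split.
    by rewrite ge_min HY ?orbT.
  by rewrite le_max (ltW de1).
have : [set x : R | chi_tail d x = delta%:E] (chi_quantile d delta).
  by apply: xgetPex; exists x; rewrite /= chi_q_fin Ex.
rewrite /= chi_q_fin => -[] H; split => //.
by rewrite ltNge; apply/negP => h; move: de1; rewrite -H chi_q0// ltxx.
Qed.

Lemma lt_chi_quantile d x (delta : R) : (0 < d)%N -> 0 < delta < 1 -> delta < chi_q d x ->
  x < chi_quantile d delta.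
Proof.
move=> d0 de xd; have [q0 qE] := chi_quantileP d0 de.
rewrite ltNge; apply/negP => /(chi_q_le d0); rewrite qE leNgt => /negP; exact.
Qed.

Lemma gt_chi_quantile d x (delta : R) : (0 < d)%N -> 0 < delta < 1 -> chi_q d x < delta ->
  chi_quantile d delta < x.
Proof.
move=> d0 de xd; have [q0 qE] := chi_quantileP d0 de.
rewrite ltNge; apply/negP => /(chi_q_le d0); rewrite qE leNgt => /negP; exact.
Qed.

(** The derivative of the difference is [t * (expR t - expR (- t))]. *)
Lemma expR_symmetric_lt t : 0 < t -> (1 - t) * expR t < (1 + t) * expR (- t).
Proof.
move=> t0; pose f s : R := (1 + s) * expR (- s) - (1 - s) * expR s.
have df (s : R) : is_derive s 1 f (s * (expR s - expR (- s))).
  by rewrite /f; apply: is_derive_eq; rewrite /GRing.scale/=; ring.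
have [c /[!in_itv]/= /andP[c0 _] E] := MVT t0 (fun s _ => df s) (continuous_subspaceT (fun s => is_derive_continuous (df s))).
rewrite -subr_gt0 -/(f t) (_ : f t = f t - f 0); last first.
  by rewrite /f addr0 subr0 oppr0 expR0 subrr subr0.
rewrite E !mulr_gt0//; last by rewrite subr0.
by rewrite subr_gt0 ltr_expR; lra.
Qed.

Lemma expR_quadratic_le t : 0 <= t -> expR (t - t ^+ 2 / 2) <= 1 + t.
Proof.
move=> t0; pose f s : R := (1 + s) * expR (s ^+ 2 / 2 - s).
have df (s : R) : is_derive s 1 f (s ^+ 2 * expR (s ^+ 2 / 2 - s)).
  rewrite /f; apply: is_derive_eq.
  by rewrite !scaler0 !add0r /GRing.scale/= !mulr1; field.
have := @derive_ge0_homo R f (fun s => s ^+ 2 * expR (s ^+ 2 / 2 - s)) 0 t t0 (fun s _ => df s).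
rewrite {1}/f expr0n/= mul0r subrr expR0 addr0 mulr1 => H.
have {}H : 1 <= f t by apply: H => s _; rewrite mulr_ge0 ?sqr_ge0 ?expR_ge0.
have -> : t - t ^+ 2 / 2 = - (t ^+ 2 / 2 - t) by ring.
by rewrite expRN -[leLHS]mul1r ler_pdivrMr ?expR_gt0.
Qed.

Definition chi_mode d : R := Num.sqrt d.-1%:R.

Lemma chi_mode2 d : chi_mode d ^+ 2 = d.-1%:R.
Proof. by rewrite sqr_sqrtr. Qed.

Lemma chi_mode_ge0 d : 0 <= chi_mode d. Proof. exact: sqrtr_ge0. Qed.

Lemma chi_mode_gt0 d : (1 < d)%N -> 0 < chi_mode d.
Proof. by case: d => [|[|d]]// _; rewrite sqrtr_gt0 ltr0n. Qed.

(** In units of the mode the density is the power [d - 1] of a function that does not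
    depend on [d], so that bounds for this one function are bounds for all [d]. *)
Lemma chi_shape_mode d y : chi_shape d (chi_mode d * y) =
  chi_mode d ^+ d.-1 * (y * expR (- (y ^+ 2 / 2))) ^+ d.-1.
Proof.
rewrite /chi_shape !exprMn chi_mode2 -mulrA; congr (_ * (_ * _)).
by rewrite -expRM_natl; congr expR; field.
Qed.

(** In units of the mode this is [expR_symmetric_lt] raised to the power [d - 1]. *)
Lemma chi_shape_reflect_lt d h : (1 < d)%N -> 0 < h <= chi_mode d ->
  chi_shape d (chi_mode d - h) < chi_shape d (chi_mode d + h).
Proof.
move=> d1 /andP[h0 hm]; have m0 := chi_mode_gt0 d1.
have m2 := chi_mode2 d.
set m := chi_mode d in hm m0 m2 *.
pose t := h / m.
have t0 : 0 < t by rewrite divr_gt0.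
have t1 : t <= 1 by rewrite ler_pdivrMr// mul1r.
have hE : h = m * t by rewrite /t mulrCA divff ?mulr1// gt_eqF.
have -> : m - h = m * (1 - t) by rewrite hE; ring.
have -> : m + h = m * (1 + t) by rewrite hE; ring.
rewrite !chi_shape_mode ltr_pM2l ?exprn_gt0//.
have t11 : 0 <= (1 - t) * expR (- ((1 - t) ^+ 2 / 2)) by rewrite mulr_ge0 ?expR_ge0// subr_ge0.
have t12 : 0 <= (1 + t) * expR (- ((1 + t) ^+ 2 / 2)) by rewrite mulr_ge0 ?expR_ge0//; lra.
rewrite ltrXn2r ?nnegrE//; first by case: (d) d1 => [|[]].
have E1 : expR (- ((1 - t) ^+ 2 / 2)) = expR t * expR (- ((1 + t ^+ 2) / 2)).
  by rewrite -expRD; congr expR; field.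
have E2 : expR (- ((1 + t) ^+ 2 / 2)) = expR (- t) * expR (- ((1 + t ^+ 2) / 2)).
  by rewrite -expRD; congr expR; field.
by rewrite E1 E2 !mulrA ltr_pM2r ?expR_gt0// expR_symmetric_lt.
Qed.

(** In units of the mode, with [h = m * t] and [m ^+ 2 = d - 1], both sides are powers
    [d - 1], and the bases compare by [expR_quadratic_le]. *)
Lemma chi_shape_mode_lb d h : 0 <= h ->
  chi_shape d (chi_mode d) * expR (- h ^+ 2) <= chi_shape d (chi_mode d + h).
Proof.
move=> h0; have [d1|d1] := ltnP 1 d; last first.
  have -> : chi_mode d = 0 by rewrite /chi_mode; case: d d1 => [|[|]]//= _; rewrite sqrtr0.
  rewrite add0r /chi_shape (_ : d.-1 = 0)%N; last by case: d d1 => [|[|]].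
  rewrite !expr0 !mul1r expr0n/= mul0r oppr0 expR0 mul1r ler_expR lerN2.
  by have := sqr_ge0 h; lra.
have m0 := chi_mode_gt0 d1.
have m2 := chi_mode2 d.
set m := chi_mode d in m0 m2 *.
pose t := h / m.
have t0 : 0 <= t by rewrite divr_ge0// ltW.
have hE : h = m * t by rewrite /t mulrCA divff ?mulr1// gt_eqF.
have -> : m + h = m * (1 + t) by rewrite hE; ring.
have m1 : chi_shape d m = chi_shape d (m * 1) by rewrite mulr1.
rewrite m1 !chi_shape_mode -/m -mulrA ler_pM2l ?exprn_gt0//.
have -> : expR (- h ^+ 2) = expR (- t ^+ 2) ^+ d.-1.
  by rewrite -expRM_natl -m2 hE exprMn mulrN.
rewrite -exprMn lerXn2r ?nnegrE ?mulr_ge0 ?expR_ge0//; first by lra.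
rewrite mul1r expr1n -expRD.
have -> : - (1 / 2) + - t ^+ 2 = (t - t ^+ 2 / 2) + (- ((1 + t) ^+ 2 / 2)) by field.
rewrite expRD ler_wpM2r ?expR_ge0//; exact: expR_quadratic_le.
Qed.

(** In units of the mode, with [r = m * y] and [m ^+ 2 = d - 1], both sides are powers
    [d - 1], and the bases compare by [y <= expR (y - 1)]. *)
Lemma chi_shape_mode_ub d r : 0 <= r ->
  chi_shape d r <= chi_shape d (chi_mode d) * expR (- ((r - chi_mode d) ^+ 2 / 2)).
Proof.
move=> r0; have [d1|d1] := ltnP 1 d; last first.
  have -> : chi_mode d = 0 by rewrite /chi_mode; case: d d1 => [|[|]]//= _; rewrite sqrtr0.
  rewrite subr0 /chi_shape (_ : d.-1 = 0)%N; last by case: d d1 => [|[|]].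
  by rewrite !expr0 !mul1r expr0n/= mul0r oppr0 expR0 mul1r.
have m0 := chi_mode_gt0 d1.
have m2 := chi_mode2 d.
set m := chi_mode d in m0 m2 *.
pose y := r / m.
have y0 : 0 <= y by rewrite divr_ge0// ltW.
have rE : r = m * y by rewrite /y mulrCA divff ?mulr1// gt_eqF.
have rm : r - m = m * (y - 1) by rewrite rE; ring.
have m1 : chi_shape d m = chi_shape d (m * 1) by rewrite mulr1.
rewrite rm rE m1 !chi_shape_mode -/m -mulrA ler_pM2l ?exprn_gt0//.
have -> : expR (- ((m * (y - 1)) ^+ 2 / 2)) = expR (- ((y - 1) ^+ 2 / 2)) ^+ d.-1.
  by rewrite -expRM_natl -m2 exprMn; congr expR; field.
have y1 : 0 <= y * expR (- (y ^+ 2 / 2)) by rewrite mulr_ge0 ?expR_ge0.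
have y2 : 0 <= 1 * expR (- (1 ^+ 2 / 2)) * expR (- ((y - 1) ^+ 2 / 2)) by rewrite !mulr_ge0 ?expR_ge0.
rewrite -exprMn lerXn2r ?nnegrE// mul1r expr1n -expRD.
have -> : - (1 / 2) + - ((y - 1) ^+ 2 / 2) = (y - 1) + (- (y ^+ 2 / 2)) by field.
rewrite expRD ler_wpM2r ?expR_ge0//.
by have := expR_ge1Dx (y - 1); lra.
Qed.

(** The density is at most [C] on the unit interval; this is continuity at the origin
    in an explicit form. *)
Lemma chi_q_near0 d (C : R) u : (0 < d)%N -> 0 < C -> (forall x, 0 < x -> is_derive x 1 (chi_q d) (- (C * chi_shape d x))) ->
  {within `[0, u], continuous (chi_q d)} -> 0 < u -> u <= 1 -> 1 - C * u <= chi_q d u.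
Proof.
move=> d0 C0 dq cq u0 u1.
have aux s : s \in `]0, u[ -> 0 < s by rewrite in_itv/= => /andP[].
have [c /[!in_itv]/= /andP[c0 cz] Ec] := MVT u0 (fun s si => dq s (aux s si)) cq.
move: Ec; rewrite (chi_q0 d (lexx 0)) subr0 => Ec.
have -> : chi_q d u = 1 - C * chi_shape d c * u by lra.
rewrite lerD2l lerN2 ler_wpM2r ?(ltW u0)// -[leRHS]mulr1 ler_wpM2l ?(ltW C0)//.
rewrite /chi_shape mulr_ile1 ?expR_ge0 ?exprn_ge0 ?(ltW c0)// ?exprn_ile1 ?(ltW c0)//; first by lra.
by rewrite -[leRHS]expR0 ler_expR; have := sqr_ge0 c; lra.
Qed.

(** Reflecting at the mode [m] increases the density, so the mass of the interval
    between [m] and [2 * m] exceeds the mass below [m]: the quantity [- (q (m + h) + q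
    (m - h))] increases with [h], and as [h] tends to [m] it is at most [- 1] plus an
    arbitrarily small amount. *)
Lemma chi_q_mode_gt d : (0 < d)%N -> 2^-1 < chi_q d (chi_mode d).
Proof.
move=> d0; have [d1|d1] := ltnP 1 d; last first.
  have -> : chi_mode d = 0 by rewrite /chi_mode; case: d d1 {d0} => [|[|]]//= _; rewrite sqrtr0.
  by rewrite chi_q0//; lra.
have m0 := chi_mode_gt0 d1.
have [C C0 [_ dq cq]] := @chi_q_derive R d d0.
set m := chi_mode d in m0 *.
(* up to a constant, the mass between [m] and [m + h] less that between [m - h] and
   [m] *)
pose E h := - (chi_q d (m + h) + chi_q d (m - h)).
have dE h : 0 <= h < m -> is_derive h 1 E (C * (chi_shape d (m + h) - chi_shape d (m - h))).
  move=> /andP[h0 hm].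
  have d1q := dq (m + h) ltac:(lra).
  have d2q := dq (m - h) ltac:(lra).
  have d1m : is_derive h 1 (fun s : R => m + s) (1 : R).
    by apply: is_derive_eq; rewrite add0r mulr1.
  have d2m : is_derive h 1 (fun s : R => m - s) (- 1 : R) by apply: is_derive_eq; lra.
  have e1 := @is_derive1_comp R (chi_q d) (fun s : R => m + s) h _ _ d1q d1m.
  have e2 := @is_derive1_comp R (chi_q d) (fun s : R => m - s) h _ _ d2q d2m.
  have -> : E = (fun s => - ((chi_q d \o (fun s : R => m + s)) s + (chi_q d \o (fun s : R => m - s)) s)) by [].
  by apply: is_derive_eq; ring.
have mono a b : 0 <= a -> a < b -> b < m -> E a < E b.
  move=> a0 ab bm.
  have aux z : z \in `]a, b[ -> 0 <= z < m by rewrite in_itv/= => /andP[? ?]; apply/andP; split; lra.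
  have [|c cab Ec] := MVT ab (fun z zi => dE z (aux z zi)).
    apply: continuous_in_subspaceT => z; rewrite inE/= in_itv/= => /andP[? ?].
    by apply: is_derive_continuous (dE z _); apply/andP; split; lra.
  rewrite -subr_gt0 Ec !mulr_gt0 ?subr_gt0//; apply: chi_shape_reflect_lt => //.
  by move: cab; rewrite in_itv/= => /andP[? ?]; apply/andP; split; rewrite -/m; lra.
have E0 : E 0 = - (chi_q d m + chi_q d m) by rewrite /E addr0 subr0.
have gap : E 0 < E (m / 2) by apply: mono; lra.
pose g := E (m / 2) - E 0.
have g0 : 0 < g by rewrite subr_gt0.
(* so close to zero that the tail at [z] differs from one by at most half of the gain
   made between [h = 0] and [h = m / 2] *)
pose z := Num.min (m / 4) (Num.min 1 (g / (2 * C))).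
have z0 : 0 < z by rewrite !lt_min divr_gt0//= ltr01/= divr_gt0// mulr_gt0.
have zm : z <= m / 4 by rewrite ge_min lexx.
have z1 : z <= 1 by rewrite !ge_min lexx orbT.
have zg : C * z <= g / 2.
  have : z <= g / (2 * C) by rewrite !ge_min lexx !orbT.
  by rewrite ler_pdivlMr ?mulr_gt0//; lra.
have := chi_q_near0 d0 C0 dq (cq z) z0 z1.
have : E (m / 2) < E (m - z) by apply: mono; lra.
have := chi_q_gt0 (m + (m - z)) d0.
have : E (m - z) = - (chi_q d (m + (m - z)) + chi_q d z) by rewrite /E; congr (- (_ + chi_q d _)); lra.
move: zg; rewrite /g E0; lra.
Qed.

End chi_tail_estimates.

(** * Comparison of chi tails at shifted points *)

Section chi_tail_comparison.
Context {R : realType}.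
Implicit Types (r x y u h t : R) (d k : nat).

Lemma ge0_of_decreasing (f df : R -> R) x :
  (forall u, x <= u -> is_derive u 1 f (df u)) -> (forall u, x <= u -> df u <= 0) ->
  (forall e : R, 0 < e -> exists2 Y, x <= Y & - e <= f Y) -> 0 <= f x.
Proof.
move=> dF df0 lim; rewrite leNgt; apply/negP => fx.
have e0 : 0 < - f x / 2 by lra.
have [Y xY HY] := lim _ e0.
suff : - f x <= - f Y by lra.
apply: (@derive_ge0_homo R (fun u => - f u) (fun u => - df u) x Y xY).
- by move=> u /andP[xu _]; have := dF u xu => dFu; exact: is_deriveN.
- by move=> u /andP[xu _]; have := df0 u xu; lra.
Qed.

(** How tail inequalities are derived from density inequalities: a strictly decreasing
    function that does not become negative at infinity is positive. *)
Lemma gt0_of_decreasing (f df : R -> R) x :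
  (forall u, x <= u -> is_derive u 1 f (df u)) -> (forall u, x <= u -> df u < 0) ->
  (forall e : R, 0 < e -> exists2 Y, x + 1 <= Y & - e <= f Y) -> 0 < f x.
Proof.
move=> dF df0 lim.
have f1 : 0 <= f (x + 1).
  apply: (@ge0_of_decreasing f df) => // u xu; first by apply: dF; lra.
  by apply/ltW/df0; lra.
apply: le_lt_trans f1 _.
have xx1 : x < x + 1 by rewrite ltrDl.
have aux u : u \in `]x, x + 1[ -> x <= u by rewrite in_itv/= => /andP[/ltW].
have [|c /aux xc E] := MVT xx1 (fun u ui => dF u (aux u ui)).
  by apply: continuous_in_subspaceT => u; rewrite inE/= in_itv/= => /andP[xu _]; exact: is_derive_continuous (dF u xu).
have := df0 c xc; move: E; rewrite (_ : x + 1 - x = 1); last by ring.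
by rewrite mulr1; lra.
Qed.

(** The logarithmic derivative of the density at [u >= x] is at most [d.-1 / x - x],
    and this bound integrates over a shift by [h]. *)
Lemma chi_shape_shift_lt d h x u : 0 < h -> 0 < x -> x <= u ->
  chi_shape d (u + h) < chi_shape d u * expR (- ((x - d.-1%:R / x) * h)).
Proof.
move=> h0 x0 xu; have u0 : 0 < u by lra.
rewrite /chi_shape -mulrA -expRD.
apply: (@lt_le_trans _ _ (u ^+ d.-1 * (expR (d.-1%:R * (h / x)) * expR (- (u ^+ 2 / 2) - u * h)))); last first.
  rewrite ler_pM2l ?exprn_gt0// -expRD ler_expR.
  have xh : x * h <= u * h by rewrite ler_pM2r.
  have -> : (x - d.-1%:R / x) * h = x * h - d.-1%:R * (h / x) by field; rewrite gt_eqF.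
  by lra.
rewrite [ltRHS]mulrA.
have e2 : expR (- ((u + h) ^+ 2 / 2)) < expR (- (u ^+ 2 / 2) - u * h).
  by rewrite ltr_expR; have : 0 < h ^+ 2 by [rewrite exprn_gt0]; lra.
apply: le_lt_trans (_ : u ^+ d.-1 * expR (d.-1%:R * (h / x)) * expR (- ((u + h) ^+ 2 / 2)) < _); last first.
  by rewrite ltr_pM2l// mulr_gt0 ?expR_gt0// exprn_gt0.
rewrite ler_pM2r ?expR_gt0// expRM_natl -exprMn lerXn2r ?nnegrE ?mulr_ge0 ?expR_ge0 ?(ltW u0)//; first by lra.
apply: (@le_trans _ _ (u * (1 + h / x))); last by rewrite ler_pM2l// expR_ge1Dx.
by rewrite mulrDr mulr1 lerD2l mulrCA ler_peMr ?(ltW h0)// ler_pdivlMr// mul1r.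
Qed.

(** The inequality holds for the densities at every point beyond [x], hence for the
    tails. It turns a ratio of probability levels into a distance between quantiles. *)
Lemma chi_q_shift_lt d h x : (0 < d)%N -> 0 < h -> 0 < x ->
  chi_q d (x + h) < chi_q d x * expR (- ((x - d.-1%:R / x) * h)).
Proof.
move=> d0 h0 x0.
have [C C0 [_ dq _]] := @chi_q_derive R d d0.
set K := expR _; have K0 : 0 < K by exact: expR_gt0.
pose f u := chi_q d u * K - chi_q d (u + h).
rewrite -subr_gt0 -/(f x).
apply: (@gt0_of_decreasing f (fun u => - (C * chi_shape d u) * K + C * chi_shape d (u + h))).
- move=> u xu.
  have d1q := dq u ltac:(lra).
  have d2q := dq (u + h) ltac:(lra).
  have d1m : is_derive u 1 (fun s : R => s + h) (1 : R) by apply: is_derive_eq; rewrite addr0.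
  have e2 := @is_derive1_comp R (chi_q d) (fun s : R => s + h) u _ _ d2q d1m.
  have -> : f = (fun s => (chi_q d s * K - (chi_q d \o (fun s : R => s + h)) s)) by [].
  by apply: is_derive_eq; rewrite /GRing.scale/=; ring.
- move=> u xu; have := chi_shape_shift_lt d h0 x0 xu; rewrite -/K => H.
  have : C * chi_shape d (u + h) < C * (chi_shape d u * K) by rewrite ltr_pM2l.
  by lra.
- move=> e e0; have [Y Y0 HY] := chi_q_small d e0.
  exists (x + 1 + Y); first by lra.
  rewrite /f; have := HY (x + 1 + Y + h) ltac:(lra).
  have : 0 <= chi_q d (x + 1 + Y) * K by rewrite mulr_ge0 ?(ltW K0)// ltW// chi_q_gt0.
  by lra.
Qed.

(** The lower bound does not depend on [d]. The density is at most its maximum times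
    [expR (- (r - m) ^+ 2 / 2)], whose integral is at most the maximum divided by
    [normal_peak 1], so the maximum is at least [normal_peak 1]; and at distance at
    most [M + 1] beyond the mode the density is still at least [expR (- (M + 1) ^+ 2)]
    times the maximum. *)
Lemma chi_q_mode_lb d (M : R) : (0 < d)%N -> 0 <= M ->
  normal_peak 1 * expR (- (M + 1) ^+ 2) <= chi_q d (chi_mode d + M).
Proof.
move=> d0 M0; have [C C0 [HC dq _]] := @chi_q_derive R d d0.
have mge0 := @chi_mode_ge0 R d.
set m := chi_mode d in mge0 *.
(* the maximum of the density *)
pose P := C * chi_shape d m.
have mshape : measurable_fun [set: R] (fun r => (C * chi_shape d r)%:E).
  by apply/measurable_EFinP; apply: measurable_funM => //; exact: measurable_chi_shape.
have P0 : 0 <= P by rewrite mulr_ge0 ?(ltW C0)// chi_shape_ge0.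
have k0 : 0 < normal_peak (1 : R) by rewrite normal_peak_gt0 ?oner_eq0.
have PK : normal_peak 1 <= P.
  suff : 1 <= P / normal_peak 1 by rewrite ler_pdivlMr// mul1r.
  have : (1 <= \int[lebesgue_measure]_r ((P / normal_peak 1) * normal_pdf m 1 r)%:E)%E.
    rewrite -(chi_tail0 d (lexx (0 : R))) HC//.
    apply: (@le_trans _ _ (\int[lebesgue_measure]_(r in `[0%R, +oo[) ((P / normal_peak 1) * normal_pdf m 1 r)%:E)%E).
      apply: ge0_le_integral => //.
      - by move=> r /=; rewrite in_itv/= andbT => r0; rewrite lee_fin mulr_ge0 ?(ltW C0)// chi_shape_ge0.
      - exact: measurable_funTS.
      - apply: measurable_funTS; apply/measurable_EFinP; apply: measurable_funM => //.
        exact: measurable_normal_pdf.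
      - move=> r /=; rewrite in_itv/= andbT => r0; rewrite lee_fin.
        have -> : P / normal_peak 1 * normal_pdf m 1 r = P * expR (- ((r - m) ^+ 2 / 2)).
          rewrite normal_pdfE ?oner_eq0// /normal_fun expr1n mulNr mulrA; congr (_ * _).
          by rewrite divfK ?gt_eqF.
        by rewrite /P -mulrA ler_pM2l//; exact: chi_shape_mode_ub.
    apply: ge0_subset_integral => //.
    - apply/measurable_EFinP; apply: measurable_funM => //; exact: measurable_normal_pdf.
    - by move=> r _; rewrite lee_fin mulr_ge0 ?normal_pdf_ge0// divr_ge0// ltW.
  under eq_integral do rewrite EFinM.
  rewrite ge0_integralZl//.
  - by rewrite integral_normal_pdf mule1 lee_fin.
  - by apply/measurable_EFinP; exact: measurable_normal_pdf.
  - by move=> r _; rewrite lee_fin normal_pdf_ge0.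
  - by rewrite lee_fin divr_ge0// ltW.
(* the mass of the unit interval beyond [m + M] is a value [C * chi_shape d c] of the
   density *)
have MM : m + M < m + M + 1 by rewrite ltrDl.
have aux z : z \in `]m + M, m + M + 1[ -> 0 < z.
  by rewrite in_itv/= => /andP[h _]; apply: le_lt_trans h; exact: addr_ge0.
have [|c cM E] := MVT MM (fun z zi => dq z (aux z zi)).
  have [_ _ [_ _ cq]] := @chi_q_derive R d d0.
  apply: continuous_subspaceW (cq (m + M + 1)) => z /=; rewrite !in_itv/= => /andP[xz ->].
  by rewrite (le_trans _ xz)// addr_ge0.
have {}E : chi_q d (m + M) = chi_q d (m + M + 1) + C * chi_shape d c by move: E; rewrite (_ : m + M + 1 - (m + M) = 1); [lra|ring].
rewrite E; apply: ler_wpDl; first by rewrite ltW// chi_q_gt0.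
move: cM; rewrite in_itv/= => /andP[c1 c2].
have h0 : 0 <= c - m by lra.
have := @chi_shape_mode_lb R d _ h0; rewrite -/m (_ : m + (c - m) = c) => [lb|]; last by ring.
apply: (@le_trans _ _ (C * (chi_shape d m * expR (- (c - m) ^+ 2)))); last by rewrite ler_pM2l.
rewrite mulrA -/P; apply: ler_pM; rewrite ?(ltW k0) ?expR_ge0//.
rewrite ler_expR lerN2 lerXn2r ?nnegrE//; lra.
Qed.

End chi_tail_comparison.

(** * Monotone hazard rates *)

Section hazard.
Context {R : realType}.
Implicit Types (r x y u v h t : R) (d k : nat).

(** The difference of the two sides, with the factor [u] frozen, decreases beyond [u]
    and does not become negative at infinity. *)
Lemma chi_hazard1 (C : R) u : 0 < C -> (forall x, 0 < x -> is_derive x 1 (chi_q 1) (- (C * chi_shape 1 x))) ->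
  0 < u -> u * chi_q 1 u <= C * chi_shape 1 u.
Proof.
move=> C0 dq u0; rewrite -subr_ge0.
apply: (@ge0_of_decreasing R (fun s => C * chi_shape 1 s - u * chi_q 1 s)
   (fun s => (u - s) * (C * chi_shape 1 s))).
- move=> s us; have s0 : 0 < s by lra.
  have d1 := is_derive_chi_shape 1 s; have d2 := dq s s0.
  by apply: is_derive_eq; rewrite /GRing.scale/= mul0r mul0r; ring.
- move=> s us; rewrite mulr_le0_ge0 ?subr_le0// mulr_ge0 ?(ltW C0)// chi_shape_ge0//; lra.
- move=> e e0; have eu0 : 0 < e / u by rewrite divr_gt0.
  have [Y Y0 HY] := @chi_q_small R 1 _ eu0.
  exists (u + Y); first by lra.
  have : chi_q 1 (u + Y) <= e / u by apply: HY; lra.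
  rewrite ler_pdivlMr// mulrC => h.
  have : 0 <= C * chi_shape 1 (u + Y) by rewrite mulr_ge0 ?(ltW C0)// chi_shape_ge0//; lra.
  by lra.
Qed.

Lemma chi_shapeE d u : (1 < d)%N -> chi_shape d u = u * chi_shape d.-1 u.
Proof. by case: d => [|[|d]]// _; rewrite /chi_shape/= exprS mulrA. Qed.

Lemma is_derive_chi_shape_pred d u : 0 < u -> is_derive u 1 (chi_shape d.-1)
  ((d.-2%:R / u - u) * chi_shape d.-1 u).
Proof.
move=> u0; have := is_derive_chi_shape d.-1 u.
suff -> : d.-2%:R * u ^+ d.-1.-2 * expR (- (u ^+ 2 / 2)) - u * chi_shape d.-1 u =
   (d.-2%:R / u - u) * chi_shape d.-1 u by [].
rewrite mulrBl; congr (_ - _); rewrite /chi_shape mulrA; congr (_ * _).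
case: d.-2 => [|n]; first by rewrite !mul0r.
by rewrite /= exprS; field; rewrite gt_eqF.
Qed.

(** The derivative of [C * chi_shape d.-1] is [- (1 - d.-2 / s ^+ 2)] times the
    density. Freezing the coefficient at [u], where it is smallest, the difference of
    the two sides decreases beyond [u] and does not become negative at infinity. *)
Lemma chi_hazard2 d (C : R) u : (1 < d)%N -> 0 < C -> (forall x, 0 < x -> is_derive x 1 (chi_q d) (- (C * chi_shape d x))) ->
  0 < u -> (1 - d.-2%:R / u ^+ 2) * chi_q d u <= C * chi_shape d.-1 u.
Proof.
move=> d1 C0 dq u0; rewrite -subr_ge0.
set b := 1 - _.
apply: (@ge0_of_decreasing R (fun s => C * chi_shape d.-1 s - b * chi_q d s)
   (fun s => (d.-2%:R / s ^+ 2 - d.-2%:R / u ^+ 2) * (C * (s * chi_shape d.-1 s)))).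
- move=> s us; have s0 : 0 < s by lra.
  have d1' := is_derive_chi_shape_pred d s0; have d2 := dq s s0.
  apply: is_derive_eq; rewrite /GRing.scale/= (chi_shapeE _ d1) /b; field.
  by rewrite !gt_eqF.
- move=> s us; have s0 : 0 < s by lra.
  apply: mulr_le0_ge0; last first.
    apply: mulr_ge0; first exact: ltW.
    by apply: mulr_ge0; [exact: ltW|apply: chi_shape_ge0; exact: ltW].
  rewrite subr_le0 ler_wpM2l// lef_pV2 ?posrE ?exprn_gt0// lerXn2r ?nnegrE ?(ltW u0) ?(ltW s0)//.
- move=> e e0; have [Y Y0 HY] := @chi_q_small R d _ e0.
  exists (u + Y); first by lra.
  have h1 : chi_q d (u + Y) <= e by apply: HY; lra.
  have h2 : 0 <= C * chi_shape d.-1 (u + Y) by rewrite mulr_ge0 ?(ltW C0)// chi_shape_ge0//; lra.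
  have h3 : 0 <= d.-2%:R / u ^+ 2 * chi_q d (u + Y).
    by rewrite mulr_ge0 ?divr_ge0 ?sqr_ge0// ltW// chi_q_gt0// ltnW.
  by rewrite /b mulrBl mul1r; lra.
Qed.

(** If the hazard rate [rho / q] in the variable [V] is nondecreasing, then [ln q] is
    concave in [V] and lies below its tangent at [V x]. The last hypothesis is the
    sign of the derivative of [rho / q]. *)
Lemma hazard_domination (q rho V dV drho : R -> R) x :
  0 < x -> (forall u, 0 < u -> 0 < q u) -> (forall u, 0 < u -> 0 <= dV u) ->
  (forall u, 0 < u -> is_derive u 1 q (- (dV u * rho u))) ->
  (forall u, 0 < u -> is_derive u 1 V (dV u)) ->
  (forall u, 0 < u -> is_derive u 1 rho (drho u)) ->
  (forall u, 0 < u -> 0 <= drho u * q u + rho u * (dV u * rho u)) ->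
  forall u, 0 < u -> q u * expR (rho x / q x * (V u - V x)) <= q x.
Proof.
move=> x0 q0 dV0 dq dVV dr cond.
have mono u v : 0 < u -> u <= v -> rho u / q u <= rho v / q v.
  move=> u0 uv.
  apply: (@derive_ge0_homo R (fun s => rho s / q s)
    (fun s => (q s)^-1 ^+ 2 * (drho s * q s + rho s * (dV s * rho s))) u v uv).
    move=> s /andP[us _]; have s0 : 0 < s by lra.
    have qn0 : q s != 0 by rewrite gt_eqF// q0.
    have d1 := dq s s0; have d2 := dr s s0; have d3 := is_deriveV qn0 d1.
    by apply: is_derive_eq; rewrite /GRing.scale/=; field.
  move=> s /andP[us _]; have s0 : 0 < s by lra.
  by rewrite mulr_ge0 ?sqr_ge0// cond.
set la := rho x / q x.
pose D u := q u * expR (la * (V u - V x)).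
pose dD u := expR (la * (V u - V x)) * (dV u * (la * q u - rho u)).
have dDE u : 0 < u -> is_derive u 1 D (dD u).
  move=> u0; have d1 := dq u u0; have d2 := dVV u u0.
  have d3 : is_derive u 1 (fun s => la * (V s - V x)) (la * dV u).
    by apply: is_derive_eq; rewrite /GRing.scale/=; ring.
  have d4 := @is_derive1_comp R expR (fun s => la * (V s - V x)) u _ _ (is_derive_expR _) d3.
  have -> : D = (fun s => q s * (expR \o (fun s => la * (V s - V x))) s) by [].
  by apply: is_derive_eq; rewrite /GRing.scale/= /dD; ring.
have Dx : D x = q x by rewrite /D subrr mulr0 expR0 mulr1.
move=> u u0; rewrite -/(D u) -Dx.
have rq s : 0 < s -> rho s = rho s / q s * q s by move=> s0; rewrite divfK// gt_eqF// q0.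
have [ux|xu] := leP u x.
  apply: (@derive_ge0_homo R D dD) => // s /andP[us sx]; have s0 : 0 < s by lra.
    exact: dDE.
  rewrite /dD !mulr_ge0 ?expR_ge0 ?dV0//.
  by rewrite subr_ge0 (rq s)// ler_pM2r ?q0// mono.
rewrite -lerN2.
apply: (@derive_ge0_homo R (fun s => - D s) (fun s => - dD s)) => //.
- exact: ltW.
- move=> s /andP[us sx]; have s0 : 0 < s by lra.
  by have := dDE s s0 => dDs; exact: is_deriveN.
move=> s /andP[us sx]; have s0 : 0 < s by lra.
rewrite /dD -mulrN -mulrN !mulr_ge0 ?expR_ge0 ?dV0//.
by rewrite opprB subr_ge0 (rq s)// ler_pM2r ?q0// mono.
Qed.

(** For one degree of freedom the tail is logarithmically concave in [u]; the hazard
    rate is nondecreasing by [chi_hazard1]. *)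
Lemma chi_q_domination1 (C : R) x u : 0 < C -> (forall x, 0 < x -> is_derive x 1 (chi_q 1) (- (C * chi_shape 1 x))) ->
  0 < x -> 0 < u ->
  chi_q 1 u <= chi_q 1 x * expR (- (C * chi_shape 1 x / chi_q 1 x * (u - x))).
Proof.
move=> C0 dq x0 u0; rewrite expRN ler_pdivlMr ?expR_gt0//.
apply: (@hazard_domination (chi_q 1) (fun u => C * chi_shape 1 u) id (fun=> 1) (fun u => - u * (C * chi_shape 1 u))) => //.
- by move=> v _; exact: chi_q_gt0.
- by move=> v v0; rewrite mul1r; exact: dq.
- move=> v v0; have d1 := is_derive_chi_shape 1 v.
  by apply: is_derive_eq; rewrite /GRing.scale/= mul0r mul0r; ring.
- move=> v v0; have h := chi_hazard1 C0 dq v0.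
  have p0 : 0 <= C * chi_shape 1 v by rewrite mulr_ge0 ?(ltW C0)// chi_shape_ge0// ltW.
  have : 0 <= C * chi_shape 1 v * (C * chi_shape 1 v - v * chi_q 1 v) by rewrite mulr_ge0// subr_ge0.
  by rewrite mul1r; lra.
Qed.

(** For at least two degrees of freedom the tail is logarithmically concave even in [u
    ^+ 2], which is stronger than concavity in [u]; the hazard rate in this variable
    is nondecreasing by [chi_hazard2]. *)
Lemma chi_q_domination2 d (C : R) x u : (1 < d)%N -> 0 < C ->
  (forall x, 0 < x -> is_derive x 1 (chi_q d) (- (C * chi_shape d x))) ->
  0 < x -> 0 < u ->
  chi_q d u <= chi_q d x * expR (- (C / 2 * chi_shape d.-1 x / chi_q d x * (u ^+ 2 - x ^+ 2))).
Proof.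
move=> d1 C0 dq x0 u0; rewrite expRN ler_pdivlMr ?expR_gt0//.
have dgt0 : (0 < d)%N by exact: ltnW.
apply: (@hazard_domination (chi_q d) (fun u => C / 2 * chi_shape d.-1 u) (fun u => u ^+ 2) (fun u => 2 * u)
  (fun u => C / 2 * ((d.-2%:R / u - u) * chi_shape d.-1 u))) => //.
- by move=> v _; exact: chi_q_gt0.
- by move=> v v0; rewrite mulr_ge0// ltW.
- move=> v v0; have := dq v v0; rewrite (chi_shapeE _ d1).
  by rewrite (_ : 2 * v * (C / 2 * chi_shape d.-1 v) = C * (v * chi_shape d.-1 v)); last by field.
- by move=> v v0; apply: is_derive_eq; rewrite /GRing.scale/=; ring.
- move=> v v0; have d1' := is_derive_chi_shape_pred d v0.
  by apply: is_derive_eq; rewrite /GRing.scale/=; ring.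
- move=> v v0; have h := chi_hazard2 d1 C0 dq v0.
  have s0 : 0 <= chi_shape d.-1 v by rewrite chi_shape_ge0// ltW.
  have -> : C / 2 * ((d.-2%:R / v - v) * chi_shape d.-1 v) * chi_q d v +
     C / 2 * chi_shape d.-1 v * (2 * v * (C / 2 * chi_shape d.-1 v)) =
    C / 2 * chi_shape d.-1 v * v * (C * chi_shape d.-1 v - (1 - d.-2%:R / v ^+ 2) * chi_q d v).
    by field; rewrite gt_eqF.
  apply: mulr_ge0; last by rewrite subr_ge0.
  apply: mulr_ge0; last exact: ltW.
  by apply: mulr_ge0 => //; rewrite divr_ge0// ltW.
Qed.

(** The limit of [chi_q_domination2] as [u] tends to zero. *)
Lemma chi_q_domination2_origin d (C : R) x : (1 < d)%N -> 0 < C ->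
  (forall x, 0 < x -> is_derive x 1 (chi_q d) (- (C * chi_shape d x))) ->
  (forall b : R, {within `[0, b], continuous (chi_q d)}) -> 0 < x ->
  1 <= chi_q d x * expR (C / 2 * chi_shape d.-1 x / chi_q d x * x ^+ 2).
Proof.
move=> d1 C0 dq cq x0; set la := C / 2 * _ / _.
have dgt0 : (0 < d)%N by exact: ltnW.
set B := _ * expR _.
have la0 : 0 <= la.
  by rewrite divr_ge0 ?(ltW (chi_q_gt0 _ _))// mulr_ge0 ?divr_ge0 ?(ltW C0)// chi_shape_ge0// ltW.
have bound u : 0 < u -> u <= 1 -> 1 - C * u <= B.
  move=> u0 u1; apply: (le_trans (chi_q_near0 dgt0 C0 dq (cq u) u0 u1)).
  apply: (le_trans (chi_q_domination2 d1 C0 dq x0 u0)); rewrite -/la /B ler_wpM2l//.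
    exact/ltW/chi_q_gt0.
  rewrite ler_expR; have : 0 <= la * u ^+ 2 by rewrite mulr_ge0// sqr_ge0.
  by lra.
rewrite leNgt; apply/negP => B1.
pose u := Num.min 1 ((1 - B) / (2 * C)).
have g0 : 0 < (1 - B) / (2 * C) by rewrite divr_gt0 ?mulr_gt0// subr_gt0.
have u0 : 0 < u by rewrite lt_min ltr01.
have u1 : u <= 1 by rewrite ge_min lexx.
have : u <= (1 - B) / (2 * C) by rewrite ge_min lexx orbT.
rewrite ler_pdivlMr ?mulr_gt0// => h.
by have := bound u u0 u1; lra.
Qed.

End hazard.

(** * Cubic moments of exponentially small tails *)

Section exponential_moment.
Context {R : realType}.
Local Notation mu := (@lebesgue_measure R).
Implicit Types (r x y u v w t s la A : R).

Lemma sqr_le_expR s : 0 <= s -> s ^+ 2 <= 2 * expR s.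
Proof.
move=> s0; have := @expR_ge1Dxn R s 1 s0; rewrite (_ : 2`!%:R = 2 :> R)// => h.
by lra.
Qed.

Lemma cvg_exponential_moment la : 0 < la ->
  - ((3 / la) * s ^+ 2 + (6 / la ^+ 2) * s + 6 / la ^+ 3) * expR (- (la * s)) @[s --> +oo] --> (0 : R).
Proof.
move=> la0.
have lan0 : la != 0 by rewrite gt_eqF.
(* with [w = la * s / 2] the polynomial is [(12 * w ^+ 2 + 12 * w + 6) / la ^+ 3], and
   [w ^+ 2 <= 2 * expR w], [w <= expR w], [1 <= expR w] add up to [24 + 12 + 6 = 42] *)
pose K := 42 / la ^+ 3.
have K0 : 0 <= K by rewrite divr_ge0// exprn_ge0// ltW.
have ub : \forall s \near +oo, 0 <= ((3 / la) * s ^+ 2 + (6 / la ^+ 2) * s + 6 / la ^+ 3) * expR (- (la * s))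
    <= K * expR (- (la * s / 2)).
  near=> s.
  have s0 : 0 <= s by near: s; exact: nbhs_pinfty_ge.
  pose w := la * s / 2.
  have w0 : 0 <= w by rewrite !mulr_ge0// ltW.
  have sE : s = 2 * w / la by rewrite /w; field.
  have e1 : 1 <= expR w by rewrite -[leLHS]expR0 ler_expR.
  have e2 := sqr_le_expR w0.
  have e3 : 1 + w <= expR w := expR_ge1Dx w.
  have P : (3 / la) * s ^+ 2 + (6 / la ^+ 2) * s + 6 / la ^+ 3 = (12 * w ^+ 2 + 12 * w + 6) / la ^+ 3.
    by rewrite sE; field.
  have P0 : 0 <= 12 * w ^+ 2 + 12 * w + 6 by have := sqr_ge0 w; lra.
  have i0 : 0 <= (la ^+ 3)^-1 by rewrite invr_ge0 exprn_ge0// ltW.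
  rewrite P; apply/andP; split; first by rewrite mulr_ge0 ?expR_ge0// mulr_ge0.
  rewrite (_ : - (la * s) = - w + - w); last by rewrite /w; field.
  rewrite (_ : - (la * s / 2) = - w)// expRD mulrA ler_pM2r ?expR_gt0//.
  rewrite /K mulrAC ler_wpM2r// expRN ler_pdivrMr ?expR_gt0//.
  by lra.
rewrite -oppr0; under eq_fun do rewrite mulNr.
apply: cvgN.
apply: (squeeze_cvgr ub).
- exact: cvg_cst.
- rewrite -[X in _ --> X](mulr0 K); apply: cvgM; first exact: cvg_cst.
  apply: (cvg_comp (fun s : R => la * s / 2) (fun y => expR (- y))); last exact: cvgr_expR.
  have -> : (fun s => la * s / 2) = (fun s => s * (la / 2)) by apply/funext => s; field.
  by apply: gt0_cvgMly; [rewrite divr_gt0|exact: cvg_id].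
Unshelve. all: by end_near. Qed.

(** The polynomial in the primitive comes from two integrations by parts; at [v = t]
    only its constant term is left. *)
Lemma exponential_moment la t : 0 < la ->
  (\int[mu]_(v in `[t, +oo[) (3 * (v - t) ^+ 2 * expR (- (la * (v - t))))%:E = (6 / la ^+ 3)%:E)%E.
Proof.
move=> la0; have lan0 : la != 0 by rewrite gt_eqF.
pose G s := - ((3 / la) * s ^+ 2 + (6 / la ^+ 2) * s + 6 / la ^+ 3) * expR (- (la * s)).
pose g s := 3 * s ^+ 2 * expR (- (la * s)).
have dG s : is_derive s 1 G (g s).
  have dE : is_derive s 1 (fun y : R => expR (- (la * y))) (- la * expR (- (la * s))).
    by apply: is_derive_eq; rewrite /GRing.scale/=; ring.
  have dP : is_derive s 1 (fun y : R => (3 / la) * y ^+ 2 + (6 / la ^+ 2) * y + 6 / la ^+ 3) ((6 / la) * s + 6 / la ^+ 2).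
    by apply: is_derive_eq; rewrite /GRing.scale/=; field.
  have -> : G = (fun y => - ((fun y : R => (3 / la) * y ^+ 2 + (6 / la ^+ 2) * y + 6 / la ^+ 3) y) * (fun y : R => expR (- (la * y))) y) by [].
  by apply: is_derive_eq; rewrite /GRing.scale/= /g; field.
have dsh v : is_derive v 1 (fun y : R => y - t) (1 : R) by apply: is_derive_eq; rewrite subr0.
have cg v : {for v, continuous (fun y => g (y - t))}.
  rewrite /g; apply: cvgM.
    apply: cvgM; first exact: cvg_cst.
    apply: (@continuous_comp _ _ _ (fun y => y - t) (fun y => y ^+ 2)); last exact: exprn_continuous.
    exact: is_derive_continuous (dsh v).
  apply: (@continuous_comp _ _ _ (fun y => - (la * (y - t))) expR); last exact: continuous_expR.
  apply: cvgN; apply: cvgM; first exact: cvg_cst.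
  exact: is_derive_continuous (dsh v).
transitivity (0 - G (t - t))%:E; last first.
  by rewrite subrr /G expr0n/= !mulr0 !add0r oppr0 expR0 mulr1 opprK.
apply: (@FTC_tail R (fun v => G (v - t)) (fun v => g (v - t)) t 0).
- move=> v _; have := @is_derive1_comp R G (fun y : R => y - t) v _ _ (dG _) (dsh v).
  by rewrite mulr1.
- by move=> v _; exact: cg.
- by move=> v tv; rewrite /g mulr_ge0 ?expR_ge0// mulr_ge0// sqr_ge0.
- apply: (cvg_comp (fun v : R => v - t) G); last exact: cvg_exponential_moment.
  exact: cvg_addrr.
Qed.

Lemma pos_part3_integral w t : (\int[mu]_(v in `]t, +oo[) (3 * (v - t) ^+ 2 * (v <= w)%R%:R)%:E = (pos_part (w - t) ^+ 3)%:E)%E.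
Proof.
have [wt|tw] := leP w t.
  rewrite /pos_part max_r ?subr_le0// expr0n/=.
  apply: integral0_eq => v /=; rewrite in_itv/= andbT => tv.
  by rewrite leNgt (le_lt_trans wt tv)/= mulr0.
rewrite /pos_part max_l; last by rewrite subr_ge0 ltW.
have dsh v : is_derive v 1 (fun y : R => y - t) (1 : R) by apply: is_derive_eq; rewrite subr0.
have cub : continuous (fun v => 3 * (v - t) ^+ 2).
  move=> v; apply: cvgM; first exact: cvg_cst.
  apply: (@continuous_comp _ _ _ (fun y => y - t) (fun y => y ^+ 2)); last exact: exprn_continuous.
  exact: is_derive_continuous (dsh v).
have : (\int[mu]_(v in `[t, w]) (3 * (v - t) ^+ 2)%:E = ((w - t) ^+ 3 - (t - t) ^+ 3)%:E)%E.
  apply: (@FTC_segment R (fun v => (v - t) ^+ 3) (fun v => 3 * (v - t) ^+ 2) t w (ltW tw)).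
    by move=> v _; have d1 := dsh v; apply: is_derive_eq; rewrite /GRing.scale/=; ring.
  by move=> v _; exact: cub.
rewrite subrr expr0n/= subr0 => <-.
rewrite -integral_itv_obnd_cbnd; last first.
  by apply/measurable_EFinP; apply: measurable_funTS; exact: continuous_measurable_fun.
rewrite [LHS]integral_mkcond [RHS]integral_mkcond; apply: eq_integral => v _.
rewrite !patchE !mem_setE !in_itv/= andbT.
by case: (t < v) => //=; case: (v <= w); rewrite ?mulr1 ?mulr0.
Qed.

(** Write the cube of the positive part as an integral of [3 * (v - t) ^+ 2] over the
    levels [v] below [g u], exchange the integrals, and insert the exponential bound
    of the tail at each level. *)
Lemma moment_of_exponential_tail (P : probability R R) (g : R -> R) A la v0 t :
  measurable_fun setT g -> 0 < la -> 0 <= A ->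
  (forall v, t < v -> (P [set u | (v <= g u)%R] <= (A * expR (- (la * (v - v0))))%:E)%E) ->
  (\int[P]_u (pos_part (g u - t) ^+ 3)%:E <= (A * expR (la * (v0 - t)) * (6 / la ^+ 3))%:E)%E.
Proof.
move=> mg la0 A0 tail.
pose K (p : R * measurableTypeR R) : \bar R :=
  if (t < p.2)%R then (3 * ((p.2 : R) - t) ^+ 2 * (((p.2 : R) <= g p.1)%R)%:R)%:E else 0%E.
have K0 p : (0 <= K p)%E by rewrite /K; case: ifP => // _; rewrite lee_fin mulr_ge0// mulr_ge0// sqr_ge0.
have m2 : measurable_fun [set: R * measurableTypeR R] (snd : R * measurableTypeR R -> R) by exact: measurable_snd.
have mg1 : measurable_fun [set: R * measurableTypeR R] (fun p => g p.1) by apply: measurableT_comp => //; exact: measurable_fst.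
have mK : measurable_fun setT K.
  apply: measurable_fun_ifT => //; first exact: measurable_fun_ltr.
  apply/measurable_EFinP; apply: measurable_funM.
    by apply: measurable_funM => //; apply: measurable_funX; exact: measurable_funB.
  have -> : (fun p : R * measurableTypeR R => ((p.2 : R) <= g p.1)%R%:R) = (fun p => if (p.2 : R) <= g p.1 then 1 else 0 : R).
    by apply/funext => p; case: ifP.
  by apply: measurable_fun_ifT => //; exact: measurable_fun_ler.
have -> : (\int[P]_u (pos_part (g u - t) ^+ 3)%:E = \int[P]_u \int[mu]_v K (u, v))%E.
  apply: eq_integral => u _; rewrite -pos_part3_integral integral_mkcond; apply: eq_integral => v _.
  by rewrite patchE mem_setE in_itv/= andbT.
rewrite (@fubini_tonelli _ _ R (measurableTypeR R) R P mu K mK K0).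
have -> : ((A * expR (la * (v0 - t)) * (6 / la ^+ 3))%:E =
   \int[mu]_(v in `]t, +oo[) ((A * expR (la * (v0 - t)))%:E * (3 * (v - t) ^+ 2 * expR (- (la * (v - t))))%:E))%E.
  have mm : measurable_fun [set: R] (fun v : R => (3 * (v - t) ^+ 2 * expR (- (la * (v - t))))%:E).
    apply/measurable_EFinP; apply: measurable_funM.
      by apply: measurable_funM => //; apply: measurable_funX; exact: measurable_funB.
    apply: measurableT_comp => //; apply: measurable_funN => //; apply: measurable_funM => //; exact: measurable_funB.
  rewrite ge0_integralZl//; last 3 first.
  - exact: measurable_funTS.
  - by move=> v _; rewrite lee_fin mulr_ge0 ?expR_ge0// mulr_ge0// sqr_ge0.
  - by rewrite lee_fin mulr_ge0 ?expR_ge0.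
  rewrite integral_itv_obnd_cbnd; last exact: measurable_funTS.
  by rewrite exponential_moment// -EFinM.
rewrite [leRHS]integral_mkcond; apply: ge0_le_integral => //.
- by move=> v _; exact: integral_ge0.
- exact: (@measurable_fun_fubini_tonelli_G _ _ R (measurableTypeR R) R P K mK K0).
- apply/(measurable_restrictT _ _).1 => //; apply: measurable_funTS; apply: emeasurable_funM => //.
  apply/measurable_EFinP; apply: measurable_funM.
      by apply: measurable_funM => //; apply: measurable_funX; exact: measurable_funB.
    apply: measurableT_comp => //; apply: measurable_funN => //; apply: measurable_funM => //; exact: measurable_funB.
move=> v _; rewrite patchE mem_setE in_itv/= andbT /K/=; case: ifPn => tv; last by rewrite integral0_eq.
have mset : measurable [set u : R | (v <= g u)%R] by exact: measurable_superlevel.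
have -> : (\int[P]_u (3 * (v - t) ^+ 2 * (v <= g u)%R%:R)%:E = (3 * (v - t) ^+ 2)%R%:E * P [set u | (v <= g u)%R])%E.
  rewrite -[X in (_ * P X)%E]setIT -integral_indic//.
  have mi : measurable_fun [set: R] (fun u : R => (\1_([set u : R | (v <= g u)%R]) u)%:E : \bar R).
    by apply/measurable_EFinP; exact: measurable_indic.
  have c0 : (0 <= (3 * (v - t) ^+ 2)%R%:E)%E by rewrite lee_fin mulr_ge0// sqr_ge0.
  rewrite -ge0_integralZl//.
  apply: eq_integral => u _; rewrite -EFinM indicE; congr (_ * (nat_of_bool _)%:R)%:E.
  by apply/idP/idP; rewrite ?inE.
apply: (@le_trans _ _ ((3 * (v - t) ^+ 2)%:E * (A * expR (- (la * (v - v0))))%:E)%E).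
  by rewrite lee_wpmul2l ?tail// lee_fin mulr_ge0// sqr_ge0.
rewrite -!EFinM lee_fin.
have -> : - (la * (v - v0)) = la * (v0 - t) + - (la * (v - t)) by ring.
by rewrite expRD le_eqVlt; apply/orP; left; apply/eqP; ring.
Qed.

End exponential_moment.

(** * The hazard rate of the half-normal law *)

Section chi_one_dimensional.
Context {R : realType}.
Implicit Types (x y s : R).

Lemma expR_taylor2_mono x y : x <= y -> expR x - (1 + x + x ^+ 2 / 2) <= expR y - (1 + y + y ^+ 2 / 2).
Proof.
move=> xy.
have dd s : is_derive s 1 (fun s : R => expR s - (1 + s + s ^+ 2 / 2)) (expR s - (1 + s)).
  by apply: is_derive_eq; rewrite !scaler0 !add0r /GRing.scale/=; field.
apply: (@derive_ge0_homo R _ (fun s => expR s - (1 + s)) x y xy (fun s _ => dd s)).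
by move=> s _; rewrite subr_ge0; exact: expR_ge1Dx.
Qed.

Lemma expR_taylor2_ge x : 0 <= x -> 1 + x + x ^+ 2 / 2 <= expR x.
Proof. by move=> /expR_taylor2_mono; rewrite expR0 expr0n/= mul0r !addr0 subrr subr_ge0. Qed.

Lemma expR_taylor2_le x : x <= 0 -> expR x <= 1 + x + x ^+ 2 / 2.
Proof. by move=> /expR_taylor2_mono; rewrite expR0 expr0n/= mul0r !addr0 subrr subr_le0. Qed.

Variable C : R.
Hypothesis C0 : 0 < C.
Hypothesis dq : forall x, 0 < x -> is_derive x 1 (chi_q 1) (- (C * chi_shape 1 x)).
Hypothesis cq : forall b : R, {within `[0, b], continuous (chi_q 1)}.

Let p x := C * chi_shape 1 x.

Let pE x : p x = C * expR (- (x ^+ 2 / 2)).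
Proof. by rewrite /p /chi_shape expr0 mul1r. Qed.

Let p0 x : 0 < p x.
Proof. by rewrite pE mulr_gt0// expR_gt0. Qed.

Let dp x : is_derive x 1 p (- x * p x).
Proof.
have d1 := is_derive_chi_shape 1 x.
by rewrite /p; apply: is_derive_eq; rewrite /GRing.scale/= mul0r mul0r; ring.
Qed.

(** Differentiating the difference of the two sides leaves a negative multiple of the
    density, and the difference tends to zero. This rational bound is a convergent of
    the continued fraction of the Mills ratio; the simpler bound [p y / y] would give
    the conclusion of [chi1_hazard_large] only for [3 <= y ^+ 2]. *)
Lemma mills_upper y : 0 < y -> chi_q 1 y <= p y * ((y ^+ 2 + 2) / (y * (y ^+ 2 + 3))).
Proof.
move=> y0; rewrite -subr_ge0.
have pos s : y <= s -> [/\ 0 < s, 0 < s ^+ 2 & s * (s ^+ 2 + 3) != 0].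
  move=> ys; have s0 : 0 < s by lra.
  have s2 : 0 < s ^+ 2 by rewrite exprn_gt0.
  by split => //; rewrite mulf_neq0// gt_eqF//; lra.
apply: (@ge0_of_decreasing R (fun s => p s * ((s ^+ 2 + 2) / (s * (s ^+ 2 + 3))) - chi_q 1 s)
  (fun s => - (6 / (s ^+ 2 * (s ^+ 2 + 3) ^+ 2)) * p s)).
- move=> s ys; have [s0 s2 den] := pos s ys.
  have d1 := dp s; have d2 := dq s0.
  have d3 : is_derive s 1 (fun v : R => v * (v ^+ 2 + 3)) (3 * s ^+ 2 + 3).
    by apply: is_derive_eq; rewrite /GRing.scale/=; ring.
  have d4 := @is_deriveV R (fun v : R => v * (v ^+ 2 + 3)) s _ _ den d3.
  apply: is_derive_eq; rewrite /GRing.scale/= -/(p s); field.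
  by rewrite gt_eqF ?gt_eqF//; lra.
- move=> s ys; have [s0 s2 den] := pos s ys.
  rewrite mulNr oppr_le0 mulr_ge0 ?(ltW (p0 s))// divr_ge0// mulr_ge0 ?(ltW s2)//.
  by rewrite exprn_ge0//; lra.
- move=> e e0; have [Y Y0 HY] := @chi_q_small R 1 _ e0.
  exists (y + Y); first by lra.
  have h1 : chi_q 1 (y + Y) <= e by apply: HY; lra.
  have yY : y <= y + Y by lra.
  have [s0 s2 _] := pos _ yY.
  have : 0 <= p (y + Y) * (((y + Y) ^+ 2 + 2) / ((y + Y) * ((y + Y) ^+ 2 + 3))).
    by rewrite mulr_ge0 ?(ltW (p0 _))// divr_ge0 ?mulr_ge0 ?(ltW s0)//; lra.
  by lra.
Qed.

(** Differentiating the difference of the two sides leaves a negative multiple of the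
    density, and the difference tends to zero. *)
Lemma mills_lower y : 0 < y -> p y * (y / (1 + y ^+ 2)) <= chi_q 1 y.
Proof.
move=> y0; rewrite -subr_ge0.
apply: (@ge0_of_decreasing R (fun s => chi_q 1 s - p s * (s / (1 + s ^+ 2)))
  (fun s => - (2 / (1 + s ^+ 2) ^+ 2) * p s)).
- move=> s ys; have s0 : 0 < s by lra.
  have s2 : 1 + s ^+ 2 != 0 by rewrite gt_eqF// ltr_pwDl// sqr_ge0.
  have d1 := dp s; have d2 := dq s0.
  have d3 : is_derive s 1 (fun v : R => 1 + v ^+ 2) (2 * s).
    by apply: is_derive_eq; rewrite /GRing.scale/=; ring.
  have d4 := @is_deriveV R (fun v : R => 1 + v ^+ 2) s _ _ s2 d3.
  by apply: is_derive_eq; rewrite /GRing.scale/= -/(p s); field.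
- move=> s ys; rewrite mulNr oppr_le0 mulr_ge0 ?(ltW (p0 s))// divr_ge0// exprn_ge0//.
  by rewrite addr_ge0// sqr_ge0.
- move=> e e0.
  have [Y Y1 Ye] : exists2 Y : R, y + 1 <= Y & 4 * C / e <= Y.
    exists (y + 1 + 4 * C / e); first by rewrite lerDl divr_ge0 ?mulr_ge0// ltW.
    by rewrite lerDr; lra.
  have Yp : 0 < Y by lra.
  exists Y; first by lra.
  have q0 := chi_q_gt0 Y (isT : (0 < 1)%N).
  suff : p Y * (Y / (1 + Y ^+ 2)) <= e by lra.
  have pC : p Y <= C by rewrite pE ler_piMr ?(ltW C0)// -[leRHS]expR0 ler_expR; have := sqr_ge0 Y; lra.
  have Y2 : 0 < 1 + Y ^+ 2 by rewrite ltr_pwDl// sqr_ge0.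
  apply: (@le_trans _ _ (C * (Y / (1 + Y ^+ 2)))).
    by rewrite ler_wpM2r// divr_ge0 ?(ltW Yp) ?(ltW Y2).
  rewrite mulrA ler_pdivrMr//.
  move: Ye; rewrite ler_pdivrMr// => Ye.
  have : C * Y <= Y * e * Y by rewrite ler_pM2r//; apply: le_trans Ye; rewrite ler_peMl ?(ltW C0)//; lra.
  by rewrite expr2; lra.
Qed.

(** A rational lower bound for the normalising constant [C], which is the square root
    of [2 / pi]. The total mass is one; below [3 / 2] the density is bounded by the
    Taylor polynomial [1 - v + v ^+ 2 / 2] of [expR (- v)] at [v = s ^+ 2 / 2], and
    the mass above [3 / 2] is at most [p (3 / 2) / (3 / 2)]. *)
Lemma normalization_bound : 1 <= C * (337 / 250).
Proof.
(* the integral of the Taylor polynomial in [s ^+ 2 / 2], so that [G] is nondecreasing *)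
pose G s := chi_q 1 s + C * (s - s ^+ 3 / 6 + s ^+ 5 / 40).
have a0 : (0 : R) < 3 / 2 by lra.
have dG s : 0 < s -> is_derive s 1 G (C * (1 - s ^+ 2 / 2 + s ^+ 4 / 8) - p s).
  move=> s0; have d2 := dq s0.
  by rewrite /G; apply: is_derive_eq; rewrite !scaler0 !add0r /GRing.scale/= -/(p s); field.
have dG0 s : 0 <= C * (1 - s ^+ 2 / 2 + s ^+ 4 / 8) - p s.
  rewrite pE -mulrBr mulr_ge0 ?(ltW C0)// subr_ge0.
  have s2 := sqr_ge0 s.
  have := @expR_taylor2_le (- (s ^+ 2 / 2)) ltac:(lra).
  have -> : (- (s ^+ 2 / 2)) ^+ 2 = s ^+ 4 / 4 by field.
  by lra.
have aux s : s \in `]0, 3 / 2[ -> 0 < s by rewrite in_itv/= => /andP[].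
have cG : {within `[0, 3 / 2], continuous G}.
  have cP : continuous (fun s : R => C * (s - s ^+ 3 / 6 + s ^+ 5 / 40)).
    move=> z; apply: (@is_derive_continuous R _ z (C * (1 - z ^+ 2 / 2 + z ^+ 4 / 8))).
    by apply: is_derive_eq; rewrite !scaler0 !add0r /GRing.scale/=; field.
  move=> x; apply: cvgD; first exact: cq.
  exact: (continuous_subspaceT cP).
have [c _ E] := MVT a0 (fun s si => dG s (aux s si)) cG.
have GG : G 0 <= G (3 / 2) by rewrite -subr_ge0 E mulr_ge0// subr_ge0 ltW.
move: GG; rewrite {1}/G (chi_q0 1 (lexx 0)) !expr0n/= !mul0r subrr add0r mulr0 addr0 /G.
have h := chi_hazard1 C0 dq a0.
(* [expR (9 / 8) >= 3.03], from the fourth power of a Taylor bound at [9 / 32] *)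
have e98 : p (3 / 2) <= C / (303 / 100).
  have c303 : (0 : R) < 303 / 100 by lra.
  rewrite pE ler_pM2l// expRN lef_pV2 ?posrE ?expR_gt0//.
  have -> : (3 / 2) ^+ 2 / 2 = 4%:R * (9 / 32) :> R by field.
  rewrite expRM_natl.
  have h2 : 132 / 100 <= expR (9 / 32 : R).
    by apply: le_trans (@expR_taylor2_ge (9 / 32) _); lra.
  apply: (@le_trans _ _ ((132 / 100) ^+ 4)); last by rewrite lerXn2r ?nnegrE ?expR_ge0//; lra.
  by rewrite !exprS expr0; lra.
move: h; rewrite -/(p _) => h.
have -> : (3 / 2 - (3 / 2) ^+ 3 / 6 + (3 / 2) ^+ 5 / 40 : R) = 3 / 2 - 27 / 48 + 243 / 1280 by field.
by have := C0; lra.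
Qed.

Lemma expR_1775 : 117 / 20 <= expR (71 / 40 : R).
Proof.
have -> : (71 / 40 = 16%:R * (71 / 640) :> R) by field.
rewrite expRM_natl.
have h2 : 1117 / 1000 <= expR (71 / 640 : R).
  by apply: le_trans (@expR_taylor2_ge (71 / 640) _); lra.
have sq a b x : 0 <= a -> a <= x -> b <= a ^+ 2 -> b <= x ^+ 2.
  by move=> aa ax ba; apply: (le_trans ba); rewrite lerXn2r ?nnegrE//; exact: le_trans ax.
have -> z : z ^+ 16 = z ^+ 2 ^+ 2 ^+ 2 ^+ 2 :> R by rewrite -!exprM.
(* rational lower bounds for successive square roots of [117 / 20] *)
apply: (@sq (121 / 50)); [lra| |rewrite expr2; lra].
apply: (@sq (389 / 250)); [lra| |rewrite expr2; lra].
apply: (@sq (499 / 400)); [lra| |rewrite expr2; lra].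
by apply: (@sq (1117 / 1000)); [lra| |rewrite expr2; lra].
Qed.

(** By [mills_upper] it is enough that [3 * (y ^+ 2 + 2) <= y ^+ 2 * (y ^+ 2 + 3)],
    which is the hypothesis on the fourth power of [y]. *)
Lemma chi1_hazard_large y : 0 < y -> 6 <= y ^+ 2 * y ^+ 2 -> 3 * chi_q 1 y <= y * p y.
Proof.
move=> y0 y46; have := mills_upper y0.
have y2 : 0 < y ^+ 2 by rewrite exprn_gt0.
have y23 : 0 < y ^+ 2 + 3 by lra.
have den : 0 < y * (y ^+ 2 + 3) by rewrite mulr_gt0.
rewrite mulrA ler_pdivlMr// => hm.
rewrite -(ler_pM2r den).
have h3 : 0 <= p y * (y ^+ 2 * y ^+ 2 - 6) by rewrite mulr_ge0 ?(ltW (p0 y))// subr_ge0.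
have -> : y * p y * (y * (y ^+ 2 + 3)) = p y * (y ^+ 2 * y ^+ 2) + 3 * (p y * y ^+ 2) by ring.
rewrite -mulrA; move: h3 hm.
set a := _ * (_ * (_ + 3)); set b := p y * (_ * _); set b' := p y * y ^+ 2.
have -> : p y * (y ^+ 2 * y ^+ 2 - 6) = b - 6 * p y by rewrite /b; ring.
have -> : p y * (y ^+ 2 + 2) = b' + 2 * p y by rewrite /b'; ring.
by lra.
Qed.

(** For [y <= 1] the hazard rate times [y] is at most [1 + y ^+ 2 <= 2] by
    [mills_lower], and the tangent of [ln (chi_q 1)] at [y] is nonnegative at the
    origin, so the tail at [y] is at least [expR (- 2)]; and [expR 1] exceeds [9 / 4]. *)
Lemma chi1_tail_small y : 0 < y -> y <= 1 -> 9 / 4 < chi_q 1 y * expR 3.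
Proof.
move=> y0 y1'; have q0 : 0 < chi_q 1 y by exact: chi_q_gt0.
have := mills_lower y0.
have y2 : 0 < 1 + y ^+ 2 by rewrite ltr_pwDl// sqr_ge0.
rewrite mulrA ler_pdivrMr// => hm.
have la : p y / chi_q 1 y * y <= 2.
  rewrite mulrAC ler_pdivrMr//; apply: (le_trans hm).
  rewrite mulrC ler_pM2r//.
  have : y ^+ 2 <= 1 by rewrite exprn_ile1// ltW.
  by lra.
have dom u : 0 < u -> u <= 1 -> 1 - C * u <= chi_q 1 y * expR 2.
  move=> u0 u1; apply: (le_trans (chi_q_near0 (isT : (0 < 1)%N) C0 dq (@cq u) u0 u1)).
  apply: (le_trans (chi_q_domination1 C0 dq y0 u0)); rewrite ler_pM2l// ler_expR -/(p y).
  have : 0 <= p y / chi_q 1 y * u by rewrite mulr_ge0 ?(ltW u0)// divr_ge0 ?(ltW (p0 y)) ?(ltW q0).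
  by rewrite mulrBr opprB; lra.
have B : 1 <= chi_q 1 y * expR 2.
  rewrite leNgt; apply/negP => B1.
  pose u := Num.min 1 ((1 - chi_q 1 y * expR 2) / (2 * C)).
  have g0 : 0 < (1 - chi_q 1 y * expR 2) / (2 * C) by rewrite divr_gt0 ?mulr_gt0// subr_gt0.
  have u0 : 0 < u by rewrite lt_min ltr01.
  have u1 : u <= 1 by rewrite ge_min lexx.
  have : u <= (1 - chi_q 1 y * expR 2) / (2 * C) by rewrite ge_min lexx orbT.
  rewrite ler_pdivlMr ?mulr_gt0// => hu.
  by have := dom u u0 u1; lra.
have e1 : 5 / 2 <= expR (1 : R) by apply: le_trans (@expR_taylor2_ge 1 ler01); rewrite expr1n; lra.
have e32 : expR (3 : R) = expR 2 * expR 1 by rewrite -expRD; congr expR; lra.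
have : chi_q 1 y * expR 2 * (5 / 2) <= chi_q 1 y * expR 2 * expR 1.
  by rewrite ler_wpM2l// mulr_ge0 ?expR_ge0// ltW.
by rewrite e32 mulrA; lra.
Qed.

(** The function [y * expR (- y ^+ 2 / 2)] decreases beyond its maximum at one. *)
Lemma mid_exp_bound y y1 : 1 <= y -> y <= y1 ->
  y1 * expR (- (y1 ^+ 2 / 2)) <= y * expR (- (y ^+ 2 / 2)).
Proof.
move=> y1' yy1; have y0 : 0 < y by lra.
have -> : - (y ^+ 2 / 2) = (y1 ^+ 2 - y ^+ 2) / 2 + - (y1 ^+ 2 / 2) by field.
rewrite expRD mulrA ler_pM2r ?expR_gt0//.
apply: (@le_trans _ _ (y * (1 + (y1 - y)))).
  have : 0 <= (y - 1) * (y1 - y) by rewrite mulr_ge0// subr_ge0.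
  by lra.
rewrite ler_pM2l//; apply: (le_trans (expR_ge1Dx _)); rewrite ler_expR.
have : 0 <= (y1 - y) * ((y1 + y) / 2 - 1) by rewrite mulr_ge0// subr_ge0//; lra.
by lra.
Qed.

(** The right-hand side decreases in [y] on this interval, and at the right end point
    the numerical bounds above give a value less than one percent above [27 / 4]. *)
Lemma chi1_mid y : 1 <= y -> y <= 36 / 23 -> 27 / 4 < y * p y * expR 3.
Proof.
move=> y1' yy1.
have Cb := normalization_bound.
have e1 := mid_exp_bound y1' yy1.
(* [71 / 40] is just below [3 - (36 / 23) ^+ 2 / 2] *)
have e2 : expR (71 / 40 : R) <= expR 3 * expR (- ((36 / 23) ^+ 2 / 2)).
  by rewrite -expRD ler_expR expr2; lra.
have e3 := expR_1775.
rewrite pE.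
have -> : y * (C * expR (- (y ^+ 2 / 2))) * expR 3 = (y * expR (- (y ^+ 2 / 2))) * (C * expR 3) by ring.
have f3 : (36 / 23 * expR (- ((36 / 23) ^+ 2 / 2))) * (C * expR 3) <= (y * expR (- (y ^+ 2 / 2))) * (C * expR 3).
  by rewrite ler_pM2r// mulr_gt0// expR_gt0.
apply: lt_le_trans f3.
have -> : (36 / 23 * expR (- ((36 / 23) ^+ 2 / 2))) * (C * expR 3) = 36 / 23 * C * (expR 3 * expR (- ((36 / 23) ^+ 2 / 2))) by ring.
have c0 : 0 < 36 / 23 * C by rewrite mulr_gt0//; lra.
apply: (@lt_le_trans _ _ (36 / 23 * C * (117 / 20))); first by lra.
by rewrite ler_pM2l//; lra.
Qed.

(** Three ranges. Beyond the fourth root of six the conclusion holds for every tail;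
    below one the tail is too large for the hypothesis; in between, a failure of the
    conclusion would bound [y * p y] from above by [27 / (4 * expR 3)]. *)
Lemma chi1_hazard_ge3 y : 0 < y -> chi_q 1 y <= 9 / (4 * expR 3) -> 3 * chi_q 1 y <= y * p y.
Proof.
move=> y0 qy; rewrite leNgt; apply/negP => h.
have e30 : 0 < expR (3 : R) by exact: expR_gt0.
have qe : chi_q 1 y * expR 3 <= 9 / 4.
  have -> : 9 / 4 = 9 / (4 * expR 3) * expR 3 :> R by field; rewrite gt_eqF.
  by rewrite ler_pM2r.
(* [36 / 23] is just above the fourth root of six *)
have [y1y|yy1] := leP (36 / 23) y.
  have c0 : (0 : R) <= 36 / 23 by lra.
  have y2 : (36 / 23) ^+ 2 <= y ^+ 2 by rewrite lerXn2r ?nnegrE ?(ltW y0).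
  have : 6 <= y ^+ 2 * y ^+ 2.
    apply: (@le_trans _ _ ((36 / 23) ^+ 2 * (36 / 23) ^+ 2)); first by rewrite expr2; lra.
    by apply: ler_pM => //; exact: sqr_ge0.
  by move=> /(chi1_hazard_large y0); rewrite leNgt h.
have [y1'|y1'] := leP y 1.
  by have := chi1_tail_small y0 y1'; rewrite ltNge qe.
have := chi1_mid (ltW y1') (ltW yy1).
have : y * p y * expR 3 < 3 * chi_q 1 y * expR 3 by rewrite ltr_pM2r.
by lra.
Qed.

End chi_one_dimensional.

(** * Majorants of the indicator of a half-line *)

Section majorant.
Context {R : realType}.

Lemma sqnorm_line m (s a : 'rV[R]_m) (z : R) :
  sqnorm (s + z *: a) = sqnorm s + sqnorm a * z ^+ 2 + 2 * (\sum_i s 0 i * a 0 i) * z.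
Proof.
rewrite /sqnorm !mulr_sumr !mulr_suml -!big_split/=; apply: eq_bigr => i _.
by rewrite !mxE; ring.
Qed.

Lemma sqnorm_ge0 m (s : 'rV[R]_m) : 0 <= sqnorm s.
Proof. by apply: sumr_ge0 => i _; exact: sqr_ge0. Qed.

Lemma sqnorm_gt0 m (s : 'rV[R]_m) : s != 0 -> 0 < sqnorm s.
Proof.
move=> s0; rewrite lt_def sqnorm_ge0 andbT; apply: contra s0.
rewrite psumr_eq0; last by move=> i _; exact: sqr_ge0.
move=> /allP h; apply/eqP/rowP => i; rewrite mxE; apply/eqP; rewrite -sqrf_eq0.
by apply: h; rewrite mem_index_enum.
Qed.

(** Along a line the squared length is a quadratic polynomial whose leading
    coefficient is nonnegative, so the symmetrised function is a [cube_pair]. *)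
Lemma quadratic_support_sqnorm m (tau : R) :
  quadratic_support (fun v : 'rV[R]_m => pos_part (sqnorm v - tau) ^+ 3).
Proof.
move=> s a.
have [k [z0 H]] := cube_pair_strict_support (sqnorm s - tau) (2 * (\sum_i s 0 i * a 0 i)) (sqnorm_ge0 a).
have E z : pos_part (sqnorm (s + z *: a) - tau) ^+ 3 + pos_part (sqnorm (s - z *: a) - tau) ^+ 3 =
   cube_pair (sqnorm s - tau) (sqnorm a) (2 * (\sum_i s 0 i * a 0 i)) z.
  by rewrite /cube_pair -scaleNr !sqnorm_line sqrrN; congr (pos_part _ ^+ 3 + pos_part _ ^+ 3); ring.
exists k, z0 => z; have := E 1; rewrite scale1r => ->; rewrite E.
apply: le_trans (H z); rewrite lerD2l ler_nat.
by case: (eqVneq a 0) => [_|/sqnorm_gt0 ->] //=.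
Qed.

(** On the line, for [t >= 0], the cube of the positive part of [|v| - t] is the sum
    of the cubes for [v - t] and for [- v - t]; symmetrising gives two pairs without
    quadratic term. For [t < 0] the two cubes would overlap. *)
Lemma quadratic_support_abs m (t : R) : (m <= 1)%N -> 0 <= t ->
  quadratic_support (fun v : 'rV[R]_m => pos_part (Num.sqrt (sqnorm v) - t) ^+ 3).
Proof.
case: m => [_ _ s a|[_ t0|//]].
  exists 0, 0 => z; have e (v : 'rV[R]_0) : v = s by rewrite [v]thinmx0 [s]thinmx0.
  by rewrite [a]thinmx0 eqxx mul0r !addr0 !(e (_ + _)).
move=> s a.
have fE (v : 'rV[R]_1) : pos_part (Num.sqrt (sqnorm v) - t) ^+ 3 =
    pos_part (v 0 0 - t) ^+ 3 + pos_part (- v 0 0 - t) ^+ 3.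
  rewrite /sqnorm big_ord1 sqrtr_sqr /pos_part.
  have [v0|v0] := leP 0 (v 0 0).
    rewrite ger0_norm// (max_r (_ : - v 0 0 - t <= 0)); last by lra.
    by rewrite [0 ^+ 3]expr0n addr0.
  rewrite ltr0_norm// (max_r (_ : v 0 0 - t <= 0)); last by lra.
  by rewrite [0 ^+ 3]expr0n add0r.
have [k1 [z1 H1]] := cube_pair_strict_support (s 0 0 - t) (a 0 0) (lexx 0).
have [k2 [z2 H2]] := cube_pair_strict_support (- s 0 0 - t) (a 0 0) (lexx 0).
have E z : pos_part (Num.sqrt (sqnorm (s + z *: a)) - t) ^+ 3 + pos_part (Num.sqrt (sqnorm (s - z *: a)) - t) ^+ 3 =
   cube_pair (s 0 0 - t) 0 (a 0 0) z + cube_pair (- s 0 0 - t) 0 (a 0 0) z.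
  rewrite !fE /cube_pair !mxE !mul0r !addr0 addrACA; congr (_ + _).
    by congr (pos_part _ ^+ 3 + pos_part _ ^+ 3); ring.
  by rewrite addrC; congr (pos_part _ ^+ 3 + pos_part _ ^+ 3); ring.
have a00 : a != 0 -> a 0 0 != 0.
  apply: contra => /eqP h; apply/eqP/rowP => i; rewrite mxE -h; congr (a _ _); exact: ord1.
exists (k1 + k2), (Num.max z1 z2) => z; have := E 1; rewrite scale1r => ->; rewrite E.
have := H1 z; have := H2 z; rewrite ltxx/= ge_max.
case: (eqVneq a 0) => [_|/a00 ->] /=.
  have n1 (b : bool) : 0 <= b%:R :> R by [].
  have := n1 ((a 0 0 != 0) && (z1 <= z)); have := n1 ((a 0 0 != 0) && (z2 <= z)); lra.
by case: (z1 <= z) => /=; case: (z2 <= z) => /=; lra.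
Qed.

Lemma pos_part_homo (u v : R) : u <= v -> pos_part u ^+ 3 <= pos_part v ^+ 3.
Proof.
move=> uv; rewrite lerXn2r ?nnegrE ?pos_part_ge0// /pos_part ge_max !le_max lexx uv.
by rewrite orbT.
Qed.

Lemma measurable_pos_part3 (g : R -> R) : measurable_fun setT g -> measurable_fun setT (fun u => pos_part (g u) ^+ 3).
Proof. by move=> mg; apply: measurable_funX; exact: measurable_maxr. Qed.

(** For [d >= 2] take [F u] to be the positive cube of [u - tau], and for [d = 1] that
    of [sqrt u - t]. With [la] the hazard rate at [y] in the corresponding variable,
    the moment bound divided by the value of [F] at [y ^+ 2] is [chi_q d y * expR (la
    * w) * 6 / (la * w) ^+ 3], where [w] is the distance from the threshold to [y]. It
    is smallest for [la * w = 3], and then the factor is [6 * expR 3 / 27]. For [d =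
    1] the condition [t >= 0], needed for [quadratic_support_abs], says that [y] times
    the hazard rate is at least three. *)
Lemma exponential_majorant d (y : R) : (0 < d)%N -> 0 < y ->
  (d = 1%N -> chi_q 1 y <= 9 / (4 * expR 3)) ->
  exists F : R -> R,
   [/\ measurable_fun setT F, forall u, 0 <= F u, {homo F : u v / u <= v},
       0 < F (y ^+ 2) &
    (\int[chi_square d]_u (F u)%:E <= (2 * expR 3 / 9 * chi_q d y * F (y ^+ 2))%:E)%E /\
     forall m, (m <= d)%N -> quadratic_support (fun v : 'rV[R]_m => F (sqnorm v))].
Proof.
move=> d0 y0 d1q.
have q0 := chi_q_gt0 y d0.
have [C C0 [_ dq cq]] := @chi_q_derive R d d0.
(* the optimal choice of the threshold, at distance [3 / la] from the point *)
have opt la : 0 < la -> chi_q d y * expR (la * (3 / la)) * (6 / la ^+ 3) = 2 * expR 3 / 9 * chi_q d y * (3 / la) ^+ 3.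
  move=> la0; rewrite (_ : la * (3 / la) = 3); last by field; rewrite gt_eqF.
  by field; rewrite gt_eqF.
have [d1|d1] := ltnP 1 d.
  pose la := C / 2 * chi_shape d.-1 y / chi_q d y.
  have la0 : 0 < la by rewrite !mulr_gt0 ?invr_gt0 ?expR_gt0 ?exprn_gt0.
  pose tau := y ^+ 2 - 3 / la.
  have yt : y ^+ 2 - tau = 3 / la by rewrite /tau; ring.
  have la3 : 0 < 3 / la by rewrite divr_gt0.
  have Fy : pos_part (y ^+ 2 - tau) ^+ 3 = (3 / la) ^+ 3 by rewrite yt /pos_part max_l// ltW.
  exists (fun u => pos_part (u - tau) ^+ 3); split.
  - by apply: measurable_pos_part3; exact: measurable_funB.
  - by move=> u; rewrite exprn_ge0// pos_part_ge0.
  - by move=> u v uv; apply: pos_part_homo; lra.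
  - by rewrite Fy exprn_gt0.
  split; last by move=> m _; exact: quadratic_support_sqnorm.
  rewrite Fy -opt// -yt.
  apply: (@moment_of_exponential_tail R (chi_square d) id (chi_q d y) la (y ^+ 2) tau) => //; first exact: ltW.
  move=> v _; have [v0|v0] := ltP 0 v.
    have sv : 0 < Num.sqrt v by rewrite sqrtr_gt0.
    rewrite (_ : [set u | _] = [set u : R | Num.sqrt v <= Num.sqrt u]); last first.
      apply/seteqP; split => u /=; first by move=> h; exact: ler_wsqrtr.
      rewrite leNgt => /negP h; rewrite leNgt; apply/negP => uv; apply: h.
      by rewrite ltr_sqrt.
    rewrite -/(chi_tail d (Num.sqrt v)) chi_q_fin lee_fin.
    have := chi_q_domination2 d1 C0 dq y0 sv; rewrite sqr_sqrtr; last exact: ltW.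
    by rewrite -/la.
  apply: (@le_trans _ _ 1%E); first by apply: probability_le1; exact: measurable_superlevel.
  rewrite lee_fin; have := chi_q_domination2_origin d1 C0 dq cq y0; rewrite -/la => /le_trans; apply.
  rewrite ler_pM2l// ler_expR.
  have : 0 <= la * (- v) by rewrite mulr_ge0 ?oppr_ge0 ?(ltW la0).
  by lra.
have dE : d = 1%N by apply/eqP; rewrite eqn_leq d1.
subst d.
pose la := C * chi_shape 1 y / chi_q 1 y.
have p0 : 0 < C * chi_shape 1 y by rewrite mulr_gt0// chi_shape_gt0.
have la0 : 0 < la by rewrite divr_gt0.
pose t := y - 3 / la.
have yt : y - t = 3 / la by rewrite /t; ring.
have la3 : 0 < 3 / la by rewrite divr_gt0.
have t0 : 0 <= t.
  rewrite subr_ge0 ler_pdivrMr// /la mulrA ler_pdivlMr//.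
  exact: (chi1_hazard_ge3 C0 dq cq y0 (d1q erefl)).
have Fy : pos_part (Num.sqrt (y ^+ 2) - t) ^+ 3 = (3 / la) ^+ 3.
  by rewrite sqrtr_sqr gtr0_norm// yt /pos_part max_l// ltW.
exists (fun u => pos_part (Num.sqrt u - t) ^+ 3); split.
- by apply: measurable_pos_part3; apply: measurable_funB => //; exact: measurable_sqrt.
- by move=> u; rewrite exprn_ge0// pos_part_ge0.
- by move=> u v uv; apply: pos_part_homo; rewrite lerD2r; exact: ler_wsqrtr.
- by rewrite Fy exprn_gt0.
split; last by move=> m m1; exact: quadratic_support_abs.
rewrite Fy -opt// -yt.
apply: (@moment_of_exponential_tail R (chi_square 1) Num.sqrt (chi_q 1 y) la y t) => //; [exact: measurable_sqrt|exact: ltW|].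
move=> v tv; have v0 : 0 < v by exact: le_lt_trans tv.
by rewrite -/(chi_tail 1 v) chi_q_fin lee_fin; exact: chi_q_domination1.
Qed.

End majorant.

(** * The statistic as the length of a projection *)

Section projection.
Context {R : realType}.

Lemma sqnormE m (v : 'rV[R]_m) : sqnorm v = (v *m v^T) 0 0.
Proof. by rewrite mxE; apply: eq_bigr => i _; rewrite mxE expr2. Qed.

Lemma sqnorm_eq0 m (v : 'rV[R]_m) : sqnorm v = 0 -> v = 0.
Proof. by move=> h; apply/eqP; apply: contra_eqT h => /sqnorm_gt0; rewrite lt0r => /andP[]. Qed.

Lemma unitmx_of_injective m (A : 'M[R]_m) : (forall v : 'rV[R]_m, v *m A = 0 -> v = 0) -> A \in unitmx.
Proof.
move=> inj; rewrite -row_free_unit -kermx_eq0; apply/eqP/row_matrixP => i.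
by rewrite row0; apply: inj; rewrite -row_mul mulmx_ker row0.
Qed.

(** Orthonormalise the rows one by one; a row that depends on the previous ones
    contributes no new direction, which is why [m] may be smaller than [d] and [C]
    remains injective on row vectors. *)
Lemma gram_schmidt d n (A : 'M[R]_(d, n)) : exists m (C : 'M[R]_(d, m)) (U : 'M[R]_(m, n)),
  [/\ (m <= d)%N, A = C *m U, U *m U^T = 1%:M & forall v : 'rV[R]_m, v *m C^T = 0 -> v = 0].
Proof.
elim: d A => [|d IH] A.
  exists 0%N, 0, 0; split => //; first by rewrite [A]flatmx0 mul0mx.
    by rewrite [LHS]flatmx0 [RHS]flatmx0.
  by move=> v _; rewrite [v]thinmx0.
have [m [C [U [md AE UU inj]]]] := IH (dsubmx (A : 'M[R]_(1 + d, n))).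
pose a : 'rV[R]_n := usubmx (A : 'M[R]_(1 + d, n)).
pose c := a *m U^T.
pose b := a - c *m U.
have bU : b *m U^T = 0 by rewrite mulmxBl -mulmxA UU mulmx1 subrr.
have Ub : U *m b^T = 0 by rewrite -[LHS]trmxK trmx_mul trmxK bU trmx0.
have AE' : A = col_mx a (C *m U) by rewrite -AE -[LHS](vsubmxK (A : 'M[R]_(1 + d, n))).
have [b0|b0] := eqVneq b 0.
  exists m, (col_mx c C), U; split => //; first exact: leqW.
    rewrite AE'; apply: etrans (esym (mul_col_mx c C U)); congr col_mx.
    by apply/eqP; rewrite -subr_eq0; apply/eqP.
  move=> v; rewrite (tr_col_mx c C : (_ : 'M[R]_(m, d.+1)) = _) => h.
  have /eq_row_mx[_] := etrans (esym (mul_mx_row v c^T C^T)) (etrans h (esym (row_mx0 _ 1 1 d))).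
  exact: inj.
pose r := Num.sqrt (sqnorm b).
have r0 : 0 < r by rewrite sqrtr_gt0 sqnorm_gt0.
have rn0 : r != 0 by rewrite gt_eqF.
have bb : b *m b^T = (r ^+ 2)%:M.
  rewrite [LHS]mx11_scalar -sqnormE sqr_sqrtr//; exact: sqnorm_ge0.
exists (1 + m)%N, (block_mx r%:M c 0 C), (col_mx (r^-1 *: b) U); split => //.
- have E := mul_block_col (r%:M : 'M[R]_1) c (0 : 'M[R]_(d, 1)) C (r^-1 *: b) U.
  rewrite AE'; apply: etrans (esym E).
  rewrite mul0mx add0r mul_scalar_mx scalerA divff// scale1r.
  by congr col_mx; rewrite /b subrK.
- rewrite tr_col_mx mul_col_row UU linearZ/= -!scalemxAl -!scalemxAr bU Ub bb !scaler0 scalerA.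
  rewrite [RHS](scalar_mx_block 1 m 1); congr block_mx.
  by rewrite scale_scalar_mx; congr (_%:M); field.
- move=> v; rewrite -[v]hsubmxK => h.
  move: (etrans (esym (etrans (congr1 _ (tr_block_mx r%:M c 0 C)) (mul_row_block _ _ _ _ _ _))) (etrans h (esym (row_mx0 _ 1 1 d)))).
  rewrite trmx0 mulmx0 add0r tr_scalar_mx => /eq_row_mx[h1 /inj h2].
  move: h1; rewrite h2 mul0mx addr0 mul_mx_scalar => /eqP.
  by rewrite scaler_eq0 (negbTE rn0)/= => /eqP ->; rewrite row_mx0.
Qed.

Lemma mulmx_tr_sqnorm d m (v : 'rV[R]_m) (B : 'M[R]_(d, m)) :
  (v *m (B^T *m B) *m v^T) 0 0 = sqnorm (v *m B^T).
Proof. by rewrite sqnormE trmx_mul trmxK !mulmxA. Qed.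

Lemma gram_shift_unit d m (B : 'M[R]_(d, m)) (s : R) :
  (forall v : 'rV[R]_m, v *m B^T = 0 -> v = 0) \/ 0 < s -> 0 <= s -> B^T *m B + s%:M \in unitmx.
Proof.
move=> Bs s0; apply: unitmx_of_injective => v h.
have : (v *m (B^T *m B + s%:M) *m v^T) 0 0 = 0 by rewrite h mul0mx mxE.
rewrite mulmxDr mulmxDl mxE mulmx_tr_sqnorm mul_mx_scalar -scalemxAl mxE -sqnormE.
move=> /eqP; rewrite paddr_eq0 ?mulr_ge0 ?sqnorm_ge0// => /andP[/eqP h1].
case: Bs => [inj _|sp]; first by apply: inj; exact: sqnorm_eq0.
by rewrite mulf_eq0 (gt_eqF sp)/= => /eqP; exact: sqnorm_eq0.
Qed.

(** The push-through identity: [B^T] may be moved across the regularised inverse,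
    which turns the product into [invmx (G + s%:M) *m G] for the Gram matrix [G]. *)
Lemma ridge_projection d m (B : 'M[R]_(d, m)) (s : R) : 0 < s ->
  B^T *m invmx (B *m B^T + s%:M) *m B = 1%:M - s *: invmx (B^T *m B + s%:M).
Proof.
move=> s0; have u1 : B^T *m B + s%:M \in unitmx by apply: gram_shift_unit; [right|exact: ltW].
have u2 : B *m B^T + s%:M \in unitmx.
  by rewrite -{1}[B]trmxK; apply: gram_shift_unit; [right|exact: ltW].
(* both products expand to the same sum *)
have push : (B^T *m B + s%:M) *m B^T = B^T *m (B *m B^T + s%:M).
  by rewrite mulmxDl mulmxDr mulmxA mul_scalar_mx mul_mx_scalar.
have -> : B^T *m invmx (B *m B^T + s%:M) = invmx (B^T *m B + s%:M) *m B^T.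
  by rewrite -[LHS](mulKmx u1) (mulmxA _ B^T) push -(mulmxA B^T) mulmxV// mulmx1.
rewrite -mulmxA -[X in invmx _ *m X](addrK s%:M) mulmxBr mulVmx//.
by rewrite mul_mx_scalar.
Qed.

(** By [ridge_projection] the difference to the limit is [s * (v *m invmx (G + s%:M)
    *m v^T)] with [s = k * t] and [G] invertible, and the inverse of [G + s%:M] is at
    most the inverse of [G] as a quadratic form. *)
Lemma ridge_limit d m (B : 'M[R]_(d, m)) (v : 'rV[R]_m) (k : R) : 0 < k ->
  (forall w : 'rV[R]_m, w *m B^T = 0 -> w = 0) ->
  (v *m (B^T *m invmx (B *m B^T + (k * t)%:M) *m B) *m v^T) 0 0 @[t --> 0^'+] --> sqnorm v.
Proof.
move=> k0 inj.
pose G := B^T *m B.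
have uG : G \in unitmx by rewrite -[G]addr0 -(raddf0 (@scalar_mx R m)); apply: gram_shift_unit; [left|].
have GT : G^T = G by rewrite trmx_mul trmxK.
have posG (w : 'rV[R]_m) : 0 <= (w *m G *m w^T) 0 0 by rewrite mulmx_tr_sqnorm sqnorm_ge0.
have GVT : (invmx G)^T = invmx G by rewrite trmx_inv GT.
have posGV (w : 'rV[R]_m) : 0 <= (w *m invmx G *m w^T) 0 0.
  have -> : w *m invmx G *m w^T = (w *m invmx G) *m G *m (w *m invmx G)^T.
    by rewrite trmx_mul GVT mulmxKV// mulmxA.
  exact: posG.
have mx1D (X Y : 'M[R]_1) : (X + Y) 0 0 = X 0 0 + Y 0 0 by rewrite mxE.
have mx1Z r (X : 'M[R]_1) : (r *: X) 0 0 = r * X 0 0 by rewrite mxE.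
pose K := (v *m invmx G *m v^T) 0 0.
have bound t : 0 < t -> 0 <= sqnorm v - (v *m (B^T *m invmx (B *m B^T + (k * t)%:M) *m B) *m v^T) 0 0 <= k * K * t.
  move=> t0; set s := k * t; have s0 : 0 < s by rewrite mulr_gt0.
  have -> : sqnorm v - (v *m (B^T *m invmx (B *m B^T + s%:M) *m B) *m v^T) 0 0 =
      s * (v *m invmx (G + s%:M) *m v^T) 0 0.
    rewrite ridge_projection// -/G mulmxBr mulmxBl mulmx1 -scalemxAr -scalemxAl.
    by rewrite sqnormE !mxE; ring.
  have u1 : G + s%:M \in unitmx by apply: gram_shift_unit; [right|exact: ltW].
  pose u := v *m invmx (G + s%:M).
  have vE : v = u *m (G + s%:M) by rewrite /u mulmxKV.
  have GsT : (G + s%:M)^T = G + s%:M by rewrite linearD/= GT tr_scalar_mx.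
  have E1 : (v *m invmx (G + s%:M) *m v^T) 0 0 = (u *m G *m u^T) 0 0 + s * sqnorm u.
    rewrite -/u {1}vE trmx_mul GsT mulmxA mulmxDr mul_mx_scalar mulmxDl mxE -scalemxAl.
    by congr (_ + _); rewrite mxE sqnormE.
  (* substitute [v = u *m (G + s%:M)] in the quadratic form of [invmx G] *)
  have E2 : K = (u *m G *m u^T) 0 0 + s * sqnorm u + s * sqnorm u + s ^+ 2 * (u *m invmx G *m u^T) 0 0.
    rewrite /K {1 2}vE trmx_mul GsT mulmxDr mul_mx_scalar mulmxDl -mulmxA mulmxV// mulmx1.
    rewrite -scalemxAl mulmxDl !mulmxA !mulmxDr !mul_mx_scalar mulmxDl -!scalemxAl.
    rewrite -(mulmxA _ (invmx G) G) mulVmx// mulmx1 !mulmxDl -!scalemxAl.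
    have -> : u *m B^T *m B = u *m G by rewrite mulmxA.
    by rewrite !mx1D !mx1Z -!sqnormE; ring.
  rewrite E1; apply/andP; split.
    by rewrite mulr_ge0 ?(ltW s0)// addr_ge0 ?posG// mulr_ge0 ?(ltW s0) ?sqnorm_ge0.
  rewrite (_ : k * K * t = s * K); last by rewrite /s; ring.
  by rewrite ler_pM2l// E2 -addrA lerDl addr_ge0 ?(mulr_ge0 (ltW s0))// ?sqnorm_ge0// mulr_ge0 ?sqr_ge0// posGV.
apply/cvgrPdist_le => e e0.
have K0 : 0 <= K by exact: posGV.
have kK : 0 < k * K + 1 by rewrite ltr_wpDl// mulr_ge0// ltW.
have small : \forall t \near 0^'+, t <= e / (k * K + 1).
  by apply: nbhs_right_le; exact: divr_gt0.
near=> t.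
have t0 : 0 < t by [].
have /andP[b1 b2] := bound t t0.
rewrite ger0_norm//; apply: (le_trans b2).
have te : t <= e / (k * K + 1) by near: t.
move: te; rewrite ler_pdivlMr// mulrDr mulr1 => h; lra.
Unshelve. all: by end_near. Qed.

End projection.

Section signed_sample.
Context {R : realType} (n d : nat).
Implicit Types (x : 'I_n -> 'rV[R]_d) (e : 'I_n -> R).

Definition ridge_statistic x (t : R) : R :=
  (sample_mean x *m invmx (sample_second_moment x + t%:M) *m (sample_mean x)^T) 0 0.

(** The vectors [a i] are the columns of a matrix [U] with orthonormal rows that span
    the column space of the data. Changing the signs of the observations does not
    change their second moment, so the same frame serves all sign patterns. *)
Lemma orthonormal_frame x : (0 < n)%N -> exists m (a : 'I_n -> 'rV[R]_m),
  [/\ (m <= d)%N, forall j k, \sum_i a i 0 j * a i 0 k = (j == k)%:R &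
  forall e, (forall i, e i ^+ 2 = 1) ->
    ridge_statistic (fun i => e i *: x i) t @[t --> 0^'+] --> n%:R^-1 * sqnorm (\sum_i e i *: a i)].
Proof.
move=> n0; have nR : 0 < n%:R :> R by rewrite ltr0n.
have nR0 : n%:R != 0 :> R by rewrite gt_eqF.
pose X : 'M[R]_(n, d) := \matrix_i x i.
have [m [C [U [md XE UU inj]]]] := gram_schmidt X^T.
exists m, (fun i => row i U^T); split => //.
  move=> j k; have /matrixP/(_ j k) := UU; rewrite !mxE => <-.
  by apply: eq_bigr => i _; rewrite !mxE.
move=> e e1; pose w : 'rV[R]_n := \row_i e i; pose v := w *m U^T.
have -> : \sum_i e i *: row i U^T = v.
  by rewrite /v mulmx_sum_row; apply: eq_bigr => i _; rewrite mxE.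
have meanE : sample_mean (fun i => e i *: x i) = n%:R^-1 *: (v *m C^T).
  rewrite /sample_mean /v -mulmxA -trmx_mul -XE trmxK mulmx_sum_row; congr (_ *: _).
  by apply: eq_bigr => i _; rewrite mxE rowK.
have momE : sample_second_moment (fun i => e i *: x i) = n%:R^-1 *: (C *m C^T).
  rewrite /sample_second_moment; congr (_ *: _).
  have -> : C *m C^T = X^T *m X.
    have XT : X = U^T *m C^T by rewrite -[X]trmxK XE trmx_mul.
    by rewrite XE XT mulmxA -(mulmxA C) UU mulmx1.
  apply/matrixP => j k; rewrite summxE mxE; apply: eq_bigr => i _.
  by rewrite !mxE big_ord1 !mxE mulrACA -expr2 e1 mul1r.
have lim := @ridge_limit R d m C v n%:R nR inj.
have : n%:R^-1 * (v *m (C^T *m invmx (C *m C^T + (n%:R * t)%:M) *m C) *m v^T) 0 0 @[t --> 0^'+]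
    --> n%:R^-1 * sqnorm v by apply: cvgM => //; exact: cvg_cst.
apply: cvg_trans; apply: near_eq_cvg; near=> t.
have t0 : 0 < t by [].
have s0 : 0 < n%:R * t by exact: mulr_gt0.
rewrite /ridge_statistic meanE momE.
have uM : C *m C^T + (n%:R * t)%:M \in unitmx.
  by rewrite -{1}[C]trmxK; apply: gram_shift_unit; [right|exact: ltW].
have -> : n%:R^-1 *: (C *m C^T) + t%:M = n%:R^-1 *: (C *m C^T + (n%:R * t)%:M).
  by rewrite scalerDr scale_scalar_mx mulKf.
rewrite invmxZ ?invrK; last by rewrite unitmxZ// unitfE invr_eq0.
have trZ (k : R) (A : 'rV[R]_d) : (k *: A)^T = k *: A^T by rewrite linearZ.
have mx1Z r (Y : 'M[R]_1) : (r *: Y) 0 0 = r * Y 0 0 by rewrite mxE.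
rewrite trZ -!(scalemxAr, scalemxAl) !mx1Z (trmx_mul v) trmxK !mulmxA.
by field.
Unshelve. all: by end_near. Qed.

End signed_sample.

(** * Counting the sign patterns with a large statistic *)

Section sign_patterns.
Context {R : realType}.

Definition sign_vector n (t : n.-tuple bool) (i : 'I_n) : R := (-1) ^+ (tnth t i).

Lemma sign_vector_sqr n (t : n.-tuple bool) i : sign_vector t i ^+ 2 = 1.
Proof. by rewrite /sign_vector -exprM mulnC exprM sqrrN expr1n expr1n. Qed.

Lemma big_tuple_bool n (G : n.+1.-tuple bool -> R) :
  \sum_t G t = \sum_(t : n.-tuple bool) (G [tuple of false :: t] + G [tuple of true :: t]).
Proof.
rewrite big_split/=.
transitivity (\sum_(b : bool) \sum_(t : n.-tuple bool) G [tuple of b :: t]); last first.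
  by rewrite big_bool addrC.
rewrite pair_bigA/= (reindex (fun p : bool * n.-tuple bool => [tuple of p.1 :: p.2]))//=.
apply: onW_bij; exists (fun t : n.+1.-tuple bool => (thead t, [tuple of behead t])).
  by move=> [b t]; congr pair; apply/val_inj.
by move=> t; rewrite [RHS]tuple_eta.
Qed.

Lemma sign_averagesE m n (a : 'I_n -> 'rV[R]_m) (f : 'rV[R]_m -> R) s :
  sign_averages [seq a i | i <- enum 'I_n] f s =
  2 ^- n * \sum_(t : n.-tuple bool) f (s + \sum_i sign_vector t i *: a i).
Proof.
elim: n a s => [|n IH] a s.
  rewrite (_ : enum 'I_0 = [::]); last by apply/size0nil; rewrite size_enum_ord.
  rewrite (big_pred1 [tuple]) => [|t]; last by apply/esym/eqP; exact: tuple0.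
  by rewrite big_ord0 addr0 expr0 invr1 mul1r.
rewrite enum_ordSl/= -map_comp /sign_average !IH big_tuple_bool exprSr invfM -mulrDr.
rewrite -big_split/= mulrAC; congr (_ * _).
apply: eq_bigr => t _; rewrite !big_ord_recl/= !addrA.
have sv0 b : sign_vector [tuple of b :: t] ord0 = (-1) ^+ b by rewrite /sign_vector tnth0.
have svS b i : sign_vector [tuple of b :: t] (lift ord0 i) = sign_vector t i.
  by rewrite /sign_vector tnthS.
rewrite !sv0 expr0 expr1 scale1r scaleN1r.
by congr (f (_ + _) + f (_ + _)); apply: eq_bigr => i _; rewrite svS.
Qed.

Lemma R_squared_frame n d m (x : 'I_n -> 'rV[R]_d) (a : 'I_n -> 'rV[R]_m) :
  ridge_statistic x t @[t --> 0^'+] --> n%:R^-1 * sqnorm (\sum_i a i) ->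
  (0 < n)%N -> Num.sqrt n%:R * R_statistic x = Num.sqrt (sqnorm (\sum_i a i)).
Proof.
move=> h n0; have nR : 0 < n%:R :> R by rewrite ltr0n.
rewrite /R_statistic (_ : R_squared x = n%:R^-1 * sqnorm (\sum_i a i)); last exact/cvg_lim.
by rewrite -sqrtrM ?ler0n// mulrA divff ?gt_eqF// mul1r.
Qed.

(** Markov's inequality for [F (sqnorm v)] with [F] from [exponential_majorant]: the
    average over signs is less than the average over Gaussian coefficients, which is a
    chi-square integral with [m <= d] degrees of freedom. If all the vectors of the
    frame vanish, the comparison is not strict, but then the statistic is zero for
    every pattern. *)
Lemma sign_count_lt n d (x : 'I_n -> 'rV[R]_d) y : (0 < n)%N -> (0 < d)%N -> 0 < y ->
  (d = 1%N -> chi_q 1 y <= 9 / (4 * expR 3)) ->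
  (#|[pred t : n.-tuple bool | y <= Num.sqrt n%:R * R_statistic (fun i => sign_vector t i *: x i)]|%:R : R)
    < 2 ^+ n * (2 * expR 3 / 9 * chi_q d y).
Proof.
move=> n0 d0 y0 y1.
have [m [a [md cov limx]]] := orthonormal_frame x n0.
have statE t : Num.sqrt n%:R * R_statistic (fun i => sign_vector t i *: x i)
    = Num.sqrt (sqnorm (\sum_i sign_vector t i *: a i)).
  by apply: R_squared_frame => //; apply: limx => i; exact: sign_vector_sqr.
have pos : 0 < 2 * expR 3 / 9 * chi_q d y :> R.
  by rewrite mulr_gt0 ?chi_q_gt0// divr_gt0// mulr_gt0// expR_gt0.
have two : 0 < 2 ^+ n :> R by exact: exprn_gt0.
set B := (X in #|X|).
have BE t : (t \in B) = (y ^+ 2 <= sqnorm (\sum_i sign_vector t i *: a i)).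
  by rewrite inE statE -{1}(ger0_norm (ltW y0)) -sqrtr_sqr ler_sqrt ?sqnorm_ge0.
have [nz|z] := boolP (has (fun b => b != 0) [seq a i | i <- enum 'I_n]); last first.
  have a0 i : a i = 0.
    apply/eqP; apply: contraNT z => ai; apply/hasP; exists (a i) => //.
    by apply: map_f; rewrite mem_enum.
  have -> : #|B| = 0%N.
    apply: eq_card0 => t; rewrite BE inE big1 => [|i _]; last by rewrite a0 scaler0.
    rewrite (_ : sqnorm 0 = 0); first by apply/negbTE; rewrite -ltNge exprn_gt0.
    by rewrite /sqnorm big1// => i _; rewrite mxE expr0n.
  by rewrite mulr_gt0.
have [F [mF F0 hF Fy [intF /(_ m md) KF]]] := exponential_majorant d0 y0 y1.
have mf : measurable_fun setT (fun v : 'rV[R]_m => F (sqnorm v)).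
  by apply: (measurableT_comp mF); exact: measurable_sqnorm.
have [_ /(_ nz)] := sign_averages_lt [seq a i | i <- enum 'I_n] 0 mf (fun v => F0 (sqnorm v)) KF.
have -> : gaussian_averages [seq a i | i <- enum 'I_n] (EFin \o (fun v : 'rV[R]_m => F (sqnorm v))) 0
    = (\int[chi_square m]_u (F u)%:E)%E.
  rewrite (@gaussian_averages_chi_square R m (EFin \o F) _ m) //.
  - have -> : sqnorm (0 : 'rV[R]_m) = 0 by rewrite /sqnorm big1// => i _; rewrite mxE expr0n.
    by under eq_integral do rewrite add0r.
  - exact/measurable_EFinP.
  - move=> i j; rewrite ltn_ord andbT -cov /covariance_form big_map big_enum//.
  - by move=> i _; rewrite mxE.
move=> h1.
have h2 : (\int[@chi_square R m]_u (F u)%:E <= \int[@chi_square R d]_u (F u)%:E)%E.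
  by apply: le_integral_chi_square => //; exact/measurable_EFinP.
have := lt_le_trans h1 (le_trans h2 intF); rewrite lte_fin sign_averagesE.
rewrite ltr_pdivrMl// => h3.
rewrite -(ltr_pM2r Fy) -[ltRHS]mulrA; apply: le_lt_trans h3.
rewrite -sum1_card natr_sum mulr_suml [leRHS](bigID (mem B))/=.
rewrite -[leLHS]addr0 lerD//; last by apply: sumr_ge0 => t _; exact: F0.
by apply: ler_sum => t; rewrite BE add0r mul1r => yt; exact: hF.
Qed.

End sign_patterns.

(** * Measurability of the statistic *)

Section measurable_matrix_algebra.
Context {R : realType} dT (T : measurableType dT).

(** Equivalent to measurability for the product sigma-algebra; the entries are what
    the formulas for products, determinants and inverses act on. *)
Definition entrywise_measurable m n (M : T -> 'M[R]_(m, n)) :=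
  forall i j, measurable_fun [set: T] (fun t => M t i j).

Lemma entrywise_measurableM m n p (M : T -> 'M[R]_(m, n)) (N : T -> 'M[R]_(n, p)) :
  entrywise_measurable M -> entrywise_measurable N -> entrywise_measurable (fun t => M t *m N t).
Proof.
move=> mM mN i j; under eq_fun do rewrite mxE.
by apply: measurable_sum => k; apply: measurable_funM.
Qed.

Lemma entrywise_measurableZ m n (k : T -> R) (M : T -> 'M[R]_(m, n)) : measurable_fun [set: T] k ->
  entrywise_measurable M -> entrywise_measurable (fun t => k t *: M t).
Proof. by move=> mk mM i j; under eq_fun do rewrite mxE; apply: measurable_funM. Qed.

Lemma entrywise_measurableD m n (M N : T -> 'M[R]_(m, n)) :
  entrywise_measurable M -> entrywise_measurable N -> entrywise_measurable (fun t => M t + N t).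
Proof. by move=> mM mN i j; under eq_fun do rewrite mxE; apply: measurable_funD. Qed.

Lemma entrywise_measurable_cst m n (A : 'M[R]_(m, n)) : entrywise_measurable (fun=> A).
Proof. by move=> i j; exact: measurable_cst. Qed.

Lemma entrywise_measurable_sum m n I (s : seq I) (M : I -> T -> 'M[R]_(m, n)) :
  (forall i, entrywise_measurable (M i)) -> entrywise_measurable (fun t => \sum_(i <- s) M i t).
Proof.
move=> mM i j; under eq_fun do rewrite summxE.
by apply: measurable_sum => k; exact: mM.
Qed.

Lemma entrywise_measurableT m n (M : T -> 'M[R]_(m, n)) :
  entrywise_measurable M -> entrywise_measurable (fun t => (M t)^T).
Proof. by move=> mM i j; under eq_fun do rewrite mxE; exact: mM. Qed.

Lemma measurable_det n (M : T -> 'M[R]_n) :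
  entrywise_measurable M -> measurable_fun [set: T] (fun t => \det (M t)).
Proof.
move=> mM; apply: measurable_sum => s; apply: measurable_funM => //.
by apply: measurable_prod => i _; exact: mM.
Qed.

(** Cramer's rule on the set where the determinant is not zero; elsewhere the inverse
    is the matrix itself by convention. *)
Lemma entrywise_measurable_inv n (M : T -> 'M[R]_n) :
  entrywise_measurable M -> entrywise_measurable (fun t => invmx (M t)).
Proof.
move=> mM i j.
have -> : (fun t => invmx (M t) i j) =
    (fun t => if \det (M t) == 0 then M t i j else (\det (M t))^-1 * cofactor (M t) j i).
  apply/funext => t; rewrite /invmx unitmxE unitfE; case: eqP => //= _.
  by rewrite !mxE.
apply: measurable_fun_ifT; first by apply: measurable_fun_eqr => //; exact: measurable_det.
  exact: mM.
apply: measurable_funM; first by apply: (measurableT_comp measurable_inv); exact: measurable_det.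
apply: measurable_funM => //; apply: measurable_det => k l.
by under eq_fun do rewrite !mxE; exact: mM.
Qed.

Lemma measurable_ridge_statistic n d (x : T -> 'I_n -> 'rV[R]_d) (t : R) :
  (forall i, entrywise_measurable (fun w => x w i)) ->
  measurable_fun [set: T] (fun w => ridge_statistic (x w) t).
Proof.
move=> mx.
have mmean : entrywise_measurable (fun w => sample_mean (x w)).
  by apply: entrywise_measurableZ => //; exact: entrywise_measurable_sum.
apply: entrywise_measurableM; last exact: entrywise_measurableT.
apply: entrywise_measurableM => //; apply: entrywise_measurable_inv.
apply: entrywise_measurableD; last exact: entrywise_measurable_cst.
apply: entrywise_measurableZ => //; apply: entrywise_measurable_sum => i.
apply: entrywise_measurableM; [exact: entrywise_measurableT|exact: mx].
Qed.

(** The statistic is a limit along the sequence of reciprocals of the positive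
    integers; the limit exists for every sample by [orthonormal_frame] with all signs
    equal to one. *)
Lemma measurable_R_statistic n d (x : T -> 'I_n -> 'rV[R]_d) : (0 < n)%N ->
  (forall i, entrywise_measurable (fun w => x w i)) ->
  measurable_fun [set: T] (fun w => R_statistic (x w)).
Proof.
move=> n0 mx; apply: (measurableT_comp measurable_sqrt).
apply: (@measurable_fun_cvg _ _ R setT (fun k w => ridge_statistic (x w) (harmonic k))).
  by move=> k; exact: measurable_ridge_statistic.
move=> w _; have [m [a [_ _ /(_ (fun=> 1))]]] := orthonormal_frame (x w) n0.
have -> : (fun i => 1 *: x w i) = x w by apply/funext => i; rewrite scale1r.
move=> /(_ (fun=> expr1n _ _)) cv.
rewrite /R_squared (cvg_lim _ cv)//; move/cvg_at_rightP: cv; apply.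
by split; [move=> k; exact: harmonic_gt0|exact: cvg_harmonic].
Qed.

End measurable_matrix_algebra.

(** * From sign patterns to the law of the statistic *)

Section orthant_tail.
Context {R : realType}.

Lemma measurable_tuple_fun dT (T : measurableType dT) dS (S : measurableType dS) n (f : 'I_n -> T -> S) :
  (forall i, measurable_fun [set: T] (f i)) -> measurable_fun [set: T] (fun w => [tuple f i w | i < n]).
Proof.
move=> mf; apply/measurable_fun_tnthP => i.
by rewrite (_ : _ \o _ = f i)//; apply/funext => w /=; rewrite tnth_mktuple.
Qed.

Lemma measurable_tuple_event dT (T : measurableType dT) dS (S : measurableType dS) n (f : 'I_n -> T -> S)
    (B : set (n.-tuple S)) : measurable B ->
  (forall i, measurable_fun [set: T] (f i)) -> measurable [set w | B [tuple f i w | i < n]].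
Proof.
by move=> mB mf; have := measurable_tuple_fun mf measurableT mB; rewrite setTI.
Qed.

Lemma measure_finType_partition dT (T : measurableType dT) (mu : {measure set T -> \bar R}) (I : finType)
    (F : I -> set T) : trivIset setT F -> (forall i, measurable (F i)) ->
  mu (\bigcup_i F i) = (\sum_i mu (F i))%E.
Proof.
move=> tF mF; rewrite measure_fin_bigcup//; last exact: finite_finset.
rewrite (fsbig_seq _ _ (index_enum_uniq I)).
suff -> : [set` index_enum I] = [set: I] by [].
by apply/seteqP; split => // i _ /=; rewrite mem_index_enum.
Qed.

(** Condition on the signs. They are independent of [Y] and each pattern has
    probability [2 ^- n], so the probability of the event is [2 ^- n] times the
    expected number of patterns [t] for which the signed sample lies in [B]; this
    number is at most [K] for every sample. *)
Lemma orthant_tail n d dT (T : measurableType dT) (P : probability T R)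
    (X : 'I_n -> {RV P >-> 'rV[R]_d}) (B : set (n.-tuple 'rV[R]_d)) (K : R) :
  measurable B -> orthant_symmetric X ->
  (forall x : 'I_n -> 'rV[R]_d,
    #|[pred t : n.-tuple bool | `[< B [tuple sign_vector t i *: x i | i < n] >]]|%:R <= K) ->
  (P [set w | B [tuple X i w | i < n]] <= (2 ^- n * K)%:E)%E.
Proof.
move=> mB [dU [U [Q [Y [e [_ re ind law]]]]]] count.
rewrite (law B mB).
pose E (t : n.-tuple bool) := [set w | forall i, e i w = sign_vector t i].
(* [C t] collects the samples whose version with signs [t] lies in [B] *)
pose C (t : n.-tuple bool) := [set x : n.-tuple 'rV[R]_d | B [tuple sign_vector t i *: tnth x i | i < n]].
pose A t := [set w | C t [tuple Y i w | i < n]].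
set G := [set w | _].
have mC t : measurable (C t).
  apply: (measurable_tuple_event (f := fun i (x : n.-tuple 'rV[R]_d) => sign_vector t i *: tnth x i)) => // i.
  apply: measurable_mx => j k; under eq_fun do rewrite mxE.
  apply: measurable_funM => //; apply: (measurableT_comp (measurable_entry j k)).
  exact: measurable_tnth.
have mA t : measurable (A t).
  by apply: (measurable_tuple_event (f := fun i => Y i : U -> _)).
have mG : measurable G.
  apply: (measurable_tuple_event (f := fun i w => e i w *: Y i w)) => // i.
  apply: measurable_mx => j k; under eq_fun do rewrite mxE.
  by apply: measurable_funM => //; apply: (measurableT_comp (measurable_entry j k)).
have mE t : measurable (E t).
  have -> : E t = \bigcap_(i in [set: 'I_n]) (e i @^-1` [set sign_vector t i]).
    by apply/seteqP; split => [w h i _|w h i]; [exact: h|exact: (h i)].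
  apply: fin_bigcap_measurable => [|i _]; first exact: finite_finset.
  by rewrite -[X in measurable X]setTI; exact: measurable_funP.
have signP t i : Q [set w | [set sign_vector t i] (e i w)] = (2^-1)%:E.
  by rewrite /sign_vector; case: (tnth t i); [rewrite expr1; case: (re i)|rewrite expr0; case: (re i)].
have prodE t : (\prod_(i < n) Q [set w | [set sign_vector t i] (e i w)] = (2 ^- n)%:E)%E.
  rewrite (eq_bigr (fun=> (2^-1)%:E)) => [|i _]; last exact: signP.
  by rewrite prodEFin prodr_const card_ord exprVn.
have QE t : Q (E t) = (2 ^- n)%:E.
  have := ind setT (fun i => [set sign_vector t i]) measurableT (fun i => measurable_set1 _).
  rewrite prodE (_ : [set w | setT _] = setT)// probability_setT mul1e => <-.
  by congr (Q _); apply/seteqP; split => [w h|w [_ h]].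
have QGE t : Q (G `&` E t) = (Q (A t) * (2 ^- n)%:E)%E.
  have := ind (C t) (fun i => [set sign_vector t i]) (mC t) (fun i => measurable_set1 _).
  rewrite prodE => <-.
  congr (Q _); apply/seteqP; split => [w [Gw h]|w [Aw h]]; split => //.
  - rewrite /C/=; move: Gw; rewrite /G/= => Gw.
    rewrite (_ : [tuple _ | _ < n] = [tuple e i w *: Y i w | i < n])//.
    by apply: eq_from_tnth => i; rewrite !tnth_mktuple -h.
  - rewrite /G/=; rewrite (_ : [tuple _ | _ < n] = [tuple sign_vector t i *: tnth [tuple Y i w | i < n] i | i < n])//.
    by apply: eq_from_tnth => i; rewrite !tnth_mktuple h.
pose E' := \bigcup_t E t.
have tE : trivIset setT E.
  move=> t u _ _ [w [ht hu]]; apply: eq_from_tnth => i.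
  have := etrans (esym (ht i)) (hu i); rewrite /sign_vector.
  by case: (tnth t i); case: (tnth u i) => //; rewrite expr0 expr1 => h; exfalso; lra.
have sumE D : measurable D -> Q (D `&` E') = (\sum_t Q (D `&` E t))%E.
  move=> mD; rewrite /E' setI_bigcupr measure_finType_partition//.
    exact: trivIset_setIl.
  by move=> t; exact: measurableI.
have mE' : measurable E' by apply: fin_bigcup_measurable => //; exact: finite_finset.
have QE' : Q E' = 1%E.
  rewrite -[E']setTI sumE//; under eq_bigr do rewrite setTI QE.
  rewrite sumEFin sumr_const card_tuple card_bool -(mulr_natr (2 ^- n)) natrX mulVf//.
have -> : Q G = Q (G `&` E').
  apply/eqP; rewrite eq_le; apply/andP; split; last first.
    by apply: le_measure; rewrite ?inE//; exact: measurableI.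
  rewrite -{1}(setUIDK G E'); apply: le_trans (measureU2 _ _ _ ) _.
  - exact: measurableI.
  - exact: measurableD.
  rewrite -[leRHS]adde0 leeD2l//.
  apply: (@le_trans _ _ (Q (~` E'))).
    by apply: le_measure; rewrite ?inE; [exact: measurableD|exact: measurableC|exact: subIsetr].
  by rewrite probability_setC// QE' subee.
rewrite sumE//; under eq_bigr do rewrite QGE muleC.
rewrite -ge0_sume_distrr => [|t _]; last exact: measure_ge0.
have pos : (0 < (2 ^- n : R)%:E)%E by rewrite lte_fin invr_gt0 exprn_gt0.
rewrite EFinM lee_pmul2l//.
have -> : (\sum_t Q (A t) = \int[Q]_w \sum_t (\1_(A t) w)%:E)%E.
  rewrite ge0_integral_sum//.
  - by apply: eq_bigr => t _; rewrite integral_indic// setIT.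
  - by move=> t; apply/measurable_EFinP; exact: measurable_indic.
apply: (@le_trans _ _ (\int[Q]_w K%:E)%E); last first.
  suff -> : (\int[Q]_w K%:E = K%:E * Q setT)%E by rewrite probability_setT mule1.
  exact: integral_cst.
have K0 : (0 <= K%:E)%E.
  by rewrite lee_fin; apply: le_trans (count (fun=> 0)); exact: ler0n.
have sum0 w : setT w -> (0 <= \sum_t (\1_(A t) w : R)%:E)%E.
  by move=> _; apply: sume_ge0 => t _; rewrite lee_fin.
have msum : measurable_fun setT (fun w => \sum_t (\1_(A t) w : R)%:E)%E.
  by apply: emeasurable_sum => t; apply/measurable_EFinP; exact: measurable_indic.
apply: ge0_le_integral => //.
move=> w _; rewrite sumEFin lee_fin; apply: le_trans (count (fun i => Y i w)).
rewrite -sum1_card natr_sum [leRHS]big_mkcond/=; apply: ler_sum => t _.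
rewrite indicE; have [|] := boolP (w \in A t); rewrite ?inE => h.
  rewrite asboolT//; move: h; rewrite /A /C/=.
  rewrite (_ : [tuple _ | _ < n] = [tuple sign_vector t i *: Y i w | i < n])//.
  by apply: eq_from_tnth => i; rewrite !tnth_mktuple.
by case: asboolP.
Qed.

End orthant_tail.

Section statistic_quantile.
Context {R : realType}.

(** Uniformity for integers: finitely many possible counts below [c] stay below a
    common integer that is itself less than [c]. *)
Lemma bounded_nat_gap (c : R) N : 0 < c ->
  exists2 K : nat, K%:R < c & forall k, (k <= N)%N -> k%:R < c -> (k <= K)%N.
Proof.
move=> c0; exists (\max_(k < N.+1 | (k : nat)%:R < c) k).
  by elim/big_ind: _ => // a b ha hb; rewrite /maxn; case: ifP.
by move=> k kN kc; apply: (leq_bigmax_cond (Ordinal (kN : (k < N.+1)%N))).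
Qed.

Variable s : orthant_sample R.
Local Notation n := (sample_size s).
Local Notation d := (Defs.dimension s).
Local Notation X := (observation (o := s)).

Definition statistic_ge (y : R) : set (Defs.space s) :=
  [set w | y <= Num.sqrt n%:R * R_statistic (fun i => X i w)].

Lemma measurable_statistic_ge y : measurable (statistic_ge y).
Proof.
have mS : measurable_fun setT (fun w : Defs.space s => Num.sqrt n%:R * R_statistic (fun i => X i w)).
  apply: measurable_funM => //; apply: measurable_R_statistic => [|i]; first exact: sample_size_gt0.
  by move=> j k; apply: (measurableT_comp (measurable_entry j k)).
exact: measurable_superlevel.
Qed.

(** The number of favourable sign patterns is an integer less than [2 ^+ n] times the
    bound for every sample, so it is at most a fixed integer with this property, and
    the strict inequality survives the expectation. *)
Lemma law_statistic_ge_lt y : 0 < y -> (d = 1%N -> chi_q 1 y <= 9 / (4 * expR 3)) ->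
  (law s (statistic_ge y) < (2 * expR 3 / 9 * chi_q d y)%:E)%E.
Proof.
move=> y0 y1.
pose B := [set x : n.-tuple 'rV[R]_d | y <= Num.sqrt n%:R * R_statistic (fun i => tnth x i)].
have BE (x : 'I_n -> 'rV[R]_d) : B [tuple x i | i < n] = (y <= Num.sqrt n%:R * R_statistic x) :> Prop.
  by rewrite /B/= (_ : (fun i => tnth _ i) = x)//; apply/funext => i; rewrite tnth_mktuple.
have mB : measurable B.
  have mS : measurable_fun setT (fun x : n.-tuple 'rV[R]_d => Num.sqrt n%:R * R_statistic (fun i => tnth x i)).
    apply: measurable_funM => //; apply: measurable_R_statistic => [|i]; first exact: sample_size_gt0.
    by move=> j k; apply: (measurableT_comp (measurable_entry j k)); exact: measurable_tnth.
  exact: measurable_superlevel.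
have d0 := dimension_gt0 s; have n0 := sample_size_gt0 s.
have q0 : 0 < 2 * expR 3 / 9 * chi_q d y :> R.
  by rewrite mulr_gt0 ?chi_q_gt0// divr_gt0// mulr_gt0// expR_gt0.
have two : 0 < 2 ^+ n :> R by exact: exprn_gt0.
(* a count of patterns never exceeds [2 ^ n] *)
have [K Kq KP] := bounded_nat_gap (2 ^ n) (mulr_gt0 two q0).
have -> : statistic_ge y = [set w | B [tuple X i w | i < n]].
  by apply/seteqP; split => w; rewrite /= BE.
apply: (@le_lt_trans _ _ (2 ^- n * K%:R)%:E); last by rewrite lte_fin ltr_pdivrMl.
apply: orthant_tail => // [|x]; first exact: observation_symmetric.
rewrite ler_nat; have -> : #|[pred t : n.-tuple bool | `[< B [tuple sign_vector t i *: x i | i < n] >]]| =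
   #|[pred t : n.-tuple bool | y <= Num.sqrt n%:R * R_statistic (fun i => sign_vector t i *: x i)]|.
  by apply: eq_card => t; rewrite !inE BE asboolb.
apply: KP; last exact: sign_count_lt.
by apply: leq_trans (max_card _) _; rewrite card_tuple card_bool.
Qed.

(** The events for the levels [y - 1 / (k + 1)] decrease to the event for [y], whose
    probability is less than [delta]; so some level below [y] still has probability at
    most [delta] and bounds the infimum. *)
Lemma stat_quantile_lt delta y : 0 < delta -> delta < 1 -> 0 < y -> (d = 1%N -> chi_q 1 y <= 9 / (4 * expR 3)) ->
  2 * expR 3 / 9 * chi_q d y = delta -> stat_quantile s delta < y.
Proof.
move=> delta0 delta1 y0 y1 qE.
have := law_statistic_ge_lt y0 y1; rewrite qE => ylt.
pose F k := statistic_ge (y - harmonic k).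
have mF k : measurable (F k) by exact: measurable_statistic_ge.
have capF : \bigcap_k F k = statistic_ge y.
  apply/seteqP; split => w; rewrite /statistic_ge/=; last first.
    by move=> h k _; rewrite /F/statistic_ge/=; apply: le_trans h; rewrite gerBl ltW ?harmonic_gt0.
  move=> h; set S := Num.sqrt _ * _.
  have cv : (y - harmonic k) @[k --> \oo] --> y.
    by rewrite -[X in _ --> X]subr0; apply: cvgB; [exact: cvg_cst|exact: cvg_harmonic].
  rewrite -(cvg_lim _ cv)//; apply: limr_le; first by apply/cvg_ex; exists y.
  by near=> k; apply: (h k).
have noninc : {homo F : n m / (n <= m)%N >-> (m <= n)%O}.
  move=> k l kl; apply/subsetPset => w; rewrite /F/statistic_ge/=; apply: le_trans.
  by rewrite lerB// /harmonic lef_pV2 ?posrE ?ltr0n// ler_nat.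
have cvF : (law s \o F) x @[x --> \oo] --> law s (\bigcap_k F k).
  apply: nonincreasing_cvg_mu => //; last by rewrite capF; exact: measurable_statistic_ge.
  by apply: le_lt_trans (probability_le1 _ _) _ => //; rewrite ltry.
rewrite capF in cvF.
have [k kF] : exists k, (law s (F k) <= delta%:E)%E.
  apply: contrapT => /forallNP noF; move: ylt; apply/negP; rewrite -leNgt -(cvg_lim _ cvF)//.
  apply: lime_ge; first by apply/cvg_ex; exists (law s (statistic_ge y)).
  by near=> k; rewrite ltW// ltNge; apply/negP; exact: noF.
apply: (@le_lt_trans _ _ (y - harmonic k)); last by rewrite gtrBl harmonic_gt0.
apply: ge_inf; last exact: kF.
exists 0 => x/=; apply: contraTT; rewrite -ltNge => x0; rewrite -ltNge.
rewrite (_ : [set w | _] = setT) ?probability_setT ?lte_fin//.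
apply/seteqP; split => // w _ /=; apply: le_trans (ltW x0) _.
by rewrite mulr_ge0 ?sqrtr_ge0.
Unshelve. all: by end_near. Qed.

End statistic_quantile.

(** * Comparison of quantiles *)

Section quantile_comparison.
Context {R : realType}.
Implicit Types (s : orthant_sample R) (delta : R).

Local Notation c := (2 * expR 3 / 9 : R).

(** Since [expR 1] is at least two, [expR 3] is at least eight. *)
Lemma comparison_constant_gt1 : 1 < c.
Proof.
have h : 2 <= expR 1 :> R by have := expR_ge1Dx (1 : R); lra.
have -> : expR 3 = expR 1 ^+ 3 :> R by rewrite -expRM_natr mul1r.
have : 8 <= expR 1 ^+ 3 :> R.
  have -> : 8 = 2 ^+ 3 :> R by ring.
  by apply: lerXn2r => //; rewrite nnegrE; lra.
lra.
Qed.

Let lnc_gt0 : 0 < ln c.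
Proof. exact/ln_gt0/comparison_constant_gt1. Qed.

Lemma chi_modeE d : (0 < d)%N -> Num.sqrt (d%:R - 1) = chi_mode d :> R.
Proof. by case: d => // d _; rewrite /chi_mode -natr1 addrK. Qed.

Lemma chi_mode_lt_quantile d delta : (0 < d)%N -> 0 < delta -> delta <= 2^-1 ->
  chi_mode d < chi_quantile d delta.
Proof.
move=> d0 delta0 delta1; apply: lt_chi_quantile => //.
  by rewrite delta0 (le_lt_trans delta1)//; lra.
exact: le_lt_trans (chi_q_mode_gt d0).
Qed.

(** The lower bound of [chi_q_mode_lb] for the tail at distance [M] beyond the mode is
    the same for all [d]. *)
Lemma chi_quantile_uniformly_large (M : R) : 0 <= M ->
  \forall delta \near 0^'+, forall d, (0 < d)%N -> chi_mode d + M < chi_quantile d delta.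
Proof.
move=> M0.
have peak : 0 < normal_peak 1 * expR (- (M + 1) ^+ 2) :> R.
  by rewrite mulr_gt0 ?expR_gt0// normal_peak_gt0.
have small : \forall delta \near 0^'+, delta < normal_peak 1 * expR (- (M + 1) ^+ 2) :> R.
  exact: nbhs_right_lt.
have small1 : \forall delta \near (0 : R)^'+, delta < 1 by exact: nbhs_right_lt.
near=> delta => d d0.
have delta0 : 0 < delta by [].
have delta1 : delta < 1 by near: delta.
apply: lt_chi_quantile => //; first by rewrite delta0.
apply: lt_le_trans (chi_q_mode_lb d0 M0); by near: delta.
Unshelve. all: by end_near. Qed.

Definition quantile_gap s delta : R :=
  (chi_quantile (Defs.dimension s) delta - Num.sqrt ((Defs.dimension s)%:R - 1))^-1 * ln c.

(** Beyond the mode by [M >= 1] the quantile is at least [sqrt d], because [(sqrt (d -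
    1) + 1) ^+ 2 >= d], and the gap is at most [ln c / M]. *)
Lemma quantile_gap_small (eps : R) : 0 < eps ->
  \forall delta \near 0^'+, forall s,
    let d := Defs.dimension s in
    [/\ 0 < delta, Num.sqrt d%:R <= chi_quantile d delta, 1 <= Num.sqrt d%:R :> R,
        0 < quantile_gap s delta & quantile_gap s delta + 3 * delta < eps].
Proof.
(* makes [ln c / M] less than [eps / 2]; the summand one gives [M >= 1] *)
move=> eps0; pose M := 1 + 2 * ln c / eps.
have M1 : 1 <= M by rewrite lerDl divr_ge0 ?mulr_ge0 ?(ltW eps0) ?(ltW lnc_gt0).
have large := chi_quantile_uniformly_large (le_trans ler01 M1).
have small : \forall delta \near (0 : R)^'+, delta < eps / 6 by apply: nbhs_right_lt; rewrite divr_gt0.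
near=> delta => s /=.
have delta0 : 0 < delta by [].
have d0 := dimension_gt0 s.
have xlarge : chi_mode (Defs.dimension s) + M < chi_quantile (Defs.dimension s) delta.
  by have : forall d, (0 < d)%N -> chi_mode d + M < chi_quantile d delta; [near: delta|apply].
have dsmall : delta < eps / 6 by near: delta.
rewrite /quantile_gap chi_modeE//; set x := chi_quantile _ _ in xlarge *.
set m := chi_mode _ in xlarge *.
have m0 : 0 <= m by exact: chi_mode_ge0.
have dE : (Defs.dimension s)%:R = m ^+ 2 + 1 :> R.
  by rewrite chi_mode2 natr1 prednK.
have gap0 : 0 < x - m by lra.
have r0 : 0 < (x - m)^-1 * ln c by rewrite mulr_gt0 ?invr_gt0.
split => //.
- rewrite dE -[leRHS]ger0_norm; last lra.
  by rewrite -sqrtr_sqr ler_wsqrtr//; nra.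
- by rewrite -[leLHS]sqrtr1 ler_wsqrtr// dE lerDr sqr_ge0.
have : (x - m)^-1 * ln c < eps / 2.
  rewrite mulrC ltr_pdivrMr//.
  have : eps / 2 * M <= eps / 2 * (x - m) by rewrite ler_pM2l ?divr_gt0//; lra.
  apply: lt_le_trans; rewrite /M mulrDr mulr1.
  rewrite (_ : eps / 2 * (2 * ln c / eps) = ln c); first lra.
  by field; rewrite gt_eqF.
lra.
Unshelve. all: by end_near. Qed.

(** With [h] equal to the increment, [chi_q_shift_lt] multiplies the tail by less than
    [expR (- ln c)]. *)
Lemma quantile_shift_lt d delta (x := chi_quantile d delta) : (0 < d)%N -> 0 < delta -> delta <= 2^-1 ->
  chi_quantile d (delta / c) < x + (x - (d%:R - 1) / x)^-1 * ln c.
Proof.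
move=> d0 delta0 delta1.
have [x0 qx] : 0 < x /\ chi_q d x = delta.
  by apply: chi_quantileP => //; rewrite delta0 (le_lt_trans delta1)//; lra.
have mx := chi_mode_lt_quantile d0 delta0 delta1; rewrite -/x in mx.
have c1 := comparison_constant_gt1; have c0 : 0 < c by lra.
have dE : d%:R - 1 = chi_mode d ^+ 2 :> R by rewrite chi_mode2 -(prednK d0) -natr1 addrK.
have l0 : 0 < x - (d%:R - 1) / x.
  rewrite subr_gt0 ltr_pdivrMr// dE -expr2 ltrXn2r// ?chi_mode_ge0//.
set h := (x - _)^-1 * ln c.
have h0 : 0 < h by rewrite mulr_gt0 ?invr_gt0.
apply: gt_chi_quantile => //.
  by rewrite divr_gt0// ltr_pdivrMr// mul1r; lra.
apply: lt_le_trans (chi_q_shift_lt d0 h0 x0) _.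
rewrite qx (_ : d.-1%:R = d%:R - 1); last by rewrite dE chi_mode2.
by rewrite /h mulrA divff ?gt_eqF// mul1r expRN lnK.
Qed.

(** The level [y = chi_quantile (delta / c)] has [c * chi_q y = delta]. In dimension
    one the hypothesis of the majorant asks for [delta / c <= 1 / (2 * c) = 9 / (4 *
    expR 3)], which is where [delta <= 1 / 2] enters. *)
Lemma stat_quantile_lt_chi s delta : 0 < delta -> delta <= 2^-1 ->
  stat_quantile s delta < chi_quantile (Defs.dimension s) (delta / c).
Proof.
move=> delta0 delta1; have d0 := dimension_gt0 s.
have c1 := comparison_constant_gt1; have c0 : 0 < c by lra.
have [x0 qx] : 0 < chi_quantile (Defs.dimension s) (delta / c) :> R /\
    chi_q (Defs.dimension s) (chi_quantile (Defs.dimension s) (delta / c)) = delta / c.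
  by apply: chi_quantileP => //; rewrite divr_gt0// ltr_pdivrMr// mul1r; lra.
apply: stat_quantile_lt => //; first lra.
  move=> dE; rewrite dE in qx; rewrite dE qx.
  have e0 : 0 < expR 3 :> R by exact: expR_gt0.
  rewrite (_ : 9 / (4 * expR 3) = 2^-1 / c); last by field; rewrite gt_eqF.
  by rewrite ler_pM2r// invr_gt0.
by rewrite qx; field; rewrite gt_eqF// expR_gt0.
Qed.

End quantile_comparison.

Theorem theorem6p3 (R : realType) :
  let c : R := 2 * expR 3 / 9 in
  exists o1 o2 o3 : orthant_sample R -> R -> R,
    [/\ uniform_o1 o1, uniform_o1 o2, uniform_o1 o3 &
    forall (s : orthant_sample R) (delta : R), 0 < delta -> delta <= 2^-1 ->
      let d : R := (dimension s)%:R in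
      let x : R := chi_quantile (dimension s) delta in
      Num.sqrt (d - 1) < x /\
      [/\ stat_quantile s delta < chi_quantile (dimension s) (delta / c),
          chi_quantile (dimension s) (delta / c)
            < x + (x - (d - 1) / x)^-1 * ln c,
          x + (x - (d - 1) / x)^-1 * ln c
            < x + (x - Num.sqrt (d - 1))^-1 * ln c ?<= if (dimension s == 1%N),
          x + (x - Num.sqrt (d - 1))^-1 * ln c < x + o1 s delta &
          x + o1 s delta < x * (1 + (Num.sqrt d)^-1 * o2 s delta) /\
          x * (1 + (Num.sqrt d)^-1 * o2 s delta) < x * (1 + o3 s delta)]].
Proof.
move=> c.
pose x (s : orthant_sample R) delta : R := chi_quantile (Defs.dimension s) delta.
pose q (s : orthant_sample R) : R := Num.sqrt (Defs.dimension s)%:R.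
(* each remainder is the exact difference, rescaled, plus [delta], which makes the
   inequalities strict *)
pose o1 s delta : R := quantile_gap s delta + delta.
pose o2 s delta : R := q s * (o1 s delta + delta) / x s delta.
pose o3 s delta : R := (q s)^-1 * o2 s delta + delta.
have small eps : 0 < eps -> \forall delta \near 0^'+, forall s,
    [/\ `|o1 s delta| < eps, `|o2 s delta| < eps & `|o3 s delta| < eps].
  move=> eps0; near=> delta => s.
  have [delta0 qx q1 g0 gs] : [/\ 0 < delta, q s <= x s delta, 1 <= q s,
      0 < quantile_gap s delta & quantile_gap s delta + 3 * delta < eps].
    by move: s; near: delta; exact: quantile_gap_small.
  have x0 : 0 < x s delta by lra.
  have q0 : 0 < q s by lra.
  have o10 : 0 < o1 s delta by rewrite /o1; lra.
  have o20 : 0 < o2 s delta by rewrite divr_gt0// mulr_gt0//; lra.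
  have o2le : o2 s delta <= o1 s delta + delta.
    by rewrite ler_pdivrMr// mulrC ler_pM2l//; lra.
  have qo20 : 0 < (q s)^-1 * o2 s delta by rewrite mulr_gt0// invr_gt0.
  have qo2le : (q s)^-1 * o2 s delta <= o2 s delta by rewrite ler_piMl ?(ltW o20)// invf_le1.
  have o30 : 0 < o3 s delta by rewrite /o3; lra.
  by rewrite !gtr0_norm//; split; rewrite /o3 /o1 in o2le *; lra.
exists o1, o2, o3; split.
- by move=> eps /small; apply: filterS => delta h s; have [] := h s.
- by move=> eps /small; apply: filterS => delta h s; have [] := h s.
- by move=> eps /small; apply: filterS => delta h s; have [] := h s.
move=> s delta delta0 delta1 d X.
have d0 := dimension_gt0 s.
have mX : Num.sqrt (d - 1) < X by rewrite chi_modeE//; exact: chi_mode_lt_quantile.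
have X0 : 0 < X by apply: le_lt_trans mX; exact: sqrtr_ge0.
have q0 : 0 < Num.sqrt d by rewrite sqrtr_gt0 ltr0n.
have lnc : 0 < ln c by exact/ln_gt0/comparison_constant_gt1.
split => //; split.
- exact: stat_quantile_lt_chi.
- exact: quantile_shift_lt.
- case: eqP => [d1|/eqP d1] /=.
    by rewrite /d d1 subrr sqrtr0 mul0r.
  have m0 : 0 < Num.sqrt (d - 1).
    by rewrite sqrtr_gt0 subr_gt0 ltr1n ltn_neqAle eq_sym d1.
  have dE : d - 1 = Num.sqrt (d - 1) ^+ 2 by rewrite sqr_sqrtr// subr_ge0 ler1n.
  rewrite ltrD2l ltr_pM2r// ltf_pV2 ?posrE ?subr_gt0//.
    by rewrite ltrD2l ltrN2 ltr_pdivrMr// {1}dE expr2 ltr_pM2l.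
  by rewrite ltr_pdivrMr// {1}dE -expr2 ltrXn2r// ?nnegrE ?sqrtr_ge0 ?(ltW X0).
- by rewrite ltrD2l /o1 /quantile_gap ltrDl.
have E : X * ((Num.sqrt d)^-1 * o2 s delta) = o1 s delta + delta.
  by rewrite /o2 /x /q -/d -/X; field; rewrite !gt_eqF.
split; first by rewrite mulrDr mulr1 ltrD2l E ltrDl.
by rewrite ltr_pM2l// ltrD2l /o3 ltrDl.
Unshelve. all: by end_near. Qed.
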